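(* Let $\boldsymbol{w}=(u,v)\in C^{2}(\overline{\Omega_0})$ be a solution (with some pressure $p$) of the system $$\Delta \boldsymbol{w}-(\boldsymbol{w}\cdot\nabla)\boldsymbol{w}-(ay\partial_x+b\partial_y)\boldsymbol{w}-(av,0)=\nabla p,\qquad \nabla\cdot\boldsymbol{w}=0\qquad\text{in }\Omega_0,$$ with the boundary condition $v(x,0)=0$, $\partial_y u(x,0)=0$ for $|x|>r_0$, and assume $$\int_{\Omega_0}|\nabla\boldsymbol{w}|^{2}\,dx\,dy<\infty.$$ Then $$\lim_{r\to\infty}\frac{|\boldsymbol{w}(r,\theta)|}{\sqrt{\log r}}=0,$$ uniformly in $\theta\in[0,\pi]$.
   Context: Fix $r_0>0$ and real constants $a,b$. Points of the plane are $(x,y)$, with polar coordinates $x=r\cos\theta$, $y=r\sin\theta$; a function $f$ in polar coordinates is written $f(r,\theta)$. $\Omega_0=\{(r,\theta): r>r_0,\ 0<\theta<\pi\}=\mathbb{R}^2_+\setminus\overline{B_{r_0}}$, where $\mathbb{R}^2_+=\{y>0\}$ and $B_{r_0}$ is the disc of radius $r_0$ centered at $0$. $C^2(\overline{\Omega_0})$ means that all derivatives up to order 2 extend continuously to $\overline{\Omega_0}$ (no boundedness at infinity is assumed). *)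

(* Defs.v *)
From HB Require Import structures.
From mathcomp Require Import all_boot all_order all_algebra.
From mathcomp Require Import all_classical all_reals all_analysis.

Set Implicit Arguments.
Unset Strict Implicit.
Unset Printing Implicit Defensive.

Import Order.TTheory GRing.Theory Num.Theory.
Import numFieldNormedType.Exports.

Local Open Scope classical_set_scope.
Local Open Scope ring_scope.

Section PlaneCalculus.
Context {R : realType}.
Implicit Types (f g u v p : R * R -> R) (D : set (R * R)) (z : R * R).

(* The library norm on [R * R] is the sup norm; lengths here are Euclidean. *)
Definition enorm z : R := Num.sqrt (z.1 ^+ 2 + z.2 ^+ 2).

Definition polar (r theta : R) : R * R := (r * cos theta, r * sin theta).

Definition Omega0 (r0 : R) : set (R * R) := [set z | 0 < z.2 /\ r0 < enorm z].

Definition ex : R * R := (1, 0).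
Definition ey : R * R := (0, 1).

Definition dx f : R * R -> R := fun z => 'D_ex f z.
Definition dy f : R * R -> R := fun z => 'D_ey f z.

Definition laplacian f : R * R -> R := fun z => dx (dx f) z + dy (dy f) z.

(* [(w . grad) f] for [w = (u, v)] *)
Definition convection u v f : R * R -> R :=
  fun z => u z * dx f z + v z * dy f z.

Definition grad_sq u v : R * R -> R :=
  fun z => dx u z ^+ 2 + dy u z ^+ 2 + dx v z ^+ 2 + dy v z ^+ 2.

Definition continuous_extension D f g : Prop :=
  {within closure D, continuous g} /\ forall z, D z -> g z = f z.

Fixpoint derivatives_extend (k : nat) D f : Prop :=
  (exists g, continuous_extension D f g) /\
  (if k is k'.+1 then
     [/\ forall z, D z -> derivable f z ex /\ derivable f z ey,
         derivatives_extend k' D (dx f) & derivatives_extend k' D (dy f)]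
   else True).

(* [C^k] on the closure of an open set [D].  Only the values of [f] on the
   closure matter; the first clause says that the boundary values of [f] are
   those of its own continuous extension. *)
Definition Ck_closure (k : nat) D f : Prop :=
  {within closure D, continuous f} /\ derivatives_extend k D f.

Definition solves_system (a b : R) D u v p : Prop :=
  forall z, D z ->
    [/\ differentiable p z,
        laplacian u z - convection u v u z
          - (a * z.2 * dx u z + b * dy u z) - a * v z = dx p z,
        laplacian v z - convection u v v z
          - (a * z.2 * dx v z + b * dy v z) = dy p z
      & dx u z + dy v z = 0].

Definition vanishes_on_flat_boundary (r0 : R) f : Prop :=
  forall x : R, r0 < `|x| -> f (x, 0) = 0.

End PlaneCalculus.

(* Main.v *)
Require Import Defs.
From HB Require Import structures.
From mathcomp Require Import all_boot all_order all_algebra.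
From mathcomp Require Import all_classical all_reals all_analysis.
From mathcomp Require Import measurable_realfun ring lra.
Import Order.TTheory GRing.Theory Num.Theory.
Import numFieldNormedType.Exports.
Local Open Scope classical_set_scope.
Local Open Scope ring_scope.

(* Write w = (u, v), omega = v_x - u_y.  The boundary conditions allow u to be extended evenly and
   v oddly across the x-axis, to a C^1 divergence-free field outside a disc whose vorticity is again
   C^1.  Two facts then drive the proof.  First, for a conjugate pair (A, C) the derivative in s of
   the mean of A over the circle of radius s is bounded by the mean of the Cauchy-Riemann defect:
   for the components of w the defect is |omega|, and for omega itself, paired with a local
   potential Q of the Bernoulli head, it is (|w| + K(1 + |z|)) |omega|.  Second, by Cauchy-Schwarz
   the integral of |grad w| ds dtheta over an annulus s0 < s < s1 is at most the square root of
   (energy of the annulus) * log(s1 / s0).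

   Choosing a point z1 where |w| is at least its value at z0 and is nearly maximal on a comparable
   disc, the second defect bounds omega near z1 at the scale delta ~ 1 / (|w(z1)| + |z1|):
   delta |omega| is small with the energy tail.  Hence the integral of |omega| ds dtheta around z1
   up to radius |z1| / 2 is o(sqrt(log |z1|)) + o(|w(z1)|), so w(z1) is within this error of its
   means over circles about z1, hence of means over circles about the origin, which are
   o(sqrt(log |z1|)).  Absorbing o(|w(z1)|) gives the theorem. *)

Set Implicit Arguments.
Unset Strict Implicit.
Unset Printing Implicit Defensive.

(** Since w is only C^2, omega is only C^1, and the vorticity equation, which differentiates omega
    twice, is avoided. Incompressibility turns the Laplacian of w into the rotated gradient of
    omega, so the momentum equation is already a first-order Cauchy-Riemann system for omega and the
    head [p + |w|^2 / 2 + b v + a y u], perturbed by multiples of omega and by the field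
    [a (-v, u)]. That field has no explicit primitive, but it is closed because w is
    divergence-free: hence a potential that is only local. Its sign jumps under reflection, so the
    reflected head need not be C^1 on the axis, whereas the form left after subtracting this field
    is continuous there.

    The perturbation of omega has |w| as a coefficient and no bound on w is known beforehand; the
    choice of z1 makes |w| comparable to its value at z1 nearby. The price is a term ln |w(z1)|
    coming from delta, for which the crude [ln a <= a] suffices because it enters with a small
    factor. *)

(** * One-variable calculus: derivatives and integrals over segments *)

Section OneVariable.
Context {R : realType}.
Notation leb := (@lebesgue_measure R).
Implicit Types (f g F : R -> R) (a b c x : R).

(** Free of quotients and with [h = 0] allowed: the form used for the chain rule, for local
    modifications and at the axis. *)
Lemma is_derive_epsP f x d :
  is_derive x 1 f d <->
  forall e, 0 < e -> exists2 dl, 0 < dl &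
    forall h, `|h| < dl -> `|f (x + h) - f x - d * h| <= e * `|h|.
Proof.
split.
- move=> [df dE] e e0.
  have : h^-1 *: (f (h *: 1 + x) - f x) @[h --> 0^'] --> d.
    by rewrite -dE; exact: df.
  move/cvgrPdist_le => /(_ _ e0) [dl /= dl0 H].
  exists dl => // h hd; have [->|h0] := eqVneq h 0.
    by rewrite addr0 subrr mulr0 subr0 normr0 mulr0.
  have := H h; rewrite /= sub0r normrN => /(_ hd h0).
  rewrite /GRing.scale /= mulr1 => {}H.
  have -> : f (x + h) - f x - d * h = - (h * (d - h^-1 * (f (h + x) - f x))).
    by rewrite mulrBr mulrA divff// mul1r [h + x]addrC; ring.
  by rewrite normrN normrM mulrC ler_wpM2r.
- move=> H; have cv : h^-1 *: (f (h *: 1 + x) - f x) @[h --> 0^'] --> d.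
    apply/cvgrPdist_le => e e0; have [dl dl0 {}H] := H _ e0.
    exists dl => // h; rewrite /= sub0r normrN => /H{}H h0.
    rewrite /GRing.scale /= mulr1 [h + x]addrC.
    have -> : d - h^-1 * (f (x + h) - f x) = - (h^-1 * (f (x + h) - f x - d * h)).
      by rewrite -[d in LHS](mulKf h0); ring.
    by rewrite normrN normrM normfV mulrC ler_pdivrMr// normr_gt0.
  by split; [apply/cvg_ex; exists d|exact/cvg_lim].
Qed.

Lemma is_derive_cts f x d : is_derive x 1 f d -> {for x, continuous f}.
Proof. by move=> [df _]; exact/differentiable_continuous/derivable1_diffP. Qed.

Lemma MVT_cc f df a b : a < b -> (forall x, a <= x <= b -> is_derive x 1 f (df x)) ->
  exists2 c, a < c < b & f b - f a = df c * (b - a).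
Proof.
move=> ab H; have [||c] := @MVT R f df a b ab.
- by move=> x; rewrite in_itv/= => /andP[/ltW ? /ltW ?]; apply: H; apply/andP.
- apply: derivable_within_continuous => x; rewrite in_itv/= => xab.
  by have [] := H _ xab.
- by rewrite in_itv/= => ? ?; exists c.
Qed.

Definition intg a b f : R := \int[leb]_(x in `[a, b]) f x.

Lemma cts_within f (A : set R) : continuous f -> {within A, continuous f}.
Proof. exact: continuous_subspaceT. Qed.

Lemma cts_intgble a b f : {within `[a, b], continuous f} ->
  leb.-integrable `[a, b] (EFin \o f).
Proof. by apply: continuous_compact_integrable; exact: segment_compact. Qed.

Lemma intgE a b f : {within `[a, b], continuous f} ->
  (\int[leb]_(x in `[a, b]) (f x)%:E)%E = (intg a b f)%:E.
Proof.
move=> cf; rewrite /intg /Rintegral fineK//.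
by apply: integrable_fin_num => //; exact: cts_intgble.
Qed.

Lemma eq_intg a b f g : (forall x, a <= x <= b -> f x = g x) ->
  intg a b f = intg a b g.
Proof. by move=> fg; apply: eq_Rintegral => x; rewrite inE/= in_itv/=; exact: fg. Qed.

Lemma intgD a b f g : continuous f -> continuous g ->
  intg a b (fun x => f x + g x) = intg a b f + intg a b g.
Proof. by move=> cf cg; apply: RintegralD => //; apply/cts_intgble/cts_within. Qed.

Lemma intgB a b f g : continuous f -> continuous g ->
  intg a b (fun x => f x - g x) = intg a b f - intg a b g.
Proof. by move=> cf cg; apply: RintegralB => //; apply/cts_intgble/cts_within. Qed.

Lemma intgZ a b f k : continuous f -> intg a b (fun x => k * f x) = k * intg a b f.
Proof. by move=> cf; apply: RintegralZl => //; apply/cts_intgble/cts_within. Qed.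

Lemma le_intg a b f g : continuous f -> continuous g ->
  (forall x, a <= x <= b -> f x <= g x) -> intg a b f <= intg a b g.
Proof.
by move=> cf cg fg; apply: le_Rintegral => //; apply/cts_intgble/cts_within.
Qed.

Lemma intg_ge0 a b f : (forall x, a <= x <= b -> 0 <= f x) -> 0 <= intg a b f.
Proof. by move=> f0; apply: Rintegral_ge0 => x; rewrite /= in_itv/=; exact: f0. Qed.

Lemma abs_intg a b f : continuous f -> `|intg a b f| <= intg a b (fun x => `|f x|).
Proof. by move=> cf; apply: le_normr_Rintegral => //; apply/cts_intgble/cts_within. Qed.

Lemma intg_cst a b k : a <= b -> intg a b (fun=> k) = (b - a) * k.
Proof.
move=> ab; rewrite /intg Rintegral_cst//= lebesgue_measure_itv/= lte_fin.
case: ltP => [_|ba]; first by rewrite -EFinB /= mulrC.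
by have -> : b = a by [apply/eqP; rewrite eq_le ba ab]; rewrite subrr mul0r mulr0.
Qed.

Lemma intgg a f : intg a a f = 0.
Proof. by rewrite /intg set_itv1 Rintegral_set1. Qed.

Lemma intg_split a b c f : a <= b -> b <= c -> {within `[a, c], continuous f} ->
  intg a c f = intg a b f + intg b c f.
Proof.
move=> ab bc cf; have i := cts_intgble cf.
have ib : leb.-integrable `]b, c] (EFin \o f).
  apply: (integrableS _ _ _ i) => //.
  by apply: subset_itv; rewrite bnd_simp.
have := @Rintegral_itvB R f (BLeft a) (BRight c) b i.
rewrite !bnd_simp => /(_ ab bc).
rewrite Rintegral_itv_obnd_cbnd// => /eqP; rewrite subr_eq => /eqP.
by rewrite /intg => ->; rewrite addrC.
Qed.

Lemma intg_FTC2 a b F f : a <= b -> {within `[a, b], continuous f} ->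
  (forall x, a <= x <= b -> is_derive x 1 F (f x)) -> intg a b f = F b - F a.
Proof.
rewrite le_eqVlt => /predU1P[<- *|ab cf dF]; first by rewrite intgg subrr.
apply: EFin_inj; rewrite -intgE// EFinB; apply: continuous_FTC2 => //.
- have cF : {within `[a, b], continuous F}.
    apply: derivable_within_continuous => x; rewrite in_itv/= => xab.
    by have [] := dF _ xab.
  have [cF1 cFa cFb] := (continuous_within_itvP F ab).1 cF.
  split => //.
  move=> x; rewrite in_itv/= => /andP[/ltW ax /ltW xb].
  by have [] := dF x; first by rewrite ax xb.
- move=> x; rewrite in_itv/= => /andP[/ltW ax /ltW xb].
  by rewrite derive1E; have [|_ ->] := dF x; first by rewrite ax xb.
Qed.

Lemma intg_FTC1 a x f : continuous f -> a < x ->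
  is_derive x 1 (fun y => intg a y f) (f x).
Proof.
move=> cf ax; have x1 : x < x + 1 by rewrite ltrDl.
have [d e] := continuous_FTC1_closed x1 (cts_intgble (cts_within cf)) ax (cf x).
by rewrite -e derive1E; exact: DeriveDef.
Qed.

End OneVariable.

(** * Integrals depending on a parameter, Fubini, affine substitution *)

Section TwoVariables.
Context {R : realType}.
Implicit Types (h g : R * R -> R).
Notation mR := (measurableTypeR R).
Notation leb := (@lebesgue_measure R).

(** The sigma-algebra here is the product one; an open set belongs to it as a countable union of
    boxes with rational endpoints. *)
Lemma open_measurable2 (O : set (R * R)) : open O ->
  measurable (O : set (mR * mR)).
Proof.
move=> oO.
pose box (q : rat * rat * rat * rat) : set (mR * mR) :=
  `]ratr q.1.1.1, ratr q.1.1.2[%classic `*` `]ratr q.1.2, ratr q.2[%classic.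
have -> : O = \bigcup_(q in [set q | box q `<=` O]) box q.
  apply/seteqP; split => [z Oz|z [q /= + zq]]; last exact.
  rewrite openE in oO; have /nbhs_ballP[e /= e0 ze] := oO z Oz.
  have [p1] := @rat_in_itvoo R (z.1 - e) z.1 ltac:(lra).
  have [p2] := @rat_in_itvoo R z.1 (z.1 + e) ltac:(lra).
  have [p3] := @rat_in_itvoo R (z.2 - e) z.2 ltac:(lra).
  have [p4] := @rat_in_itvoo R z.2 (z.2 + e) ltac:(lra).
  rewrite !in_itv/= => /andP[h1 h2] /andP[h3 h4] /andP[h5 h6] /andP[h7 h8].
  exists (p1, p2, p3, p4).
    move=> w [] /=; rewrite !in_itv/= => /andP[a1 a2] /andP[a3 a4].
    by apply: ze; split => /=; rewrite /ball/= ltr_norml; apply/andP; split; lra.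
  by split; rewrite /= in_itv/=; apply/andP.
rewrite bigcup_mkcond; apply: countable_bigcupT_measurable; first exact: countableP.
move=> q; case: ifPn => // _; rewrite /box.
by apply: measurableX; exact: measurable_itv.
Qed.

Lemma cts_measurable2 h : continuous h ->
  measurable_fun (setT : set (mR * mR)) (h : mR * mR -> mR).
Proof.
move=> /continuousP ch; apply: (measurability _ (measurable_realfun.RGenOpens.measurableE R)).
move=> _ [_ [a [b ->] <-]]; rewrite setTI; apply: open_measurable2.
exact/ch/interval_open.
Qed.

Lemma cts_pair (T : topologicalType) (f g : T -> R) x :
  {for x, continuous f} -> {for x, continuous g} ->
  {for x, continuous (fun x => (f x, g x))}.
Proof. by move=> cf cg; exact: (cvg_pair cf cg). Qed.

Lemma cts_secl h s : continuous h -> continuous (fun t => h (s, t)).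
Proof.
move=> ch t; apply: (@continuous_comp _ _ _ (fun t => (s, t)) h); last exact: ch.
by apply: cts_pair; [exact: cvg_cst|exact: cvg_id].
Qed.

Lemma cts_secr h t : continuous h -> continuous (fun s => h (s, t)).
Proof.
move=> ch s; apply: (@continuous_comp _ _ _ (fun s => (s, t)) h); last exact: ch.
by apply: cts_pair; [exact: cvg_id|exact: cvg_cst].
Qed.

Lemma cts_bound h a b c d : continuous h ->
  exists M, forall s t, a <= s <= b -> c <= t <= d -> `|h (s, t)| <= M.
Proof.
move=> ch; have K : compact (`[a, b]%classic `*` `[c, d]%classic : set (R * R)).
  by apply: compact_setX; exact: segment_compact.
have [E|/set0P NE] := eqVneq (`[a, b]%classic `*` `[c, d]%classic : set (R * R)) set0.
  exists 0 => s t sab tcd; suff : set0 (s, t) by [].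
  by rewrite -E; split; rewrite /= in_itv.
have [|m _ Hm] := @compact_EVT_max _ R (fun z => `|h z|) _ NE K.
  apply: continuous_subspaceT => z; apply: continuous_comp; first exact: ch.
  exact: norm_continuous.
exists `|h m| => s t sab tcd; apply: Hm; rewrite inE.
by split; rewrite /= in_itv.
Qed.

(** Dominated convergence: [h] is bounded by a constant on a compact box around [s0]. *)
Lemma cts_intg_param a b h : continuous h ->
  continuous (fun s => intg a b (fun t => h (s, t))).
Proof.
move=> ch s0; have [M HM] := cts_bound (s0 - 1) (s0 + 1) a b ch.
have := @continuity_under_integral R _ _ leb (fun s t => h (s, t)) `[a, b] _
  (s0 - 1) (s0 + 1) _ _ (fun=> M) _ _ s0.
apply => //.
- by move=> x _; apply/cts_intgble/cts_within/cts_secl.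
- by apply/aeW => y _ s _; exact: cts_secr.
- by apply/cts_intgble/cts_within => ?; exact: cvg_cst.
- move=> x /=; rewrite in_itv/= => /andP[x1 x2]; apply/aeW => y /=.
  by rewrite in_itv/= => yab; apply: HM => //; rewrite !ltW.
- by rewrite inE/= in_itv/=; apply/andP; split; lra.
Qed.

Lemma intg_swap a b c d h : continuous h ->
  intg a b (fun s => intg c d (fun t => h (s, t))) =
  intg c d (fun t => intg a b (fun s => h (s, t))).
Proof.
move=> ch; have [M HM] := cts_bound a b c d ch.
pose D : set (mR * mR) := `[a, b]%classic `*` `[c, d]%classic.
have mD : measurable D by apply: measurableX.
(* Extension by zero outside the rectangle, so that Fubini on the whole product space applies. *)
pose f : mR * mR -> \bar R := (EFin \o h) \_ D.
have lt1 : ((leb \x leb)%E D < +oo)%E.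
  rewrite product_measure1E//= /= !lebesgue_measure_itv/=.
  by do 2 case: ifP => _; rewrite ?mule0 ?mul0e -?EFinB -?EFinM ltry.
have fi : (leb \x leb)%E.-integrable setT f.
  rewrite /f; apply/integrable_restrict => //; rewrite setTI.
  apply: measurable_bounded_integrable => //.
    by apply: measurable_funTS; exact: cts_measurable2.
  exists M; split; first exact: num_real.
  move=> y My z [] /=; rewrite !in_itv/= => z1 z2.
  by rewrite (le_trans _ (ltW My))//; case: z z1 z2 => s t; exact: HM.
have := Fubini fi.
have secl s : (\int[leb]_y f (s, y) = ((fun s => intg c d (fun t => h (s, t))) \_ `[a, b] s)%:E)%E.
  rewrite /f !patchE; case: ifPn => [|] sab.
    rewrite -intgE; last by apply/cts_within/cts_secl.
    rewrite [RHS]integral_mkcond; apply: eq_integral => y _; rewrite !patchE.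
    rewrite /D; congr (if _ then _ else _); apply/idP/idP; rewrite !inE//=.
      by case.
    by split => //; rewrite inE in sab.
  rewrite integral0_eq// => y _; rewrite patchE ifF//; apply/negbTE; apply: contra sab.
  by rewrite !inE => -[].
have secr t : (\int[leb]_x f (x, t) = ((fun t => intg a b (fun s => h (s, t))) \_ `[c, d] t)%:E)%E.
  rewrite /f !patchE; case: ifPn => [|] sab.
    rewrite -intgE; last by apply/cts_within/cts_secr.
    rewrite [RHS]integral_mkcond; apply: eq_integral => y _; rewrite !patchE.
    rewrite /D; congr (if _ then _ else _); apply/idP/idP; rewrite !inE//=.
      by case.
    by split => //; rewrite inE in sab.
  rewrite integral0_eq// => y _; rewrite patchE ifF//; apply/negbTE; apply: contra sab.
  by rewrite !inE => -[].
under eq_integral do rewrite secl.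
under [in X in _ = X -> _]eq_integral do rewrite secr.
move=> E; rewrite {1}/intg [RHS]/intg Rintegral_mkcond [RHS]Rintegral_mkcond.
by rewrite /Rintegral E.
Qed.

(** Lebesgue measure equals [c] times its pushforward under [x |-> c * x + d], as both agree on
    half-open intervals. No continuity of [h] is assumed because indicators are integrated below. *)
Lemma integral_affine (c d : R) (h : mR -> \bar R) : 0 < c ->
  measurable_fun [set: mR] h -> (forall x, 0 <= h x)%E ->
  (\int[leb]_x h x = c%:E * \int[leb]_x h (c * x + d)%R)%E.
Proof.
move=> c0 mh h0.
pose phi : mR -> mR := fun x => c * x + d.
have mphi : measurable_fun [set: mR] phi.
  by apply: measurable_funD => //; apply: measurable_funM.
pose cn := NngNum (ltW c0).
rewrite (eq_measure_integral (mscale cn (pushforward leb phi))); last first.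
  move=> A mA _; apply: lebesgue_measure_unique => // _ [[a b]] _ <-.
  have E : phi @^-1` `]a, b] = `](a - d) / c, (b - d) / c]%classic.
    apply/seteqP; split => x; rewrite /phi /= !in_itv/= ltr_pdivrMr// ler_pdivlMr//;
    by rewrite ltrBlDr lerBrDr mulrC.
  transitivity (cn%:num%:E * leb (phi @^-1` `]a, b]))%E; last by [].
  rewrite E.
  rewrite !lebesgue_measure_itv/= !lte_fin ltr_pM2r ?invr_gt0//.
  rewrite ltrD2r; case: ifP => _; last by rewrite mule0.
  rewrite -!EFinB -EFinM; congr (_%:E); rewrite -mulrBl mulrCA divff ?gt_eqF//; ring.
rewrite ge0_integral_mscale//= ge0_integral_pushforward//.
Qed.

Lemma integral_oppr (h : mR -> \bar R) :
  measurable_fun [set: mR] h -> (forall x, 0 <= h x)%E ->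
  (\int[leb]_x h x = \int[leb]_x h (- x)%R)%E.
Proof.
move=> mh h0; rewrite -[RHS](@ge0_integral_pushforward _ _ _ _ _ (-%R : mR -> mR) _ leb setT h)//.
- by apply: eq_measure_integral => A mA _; exact/esym/lebesgue_measureN.
Qed.

End TwoVariables.

(** * Polar coordinates in one wedge *)

Section Polar.
Context {R : realType}.
Notation mR := (measurableTypeR R).
Notation leb := (@lebesgue_measure R).
Notation leb2 := (leb \x leb)%E.
Implicit Types (g : R * R -> R) (G : mR * mR -> mR).

(* In the wedge [|theta| < pi / 4], polar coordinates are [(s, t) |-> (s cos theta, s sin theta)]
   with [t = tan theta]; they factor into one-variable substitutions. *)
Definition wedge : set (mR * mR) := [set z | 0 < z.1 /\ - z.1 <= z.2 < z.1].
Definition strip : set (mR * mR) := [set z | 0 < z.1 /\ -1 <= z.2 < 1].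

Definition cos_of_tan (t : R) : R := (Num.sqrt (1 + t ^+ 2))^-1.

Lemma measurable_set_lt (d : measure_display) (T : measurableType d) (f g : T -> R) :
  measurable_fun setT f -> measurable_fun setT g ->
  measurable [set x | f x < g x].
Proof.
move=> mf mg; have /(_ measurableT [set true] I) := measurable_fun_ltr mf mg.
by rewrite setTI; congr measurable; apply/seteqP; split.
Qed.

Lemma measurable_set_le (d : measure_display) (T : measurableType d) (f g : T -> R) :
  measurable_fun setT f -> measurable_fun setT g ->
  measurable [set x | f x <= g x].
Proof.
move=> mf mg; have /(_ measurableT [set true] I) := measurable_fun_ler mf mg.
by rewrite setTI; congr measurable; apply/seteqP; split.
Qed.

Lemma measurable_wedge : measurable wedge.
Proof.
have -> : wedge = [set z : mR * mR | 0 < z.1] `&`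
    ([set z : mR * mR | - z.1 <= z.2] `&` [set z : mR * mR | z.2 < z.1]).
  by apply/seteqP; split => z /=; rewrite /wedge /=; [move=> [? /andP[]]|move=> [? [? ?]]; split=> //; apply/andP].
apply: measurableI; first exact: measurable_set_lt.
apply: measurableI; last exact: measurable_set_lt.
by apply: measurable_set_le => //; exact: measurableT_comp.
Qed.

Lemma measurable_strip : measurable strip.
Proof.
have -> : strip = [set z : mR * mR | 0 < z.1] `&`
    ([set z : mR * mR | -1 <= z.2] `&` [set z : mR * mR | z.2 < 1]).
  by apply/seteqP; split => z /=; rewrite /strip /=; [move=> [? /andP[]]|move=> [? [? ?]]; split=> //; apply/andP].
apply: measurableI; first exact: measurable_set_lt.
by apply: measurableI; [exact: measurable_set_le|exact: measurable_set_lt].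
Qed.

Lemma cos_of_tan_gt0 t : 0 < cos_of_tan t.
Proof. by rewrite invr_gt0 sqrtr_gt0 ltr_pwDl// sqr_ge0. Qed.

Lemma continuous_cos_of_tan : continuous cos_of_tan.
Proof.
move=> t; apply: cvgV; first by rewrite gt_eqF// sqrtr_gt0 ltr_pwDl// sqr_ge0.
apply: continuous_comp; last exact: sqrt_continuous.
by apply: cvgD; [exact: cvg_cst|exact: exprn_continuous].
Qed.

(** For fixed [x] substitute [y = x * t], with Jacobian [x]; exchange the integrals; for fixed [t]
    substitute [x = s * cos_of_tan t]. Both substitutions are linear, so [integral_affine] suffices
    for measurable [G]. *)
Lemma wedge_integral G : measurable_fun setT G -> (forall z, 0 <= G z) ->
  (\int[leb2]_z (\1_wedge z * G z)%:E =
   \int[leb]_s \int[leb]_t (\1_strip (s, t) *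
     (s * cos_of_tan t ^+ 2 * G (s * cos_of_tan t, s * cos_of_tan t * t)))%:E)%E.
Proof.
move=> mG G0.
have m1 : measurable_fun setT (fst : mR * mR -> mR) by [].
have m2 : measurable_fun setT (snd : mR * mR -> mR) by [].
have mind A : measurable A -> measurable_fun setT (\1_A : mR * mR -> mR).
  by move=> mA; exact: measurable_indic.
have mw : measurable_fun setT (fun z : mR * mR => \1_wedge z * G z).
  by apply: measurable_funM => //; exact: (mind _ measurable_wedge).
have mcost : measurable_fun [set: mR * mR] (fun z : mR * mR => cos_of_tan z.2).
  apply: (@measurableT_comp _ _ _ _ _ _ (cos_of_tan : mR -> mR)) => //.
  exact: (continuous_measurable_fun continuous_cos_of_tan).
pose G1 (z : mR * mR) := \1_strip z * (z.1 * G (z.1, z.1 * z.2)).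
have mG1 : measurable_fun setT G1.
  apply: measurable_funM; first exact: (mind _ measurable_strip).
  apply: measurable_funM => //; apply: measurableT_comp => //.
  by apply: measurable_fun_pair => //; exact: measurable_funM.
pose G2 (z : mR * mR) := \1_strip z *
     (z.1 * cos_of_tan z.2 ^+ 2 * G (z.1 * cos_of_tan z.2, z.1 * cos_of_tan z.2 * z.2)).
have mG2 : measurable_fun setT G2.
  apply: measurable_funM; first exact: (mind _ measurable_strip).
  have mc : measurable_fun setT (fun z : mR * mR => z.1 * cos_of_tan z.2) by apply: measurable_funM.
  apply: measurable_funM => //.
    by apply: measurable_funM => //; exact: measurable_funX.
  apply: measurableT_comp => //; apply: measurable_fun_pair => //.
  exact: measurable_funM.
have E1 : (\int[leb2]_z (\1_wedge z * G z)%:E = \int[leb]_x \int[leb]_t (G1 (x, t))%:E)%E.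
  rewrite fubini_tonelli1; last 2 first.
  - exact/measurable_EFinP.
  - by move=> z; rewrite lee_fin mulr_ge0// indicE.
  apply: eq_integral => x _; rewrite /fubini_F/=.
  have [x0|x0] := ltP 0 x; last first.
    rewrite !integral0_eq// => t _; rewrite ?/G1 indicE memNset ?mul0r//=;
    by move=> []/=; rewrite ltNge x0.
  rewrite (@integral_affine R x 0)//; last 2 first.
  - apply/measurable_EFinP; apply: (@measurableT_comp _ _ _ _ _ _ (fun z : mR * mR => \1_wedge z * G z)) => //.
  - by move=> t; rewrite lee_fin mulr_ge0// indicE.
  rewrite -ge0_integralZl//; last 3 first.
  - apply/measurable_EFinP; apply: (@measurableT_comp _ _ _ _ _ _ (fun z : mR * mR => \1_wedge z * G z)) => //.
    apply: measurable_fun_pair => //; apply: measurable_funD => //; exact: measurable_funM.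
  - by move=> t _; rewrite lee_fin mulr_ge0// indicE.
  - by rewrite lee_fin ltW.
  apply: eq_integral => t _; rewrite -EFinM /G1 /= addr0; congr EFin.
  rewrite mulrCA; congr (_ * _); rewrite !indicE; congr (_%:R); congr nat_of_bool.
  apply/idP/idP; rewrite !inE /wedge /strip /=.
    move=> [_ /andP[h1 h2]]; split => //; apply/andP; split; nra.
  by move=> [_ /andP[h1 h2]]; split => //; apply/andP; split; nra.
have G10 z : 0 <= G1 z.
  rewrite /G1 indicE; case: (boolP (z \in strip)) => [|_]; last by rewrite mul0r.
  by rewrite inE => -[/ltW z0 _]; rewrite mul1r mulr_ge0.
have G20 z : 0 <= G2 z.
  rewrite /G2 indicE; case: (boolP (z \in strip)) => [|_]; last by rewrite mul0r.
  by rewrite inE => -[/ltW z0 _]; rewrite mul1r !mulr_ge0 ?exprn_ge0 ?(ltW (cos_of_tan_gt0 _)).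
rewrite E1 (fubini_tonelli (fun z => (G1 z)%:E)); last 2 first.
- exact/measurable_EFinP.
- by move=> z; rewrite lee_fin.
rewrite [RHS](fubini_tonelli (fun z => (G2 z)%:E)); last 2 first.
- exact/measurable_EFinP.
- by move=> z; rewrite lee_fin.
apply: eq_integral => t _; have c0 := cos_of_tan_gt0 t.
rewrite (@integral_affine R (cos_of_tan t) 0)//; last 2 first.
- by apply/measurable_EFinP; exact: (@measurableT_comp _ _ _ _ _ _ G1).
- by move=> x; rewrite lee_fin.
rewrite -ge0_integralZl//; last 3 first.
- apply/measurable_EFinP; apply: (@measurableT_comp _ _ _ _ _ _ G1) => //.
  apply: measurable_fun_pair => //; apply: measurable_funD => //; exact: measurable_funM.
- by move=> x _; rewrite lee_fin.
- by rewrite lee_fin ltW.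
apply: eq_integral => x _; rewrite -EFinM /G1 /G2/= addr0; congr EFin.
rewrite [cos_of_tan t * x]mulrC mulrCA; congr (_ * _); last by ring.
rewrite !indicE; congr (_%:R); congr nat_of_bool.
by apply/idP/idP; rewrite !inE /strip /= pmulr_lgt0.
Qed.

Definition rot90 (z : R * R) : R * R := (- z.2, z.1).

Lemma measurable_rot90 : measurable_fun setT (rot90 : mR * mR -> mR * mR).
Proof. by apply: measurable_fun_pair => //; exact: measurableT_comp. Qed.

Lemma rot_integral G : measurable_fun setT G -> (forall z, 0 <= G z) ->
  (\int[leb2]_z (G (rot90 z))%:E = \int[leb2]_z (G z)%:E)%E.
Proof.
move=> mG G0.
rewrite fubini_tonelli1; last 2 first.
- by apply/measurable_EFinP; apply: (measurableT_comp mG); exact: measurable_rot90.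
- by move=> z; rewrite lee_fin.
rewrite (fubini_tonelli2 (fun z => (G z)%:E)); last 2 first.
- exact/measurable_EFinP.
- by move=> z; rewrite lee_fin.
apply: eq_integral => x _; rewrite /fubini_F /fubini_G/= /rot90/=.
rewrite integral_oppr//.
- by under eq_integral do rewrite opprK.
- apply/measurable_EFinP; apply: (measurableT_comp mG).
  by apply: measurable_fun_pair => //; exact: measurableT_comp.
- by move=> y; rewrite lee_fin.
Qed.

(** The factor [cos_of_tan t ^+ 2] left over in [wedge_integral] is the derivative of [atan]. *)
Lemma intg_atan (f : R -> R) : continuous f ->
  intg (- (pi / 4)) (pi / 4) f = intg (-1) 1 (fun t => f (atan t) * cos_of_tan t ^+ 2).
Proof.
move=> cf.
have costE t : cos_of_tan t ^+ 2 = (1 + t ^+ 2)^-1.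
  by rewrite /cos_of_tan exprVn sqr_sqrtr// addr_ge0// sqr_ge0.
have D : derive1 (@atan R) = fun t => cos_of_tan t ^+ 2.
  by apply/funext => t; rewrite derive1_atan costE.
have cD : continuous (fun t => cos_of_tan t ^+ 2).
  move=> t; apply: (@continuous_comp _ _ _ cos_of_tan (fun x => x ^+ 2)); first exact: continuous_cos_of_tan.
  exact: exprn_continuous.
have ca : continuous (@atan R) by move=> t; exact: continuous_atan.
have := @integration_by_substitution_increasing R (@atan R) f (-1) 1 _ _ _ _ _ _ _.
rewrite D atanN atan1 => E; apply: EFin_inj; rewrite -!intgE; last 2 first.
- apply: cts_within => t; apply: cvgM; last exact: cD.
  by apply: continuous_comp; [exact: ca|exact: cf].
- exact: cts_within.
apply: E => //.
- by move=> x y _ _; exact: lt_atan.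
- by apply/cvg_ex; exists (cos_of_tan (-1) ^+ 2); apply: cvg_at_right_filter; exact: cD.
- by apply/cvg_ex; exists (cos_of_tan 1 ^+ 2); apply: cvg_at_left_filter; exact: cD.
- split; first by move=> x _; exact: derivable_atan.
  + by apply: cvg_at_right_filter; exact: ca.
  + by apply: cvg_at_left_filter; exact: ca.
- exact: cts_within.
Qed.

Definition cpt (c : R * R) (s phi : R) : R * R := (c.1 + s * cos phi, c.2 + s * sin phi).

Definition annulus (s1 s2 : R) : set (mR * mR) := [set z | s1 <= enorm z <= s2].

Lemma continuous_enorm : continuous (@enorm R).
Proof.
move=> z; apply: (@continuous_comp _ _ _ (fun z : R * R => z.1 ^+ 2 + z.2 ^+ 2) Num.sqrt).
  apply: cvgD.
    apply: (@continuous_comp _ _ _ fst (fun x : R => x ^+ 2)); [exact: cvg_fst|exact: exprn_continuous].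
  apply: (@continuous_comp _ _ _ snd (fun x : R => x ^+ 2)); [exact: cvg_snd|exact: exprn_continuous].
exact: sqrt_continuous.
Qed.

Lemma measurable_annulus s1 s2 : measurable (annulus s1 s2).
Proof.
have -> : annulus s1 s2 = [set z : mR * mR | s1 <= enorm z] `&` [set z : mR * mR | enorm z <= s2].
  by apply/seteqP; split => z /=; rewrite /annulus /=; [move=> /andP[]|move=> [? ?]; apply/andP].
have m := cts_measurable2 continuous_enorm.
by apply: measurableI; exact: measurable_set_le.
Qed.

Lemma cts_cpt c : continuous (fun z : R * R => cpt c z.1 z.2).
Proof.
move=> z; apply: (@cts_pair _ _ (fun z : R * R => c.1 + z.1 * cos z.2)
  (fun z : R * R => c.2 + z.1 * sin z.2)).
- apply: cvgD; first exact: cvg_cst.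
  apply: cvgM; first exact: cvg_fst.
  by apply: (@continuous_comp _ _ _ snd cos); [exact: cvg_snd|exact: continuous_cos].
- apply: cvgD; first exact: cvg_cst.
  apply: cvgM; first exact: cvg_fst.
  by apply: (@continuous_comp _ _ _ snd sin); [exact: cvg_snd|exact: continuous_sin].
Qed.

Lemma wedge_polar g s1 s2 : continuous g -> (forall z, 0 <= g z) -> 0 <= s1 -> s1 <= s2 ->
  (\int[leb2]_z (\1_wedge z * (g z * \1_(annulus s1 s2) z))%:E =
   (intg s1 s2 (fun s => s * intg (- (pi / 4)) (pi / 4) (fun phi => g (cpt 0 s phi))))%:E)%E.
Proof.
move=> cg g0 s10 s12.
have cgp : continuous (fun z : R * R => g (cpt 0 z.1 z.2)).
  by move=> z; apply: continuous_comp; [exact: cts_cpt|exact: cg].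
have cin : continuous (fun s : R => s * intg (- (pi / 4)) (pi / 4) (fun phi => g (cpt 0 s phi))).
  by move=> s; apply: cvgM; [exact: cvg_id|exact: (@cts_intg_param _ (- (pi / 4)) (pi / 4) _ cgp s)].
rewrite (wedge_integral (G := fun z => g z * \1_(annulus s1 s2) z)); last 2 first.
- apply: measurable_funM; first exact: cts_measurable2.
  by apply: measurable_indic; exact: measurable_annulus.
- by move=> z; rewrite mulr_ge0// indicE.
rewrite -intgE; last exact: cts_within.
rewrite [RHS]integral_mkcond; apply: eq_integral => s _; rewrite patchE.
have [s0|s0] := leP s 0.
  rewrite integral0_eq; last first.
    move=> t _; rewrite indicE memNset ?mul0r//.
    by rewrite /strip /= => -[]; rewrite ltNge s0.
  case: ifPn => //; rewrite inE/= in_itv/= => /andP[s1s _].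
  have -> : s = 0 by lra.
  by rewrite mul0r.
have encost t : enorm (s * cos_of_tan t, s * cos_of_tan t * t) = s.
  rewrite /enorm/= [X in Num.sqrt X](_ : _ = s ^+ 2 * (cos_of_tan t ^+ 2 * (1 + t ^+ 2))); last by ring.
  rewrite /cos_of_tan exprVn sqr_sqrtr ?addr_ge0 ?sqr_ge0// mulVf ?mulr1.
    by rewrite sqrtr_sqr gtr0_norm.
  by rewrite gt_eqF// ltr_pwDl// sqr_ge0.
case: ifPn; last first.
  rewrite notin_setE/= in_itv/= => /negP ns.
  rewrite integral0_eq// => t _; rewrite [\1_(annulus _ _) _]indicE memNset ?mulr0//.
  by rewrite /annulus /= encost; exact/negP.
rewrite inE/= in_itv/= => s12'.
rewrite intg_atan; last by move=> phi; exact: (cts_secl (h := fun z => g (cpt 0 z.1 z.2))).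
have cs : continuous (fun t : R => g (cpt 0 s (atan t)) * cos_of_tan t ^+ 2).
  move=> t; apply: cvgM.
    apply: (@continuous_comp _ _ _ (fun t => (s, atan t)) (fun z => g (cpt 0 z.1 z.2))).
      by apply: cts_pair; [exact: cvg_cst|exact: continuous_atan].
    exact: cgp.
  apply: (@continuous_comp _ _ _ cos_of_tan (fun x => x ^+ 2)); first exact: continuous_cos_of_tan.
  exact: exprn_continuous.
rewrite -intgZ// -intgE; last first.
  by apply: cts_within => t; apply: cvgM; [exact: cvg_cst|exact: cs].
(* [strip] is half-open in [t]; dropping the endpoint 1 does not change the integral. *)
rewrite -(@integral_itv_bndo_bndc _ (BLeft (-1)) 1); last first.
  apply/measurable_EFinP; apply: measurable_funTS; apply: continuous_measurable_fun => t.
  by apply: cvgM; [exact: cvg_cst|exact: cs].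
rewrite [RHS]integral_mkcond; apply: eq_integral => t _; rewrite patchE indicE.
have -> : ((s, t) \in strip) = (t \in `[(-1), 1[%classic).
  by apply/idP/idP; rewrite !inE /strip /= in_itv/=; [case|split].
case: ifPn => _; last by rewrite mul0r.
rewrite mul1r [\1_(annulus _ _) _]indicE mem_set ?mulr1; last by rewrite /annulus/= encost.
congr EFin; rewrite mulrC [RHS]mulrC mulrAC -!mulrA; congr (_ * _).
  rewrite /cpt /= !add0r cos_atan -/(cos_of_tan t); congr (g (_, _)).
  have -> : sin (atan t) = cos_of_tan t * t.
    rewrite -[X in _ * X](atanK t) /tan cos_atan -/(cos_of_tan t) mulrCA divff ?mulr1//.
    by rewrite gt_eqF// cos_of_tan_gt0.
  by rewrite [t * _]mulrC.
by rewrite mulrCA mulrC -mulrA.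
Qed.

End Polar.

(** * Polar coordinates in the plane, about any centre *)

Section PolarCoordinates.
Context {R : realType}.
Notation mR := (measurableTypeR R).
Notation leb := (@lebesgue_measure R).
Notation leb2 := (leb \x leb)%E.
Implicit Types (g : R * R -> R) (G : mR * mR -> mR).

(** The wedge contains one of its two boundary rays, so its four rotations cover every nonzero point
    exactly once. *)
Lemma wedge_sum (z : R * R) : z != 0 ->
  \1_wedge z + \1_wedge (rot90 z) + \1_wedge (rot90 (rot90 z))
    + \1_wedge (rot90 (rot90 (rot90 z))) = 1 :> R.
Proof.
have wE (w : R * R) : \1_wedge w = ((- w.1 <= w.2) && (w.2 < w.1))%:R :> R.
  rewrite indicE; congr (_%:R); congr nat_of_bool; apply/idP/idP; rewrite inE /wedge /=.
    by move=> [_ ->].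
  by move=> /andP[h1 h2]; split; [lra|rewrite h1].
case: z => x y; rewrite !wE /rot90 /= => z0.
have {}z0 : (x != 0) || (y != 0).
  by move: z0; apply: contra_neqT; rewrite negb_or !negbK => /andP[/eqP-> /eqP->].
rewrite !opprK !lerN2 !ltrN2 [- x <= y]lerNl [- x < y]ltrNl.
by case: (ltrgtP x y) => xy; case: (ltrgtP x (- y)) => xy';
  rewrite ?addr0 ?add0r//; exfalso; move: z0;
  (have -> : x = 0 by lra); (have -> : y = 0 by lra); rewrite eqxx.
Qed.

Lemma measurable_rotk k : measurable_fun setT (iter k (@rot90 R) : mR * mR -> mR * mR).
Proof.
elim: k => [|k IH]; first exact: measurable_id.
exact: (measurableT_comp (@measurable_rot90 R) IH).
Qed.

Lemma rotk_integral k G : measurable_fun setT G -> (forall z, 0 <= G z) ->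
  (\int[leb2]_z (G (iter k rot90 z))%:E = \int[leb2]_z (G z)%:E)%E.
Proof.
move=> mG G0; elim: k => //= k <-.
rewrite -(@rot_integral R (fun z => G (iter k rot90 z)))//.
- by apply: eq_integral => z _; rewrite -iterS iterSr.
- exact: (measurableT_comp mG (measurable_rotk k)).
Qed.

Lemma rot90_4 (z : R * R) : rot90 (rot90 (rot90 (rot90 z))) = z.
Proof. by case: z => x y; rewrite /rot90 /= !opprK. Qed.

Lemma plane_wedges G : measurable_fun setT G -> (forall z, 0 <= G z) ->
  (\int[leb2]_z (G z)%:E = \sum_(k < 4) \int[leb2]_z (\1_wedge z * G (iter k rot90 z))%:E)%E.
Proof.
move=> mG G0.
have mk k j : measurable_fun setT (fun z : mR * mR => \1_wedge (iter k rot90 z) * G (iter j rot90 z)).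
  apply: measurable_funM; last exact: (measurableT_comp mG (measurable_rotk j)).
  have m1 : measurable_fun setT (\1_(@wedge R) : mR * mR -> mR).
    by apply: measurable_indic; exact: measurable_wedge.
  exact: (measurableT_comp m1 (measurable_rotk k)).
have ge0 k j (z : mR * mR) : 0 <= \1_wedge (iter k rot90 z) * G (iter j rot90 z).
  by rewrite mulr_ge0// indicE.
(* The exponent [4 - k] is undone by [k] further quarter turns, which moves the rotation from the
   indicator onto [G]. The identity fails only at the origin, a null set. *)
transitivity (\int[leb2]_z (\sum_(k < 4) (\1_wedge (iter (4 - k) rot90 z) * G z)%:E))%E.
  apply: ge0_ae_eq_integral => //.
  - exact/measurable_EFinP.
  - apply: emeasurable_sum => k; apply/measurable_EFinP; exact: (mk _ 0%N).
  - by move=> z _; rewrite lee_fin.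
  - by move=> z _; apply: sume_ge0 => k _; rewrite lee_fin; exact: (ge0 _ 0%N).
  - exists ([set 0] `*` [set 0]); split.
    + by apply: measurableX; exact: measurable_set1.
    + have := @product_measure1E _ _ mR mR R leb leb [set 0] [set 0] (measurable_set1 _) (measurable_set1 _).
      by move=> /= ->; rewrite lebesgue_measure_set1 mul0e.
    + move=> z /= H; apply: contrapT => zn; apply: H => _.
      have z0 : z != 0.
        by apply/eqP => z0; apply: zn; rewrite z0.
      rewrite sumEFin; congr EFin; rewrite !big_ord_recl big_ord0 /= /bump /= rot90_4.
      by rewrite -[LHS]mul1r -(wedge_sum z0); ring.
rewrite ge0_integral_sum//; last 2 first.
- by move=> k; apply/measurable_EFinP; exact: (mk _ 0%N).
- by move=> k z _; rewrite lee_fin; exact: (ge0 _ 0%N).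
apply: eq_bigr => k _.
rewrite -(@rotk_integral (4 - k) (fun z => \1_wedge z * G (iter k rot90 z))); last 2 first.
- exact: (mk 0%N).
- by move=> z; exact: (ge0 0%N).
apply: eq_integral => z _; rewrite -iterD subnKC; last exact: ltnW.
by rewrite /= rot90_4.
Qed.

Lemma translate_integral G (c : R * R) : measurable_fun setT G -> (forall z, 0 <= G z) ->
  (\int[leb2]_z (G z)%:E = \int[leb2]_z (G (c + z)%R)%:E)%E.
Proof.
move=> mG G0.
have mt : measurable_fun setT (fun z : mR * mR => c + z : mR * mR).
  by apply: measurable_fun_pair; apply: measurable_funD => //; exact: measurable_cst.
rewrite fubini_tonelli1; last 2 first.
- exact/measurable_EFinP.
- by move=> z; rewrite lee_fin.
rewrite fubini_tonelli1; last 2 first.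
- by apply/measurable_EFinP; exact: (measurableT_comp mG mt).
- by move=> z; rewrite lee_fin.
have mF := @measurable_fun_fubini_tonelli_F _ _ _ _ _ leb (fun z => (G z)%:E).
rewrite (@integral_affine R 1 c.1)//; last 2 first.
- by apply: mF => [|z]; [exact/measurable_EFinP|rewrite lee_fin].
- by move=> x; apply: integral_ge0 => y _; rewrite lee_fin.
rewrite mul1e; apply: eq_integral => x _; rewrite /fubini_F.
rewrite (@integral_affine R 1 c.2)//.
- by rewrite mul1e; apply: eq_integral => y _; rewrite !mul1r [x + _]addrC [y + _]addrC.
- by apply/measurable_EFinP; exact: (measurableT_comp mG).
- by move=> y; rewrite lee_fin.
Qed.

Lemma intg_shift (f : R -> R) a b d : a <= b -> continuous f ->
  intg (a + d) (b + d) f = intg a b (fun x => f (x + d)).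
Proof.
move=> ab cf.
have cfd : continuous (fun x => f (x + d)).
  move=> x; apply: (@continuous_comp _ _ _ (fun x => x + d) f); last exact: cf.
  by apply: cvgD; [exact: cvg_id|exact: cvg_cst].
have dF x : a <= x <= b -> is_derive x 1 (fun x => intg (a + d - 1) (x + d) f) (f (x + d)).
  move=> /andP[ax xb].
  have H := @intg_FTC1 _ (a + d - 1) (x + d) f cf ltac:(lra).
  have -> : f (x + d) = f (x + d) * 1 by rewrite mulr1.
  apply: (@is_derive1_comp _ (fun y => intg (a + d - 1) y f) (fun x => x + d)) => //.
  by apply: is_derive_eq; rewrite addr0.
rewrite [RHS](intg_FTC2 ab (cts_within cfd) dF).
by rewrite (@intg_split _ (a + d - 1) (a + d) (b + d))//; [ring|lra|lra|exact: cts_within].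
Qed.

(* Circles are run over [-pi / 4, 7 pi / 4], the union of the four rotated wedges. *)
Definition ca : R := - (pi / 4).
Definition cb : R := pi * 2 + - (pi / 4).
Definition cint g c s := intg ca cb (fun phi => g (cpt c s phi)).

Lemma ca_le_cb : ca <= cb.
Proof. by rewrite /ca /cb; have := @pi_gt0 R; lra. Qed.

Lemma cts_circ g c s : continuous g -> continuous (fun phi => g (cpt c s phi)).
Proof.
move=> cg; apply: (@cts_secl _ (fun z => g (cpt c z.1 z.2))) => z.
by apply: continuous_comp; [exact: cts_cpt|exact: cg].
Qed.

Lemma cts_cint g c : continuous g -> continuous (cint g c).
Proof.
move=> cg; apply: (@cts_intg_param _ ca cb (fun z => g (cpt c z.1 z.2))) => z.
by apply: continuous_comp; [exact: cts_cpt|exact: cg].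
Qed.

Lemma quarter_le : - (pi / 4) <= pi / 4 :> R.
Proof. by have := @pi_gt0 R; lra. Qed.

Lemma sum4_intg (F : nat -> R -> R) a b : (forall k, continuous (F k)) ->
  \sum_(k < 4) intg a b (F k) =
  intg a b (fun s => F 0%N s + (F 1%N s + (F 2%N s + F 3%N s))).
Proof.
move=> cF; rewrite !big_ord_recl big_ord0 addr0.
have c2 : continuous (fun s => F 2%N s + F 3%N s) by move=> s; apply: cvgD; exact: cF.
have c1 : continuous (fun s => F 1%N s + (F 2%N s + F 3%N s)).
  by move=> s; apply: cvgD; [exact: cF|exact: c2].
by rewrite (intgD _ _ (cF 0%N) c1) (intgD _ _ (cF 1%N) c2) (intgD _ _ (cF 2%N) (cF 3%N)).
Qed.

Lemma intg_quarters (f : R -> R) : continuous f ->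
  let I k := intg (- (pi / 4) + k%:R * (pi / 2)) (pi / 4 + k%:R * (pi / 2)) f in
  I 0%N + (I 1%N + (I 2%N + I 3%N)) = intg ca cb f.
Proof.
move=> cf; have p0 := @pi_gt0 R; rewrite /ca /cb /=.
have -> : - (pi / 4) + 0%:R * (pi / 2) = - (pi / 4) :> R by lra.
have -> : pi / 4 + 0%:R * (pi / 2) = pi / 4 :> R by lra.
have -> : - (pi / 4) + 1%:R * (pi / 2) = pi / 4 :> R by lra.
have -> : - (pi / 4) + 2%:R * (pi / 2) = pi / 4 + 1%:R * (pi / 2) :> R by lra.
have -> : - (pi / 4) + 3%:R * (pi / 2) = pi / 4 + 2%:R * (pi / 2) :> R by lra.
have -> : pi * 2 + - (pi / 4) = pi / 4 + 3%:R * (pi / 2) :> R by lra.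
have l1 : - (pi / 4) <= pi / 4 :> R by lra.
have l0 : - (pi / 4) <= pi / 4 + 3%:R * (pi / 2) :> R by lra.
have l2 : pi / 4 <= pi / 4 + 3%:R * (pi / 2) :> R by lra.
have l3 : pi / 4 <= pi / 4 + 1%:R * (pi / 2) :> R by lra.
have l4 : pi / 4 + 1%:R * (pi / 2) <= pi / 4 + 3%:R * (pi / 2) :> R by lra.
have l5 : pi / 4 + 1%:R * (pi / 2) <= pi / 4 + 2%:R * (pi / 2) :> R by lra.
have l6 : pi / 4 + 2%:R * (pi / 2) <= pi / 4 + 3%:R * (pi / 2) :> R by lra.
have S1 := intg_split l1 l2 (cts_within cf).
have S2 := intg_split l3 l4 (cts_within cf).
have S3 := intg_split l5 l6 (cts_within cf).
by rewrite S1 S2 S3.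
Qed.

Lemma polar_coordinates0 g s1 s2 : continuous g -> (forall z, 0 <= g z) -> 0 <= s1 -> s1 <= s2 ->
  (\int[leb2]_z (g z * \1_(annulus s1 s2) z)%:E =
   (intg s1 s2 (fun s => s * cint g 0 s))%:E)%E.
Proof.
move=> cg g0 s10 s12.
have mG : measurable_fun setT (fun z : mR * mR => g z * \1_(annulus s1 s2) z).
  apply: measurable_funM; first exact: cts_measurable2.
  by apply: measurable_indic; exact: measurable_annulus.
rewrite (@plane_wedges (fun z => g z * \1_(annulus s1 s2) z))//; last first.
  by move=> z; rewrite mulr_ge0// indicE.
have crot : continuous (@rot90 R).
  move=> z; apply: (@cts_pair _ _ (fun z : R * R => - z.2) fst).
    by apply: cvgN; exact: cvg_snd.
  exact: cvg_fst.
have crotk k : continuous (iter k (@rot90 R)).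
  by elim: k => [|k IH] z; [exact: cvg_id|apply: (continuous_comp (IH z)); exact: crot].
have arot (z : R * R) : \1_(annulus s1 s2) (rot90 z) = \1_(annulus s1 s2) z :> R.
  rewrite !indicE; congr (_%:R); congr nat_of_bool; rewrite /annulus.
  by apply/idP/idP; rewrite !inE /enorm /rot90 /= sqrrN addrC.
have arotk k (z : R * R) : \1_(annulus s1 s2) (iter k rot90 z) = \1_(annulus s1 s2) z :> R.
  by elim: k => //= k; rewrite arot.
have rc (s phi : R) : rot90 (cpt 0 s phi) = cpt 0 s (phi + pi / 2).
  by rewrite /rot90 /cpt /= !add0r cosDpihalf sinDpihalf mulrN.
have rck (s phi : R) k : iter k rot90 (cpt 0 s phi) = cpt 0 s (phi + k%:R * (pi / 2)).
  elim: k => [|k IH]; first by rewrite mul0r addr0.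
  by rewrite iterS IH rc -natr1; congr cpt; ring.
have cgk k : continuous (fun z => g (iter k rot90 z)).
  by move=> z; apply: continuous_comp; [exact: crotk|exact: cg].
under eq_bigr => k _.
  under eq_integral do rewrite arotk.
  rewrite (@wedge_polar R (fun z => g (iter k rot90 z)))//.
  over.
rewrite sumEFin; congr EFin.
have cin k : continuous (fun s : R => s * intg (- (pi / 4)) (pi / 4) (fun phi => g (iter k rot90 (cpt 0 s phi)))).
  move=> s; apply: cvgM; first exact: cvg_id.
  apply: (@cts_intg_param _ _ _ (fun z => g (iter k rot90 (cpt 0 z.1 z.2)))) => z.
  by apply: (@continuous_comp _ _ _ (fun z => cpt 0 z.1 z.2) (fun w => g (iter k rot90 w))); [exact: cts_cpt|exact: cgk].
pose J k s := intg (- (pi / 4)) (pi / 4) (fun phi => g (iter k rot90 (cpt 0 s phi))).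
pose F k (s : R) := s * J k s.
have cF k : continuous (F k) by exact: cin.
transitivity (\sum_(k < 4) intg s1 s2 (F k)); first by [].
rewrite (sum4_intg _ _ cF).
apply: eq_intg => s _; rewrite /F -!mulrDr; congr (_ * _).
have cc := @cts_circ g 0 s cg.
rewrite /cint -(intg_quarters cc).
have E k : J k s =
    intg (- (pi / 4) + k%:R * (pi / 2)) (pi / 4 + k%:R * (pi / 2)) (fun phi => g (cpt 0 s phi)).
  rewrite (@intg_shift (fun phi => g (cpt 0 s phi)) _ _ (k%:R * (pi / 2)) quarter_le cc).
  by apply: eq_intg => phi _; rewrite rck.
by rewrite (E 0%N) (E 1%N) (E 2%N) (E 3%N).
Qed.

Lemma polar_coordinates g c s1 s2 : continuous g -> (forall z, 0 <= g z) -> 0 <= s1 -> s1 <= s2 ->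
  (\int[leb2]_z (g z * \1_(annulus s1 s2) (z - c))%:E =
   (intg s1 s2 (fun s => s * cint g c s))%:E)%E.
Proof.
move=> cg g0 s10 s12.
have ct : continuous (fun z : R * R => c + z).
  by move=> z; apply: cvgD; [exact: cvg_cst|exact: cvg_id].
have ct' : continuous (fun z : R * R => z - c).
  by move=> z; apply: cvgD; [exact: cvg_id|exact: cvg_cst].
rewrite (@translate_integral (fun z => g z * \1_(annulus s1 s2) (z - c)) c); last 2 first.
- apply: measurable_funM; first exact: cts_measurable2.
  have m1 : measurable_fun setT (\1_(annulus s1 s2) : mR * mR -> mR).
    by apply: measurable_indic; exact: measurable_annulus.
  have m2 : measurable_fun setT (fun z : mR * mR => z - c : mR * mR).
    by apply: measurable_fun_pair; apply: measurable_funB => //; exact: measurable_cst.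
  exact: (measurableT_comp m1 m2).
- by move=> z; rewrite mulr_ge0// indicE.
under eq_integral do rewrite addrAC subrr add0r.
have cgc : continuous (fun z => g (c + z)).
  by move=> z; apply: continuous_comp; [exact: ct|exact: cg].
rewrite (polar_coordinates0 cgc (fun=> g0 _) s10 s12).
congr EFin; apply: eq_intg => s _; congr (_ * _); apply: eq_intg => phi _.
by congr g; rewrite /cpt /= !add0r.
Qed.

End PolarCoordinates.

(** * Partial derivatives, increments and the chain rule *)

Section Gradient.
Context {R : realType}.
Implicit Types (f g : R * R -> R) (z w : R * R) (D : set (R * R)).

Lemma mean_value_le (F dF : R -> R) (a h d e : R) :
  (forall x, `|x - a| <= `|h| -> is_derive x 1 F (dF x)) ->
  (forall x, `|x - a| <= `|h| -> `|dF x - d| <= e) ->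
  `|F (a + h) - F a - d * h| <= e * `|h|.
Proof.
move=> H1 H2; have [h0|h0|<-] := ltrgtP 0 h.
- have [||c /andP[c1 c2] E] := @MVT_cc R F dF a (a + h).
  + by rewrite ltrDl.
  + move=> x /andP[x1 x2]; apply: H1.
    by rewrite ger0_norm ?subr_ge0// gtr0_norm// lerBlDl.
  + have -> : F (a + h) - F a - d * h = (dF c - d) * h by rewrite E; ring.
    rewrite normrM ler_wpM2r//; apply: H2.
    by rewrite gtr0_norm ?subr_gt0// gtr0_norm// lerBlDl ltW.
- have [||c /andP[c1 c2] E] := @MVT_cc R F dF (a + h) a.
  + by rewrite gtrDl.
  + move=> x /andP[x1 x2]; apply: H1.
    by rewrite ler0_norm ?subr_le0// ltr0_norm// opprB; lra.
  + have -> : F (a + h) - F a - d * h = (dF c - d) * h by rewrite -(opprB (F a)) E; ring.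
    rewrite normrM ler_wpM2r//; apply: H2.
    by rewrite ltr0_norm ?subr_lt0// ltr0_norm// opprB; lra.
- by rewrite addr0 subrr mulr0 subr0 normr0 mulr0.
Qed.

(* Only the two partial derivatives; differentiability comes from their continuity. *)
Definition has_grad f z (a b : R) :=
  is_derive z.1 1 (fun t => f (t, z.2)) a /\ is_derive z.2 1 (fun t => f (z.1, t)) b.

Lemma cts_boxP g z : {for z, continuous g} <->
  forall e, 0 < e -> exists2 dl, 0 < dl & forall w, `|w.1 - z.1| < dl ->
    `|w.2 - z.2| < dl -> `|g w - g z| <= e.
Proof.
split.
- move=> /cvgrPdist_le H e /H /nbhs_ballP[dl /= dl0 K]; exists dl => // w h1 h2.
  by rewrite distrC; apply: K; split; rewrite /ball/= distrC.
- move=> H; apply/cvgrPdist_le => e /H[dl dl0 K].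
  suff : nbhs z [set t | `|g z - g t| <= e] by [].
  apply/nbhs_ballP; exists dl => // w [/= h1 h2]; rewrite distrC.
  by apply: K; rewrite distrC.
Qed.

Lemma open_boxP D z : open D -> D z ->
  exists2 dl, 0 < dl & forall w, `|w.1 - z.1| < dl -> `|w.2 - z.2| < dl -> D w.
Proof.
rewrite openE => oD /oD /nbhs_ballP[dl /= dl0 H]; exists dl => // w h1 h2.
by apply: H; split; rewrite /ball/= distrC.
Qed.

(** The increment is taken along two sides of a rectangle, with one mean value estimate on each. *)
Lemma grad_increment D f f1 f2 z : open D -> D z ->
  (forall w, D w -> has_grad f w (f1 w) (f2 w)) ->
  {for z, continuous f1} -> {for z, continuous f2} ->
  forall e, 0 < e -> exists2 dl, 0 < dl & forall h k, `|h| < dl -> `|k| < dl ->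
    `|f (z.1 + h, z.2 + k) - f z - f1 z * h - f2 z * k| <= e * (`|h| + `|k|).
Proof.
move=> oD Dz G /cts_boxP c1 /cts_boxP c2 e e0.
have [d1 d10 H1] := c1 _ e0; have [d2 d20 H2] := c2 _ e0.
have [d3 d30 H3] := open_boxP oD Dz.
exists (Num.min d1 (Num.min d2 d3)); first by rewrite !lt_min d10 d20.
move=> h k; rewrite !lt_min => /andP[h1 /andP[h2 h3]] /andP[k1 /andP[k2 k3]].
have Ek : z.2 + k - z.2 = k by ring.
have S1 : `|f (z.1 + h, z.2 + k) - f (z.1, z.2 + k) - f1 z * h| <= e * `|h|.
  apply: (@mean_value_le (fun t => f (t, z.2 + k)) (fun t => f1 (t, z.2 + k))) => x xh.
    have [] // := G (x, z.2 + k) _.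
    by apply: H3; rewrite /= ?Ek// (le_lt_trans xh).
  by apply: H1; rewrite /= ?Ek// (le_lt_trans xh).
have S2 : `|f (z.1, z.2 + k) - f (z.1, z.2) - f2 z * k| <= e * `|k|.
  apply: (@mean_value_le (fun t => f (z.1, t)) (fun t => f2 (z.1, t))) => x xk.
    have [] // := G (z.1, x) _.
    by apply: H3; rewrite /= ?subrr ?normr0// (le_lt_trans xk).
  by apply: H2; rewrite /= ?subrr ?normr0// (le_lt_trans xk).
rewrite mulrDr (le_trans _ (lerD S1 S2))//; apply: le_trans (ler_normD _ _).
by rewrite -surjective_pairing le_eqVlt; apply/orP; left; apply/eqP; congr Num.norm; ring.
Qed.

Lemma chain_rule D f f1 f2 (x y : R -> R) t x' y' : open D -> D (x t, y t) ->
  (forall w, D w -> has_grad f w (f1 w) (f2 w)) ->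
  {for (x t, y t), continuous f1} -> {for (x t, y t), continuous f2} ->
  is_derive t 1 x x' -> is_derive t 1 y y' ->
  is_derive t 1 (fun t => f (x t, y t)) (f1 (x t, y t) * x' + f2 (x t, y t) * y').
Proof.
move=> oD Dz G c1 c2 dx dy; apply/is_derive_epsP => e e0.
set a := f1 _; set b := f2 _.
(* Two errors share [e]. The increments of [x] and [y] add up to at most [M * |s|], so the remainder
   of [f] is allowed [e / (2 * M)]; the remainders of [x] and [y] reach [f] through the factor [N],
   so they are allowed [e / (2 * N)]. *)
pose M := `|x'| + `|y'| + 2; have M0 : 0 < M by rewrite ltr_pwDr// addr_ge0.
pose N := `|a| + `|b| + 1; have N0 : 0 < N by rewrite ltr_pwDr// addr_ge0.
have e1 : 0 < e / (2 * M) by rewrite divr_gt0// mulr_gt0.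
pose eta := Num.min 1 (e / (2 * N)).
have eta0 : 0 < eta by rewrite lt_min ltr01 divr_gt0// mulr_gt0.
have [d1 d10 H] := grad_increment oD Dz G c1 c2 e1.
have /is_derive_epsP/(_ _ eta0)[d2 d20 Hx] := dx.
have /is_derive_epsP/(_ _ eta0)[d3 d30 Hy] := dy.
exists (Num.min (d1 / M) (Num.min d2 d3)); first by rewrite !lt_min d20 d30 divr_gt0.
move=> s; rewrite !lt_min => /andP[s1 /andP[s2 s3]].
have {}Hx := Hx _ s2; have {}Hy := Hy _ s3.
set h := x (t + s) - x t; set k := y (t + s) - y t.
have eta1 : eta <= 1 by rewrite ge_min lexx.
have etaN : eta * N <= e / 2.
  rewrite -ler_pdivlMr// -mulrA -invfM ge_min; apply/orP; right; by rewrite lexx.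
have hle : `|h| <= (`|x'| + 1) * `|s|.
  have -> : h = (x (t + s) - x t - x' * s) + x' * s by rewrite /h; ring.
  rewrite (le_trans (ler_normD _ _))// normrM mulrDl addrC lerD2l//.
  by rewrite (le_trans Hx)// ler_wpM2r.
have kle : `|k| <= (`|y'| + 1) * `|s|.
  have -> : k = (y (t + s) - y t - y' * s) + y' * s by rewrite /k; ring.
  rewrite (le_trans (ler_normD _ _))// normrM mulrDl addrC lerD2l//.
  by rewrite (le_trans Hy)// ler_wpM2r.
have hkle : `|h| + `|k| <= M * `|s|.
  by rewrite (le_trans (lerD hle kle))// -mulrDl ler_wpM2r// /M; lra.
rewrite ltr_pdivlMr// mulrC in s1.
have hd : `|h| < d1 by apply: le_lt_trans s1; apply: le_trans hkle; rewrite lerDl.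
have kd : `|k| < d1 by apply: le_lt_trans s1; apply: le_trans hkle; rewrite lerDr.
have := H h k hd kd; rewrite -/a -/b /= /h /k !subrKC -/h -/k => {}H.
have -> : f (x (t + s), y (t + s)) - f (x t, y t) - (a * x' + b * y') * s =
  (f (x (t + s), y (t + s)) - f (x t, y t) - a * h - b * k)
  + (a * (x (t + s) - x t - x' * s) + b * (y (t + s) - y t - y' * s)).
  by rewrite /h /k; ring.
rewrite (le_trans (ler_normD _ _))//.
have -> : e * `|s| = e / 2 * `|s| + e / 2 * `|s| by rewrite -mulrDl -splitr.
apply: lerD.
  rewrite (le_trans H)//.
  have -> : e / 2 * `|s| = e / (2 * M) * (M * `|s|).
    by field; rewrite gt_eqF.
  by rewrite ler_wpM2l// ltW.
rewrite (le_trans (ler_normD _ _))// !normrM.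
apply: (@le_trans _ _ (eta * N * `|s|)); last by rewrite ler_wpM2r.
have -> : eta * N * `|s| = `|a| * (eta * `|s|) + `|b| * (eta * `|s|) + eta * `|s|.
  by rewrite /N; ring.
by rewrite -[leLHS]addr0 !lerD ?ler_wpM2l ?mulr_ge0// ltW.
Qed.

Lemma is_derive_radial D f f1 f2 c (s phi : R) : open D -> D (cpt c s phi) ->
  (forall w, D w -> has_grad f w (f1 w) (f2 w)) -> continuous f1 -> continuous f2 ->
  is_derive s 1 (fun s => f (cpt c s phi)) (f1 (cpt c s phi) * cos phi + f2 (cpt c s phi) * sin phi).
Proof.
move=> oD Dc gf c1 c2.
apply: (@chain_rule D f f1 f2 (fun s => c.1 + s * cos phi) (fun s => c.2 + s * sin phi)) => //.
- exact: c1.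
- exact: c2.
- by apply: is_derive_eq; rewrite /GRing.scale /=; ring.
- by apply: is_derive_eq; rewrite /GRing.scale /=; ring.
Qed.

Lemma is_derive_angular D f f1 f2 c (s phi : R) : open D -> D (cpt c s phi) ->
  (forall w, D w -> has_grad f w (f1 w) (f2 w)) -> continuous f1 -> continuous f2 ->
  is_derive phi 1 (fun phi => f (cpt c s phi))
    (f1 (cpt c s phi) * (s * - sin phi) + f2 (cpt c s phi) * (s * cos phi)).
Proof.
move=> oD Dc gf c1 c2.
apply: (@chain_rule D f f1 f2 (fun phi => c.1 + s * cos phi) (fun phi => c.2 + s * sin phi)) => //.
- exact: c1.
- exact: c2.
- by apply: is_derive_eq; rewrite /GRing.scale /=; ring.
- by apply: is_derive_eq; rewrite /GRing.scale /=; ring.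
Qed.

End Gradient.

(** * Circle means for conjugate pairs *)

Section MeanValue.
Context {R : realType}.
Implicit Types (f g : R * R -> R) (z w c : R * R) (D : set (R * R)).

Lemma cos_cb : cos cb = cos ca :> R.
Proof. by have -> : cb = ca + pi *+ 2 :> R by [rewrite /cb /ca; ring]; rewrite cosD2pi. Qed.

Lemma sin_cb : sin cb = sin ca :> R.
Proof. by have -> : cb = ca + pi *+ 2 :> R by [rewrite /cb /ca; ring]; rewrite sinD2pi. Qed.

Lemma cpt_cb c s : cpt c s cb = cpt c s ca.
Proof. by rewrite /cpt cos_cb sin_cb. Qed.

Lemma cb_sub_ca : cb - ca = pi * 2 :> R.
Proof. by rewrite /cb /ca; ring. Qed.

Lemma cpt0s c phi : cpt c 0 phi = c.
Proof. by rewrite /cpt !mul0r !addr0 -surjective_pairing. Qed.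

Lemma cts_snd_fun (f : R -> R) : continuous f -> continuous (fun w : R * R => f w.2).
Proof. by move=> cf w; apply: (@continuous_comp _ _ _ snd f); [exact: cvg_snd|exact: cf]. Qed.

Lemma cts_comp_cpt g c : continuous g -> continuous (fun w : R * R => g (cpt c w.1 w.2)).
Proof.
move=> cg w; apply: (@continuous_comp _ _ _ (fun w => cpt c w.1 w.2) g); last exact: cg.
exact: cts_cpt.
Qed.

Lemma cts_mul (T : topologicalType) (f g : T -> R) : continuous f -> continuous g ->
  continuous (fun x => f x * g x).
Proof. by move=> cf cg x; apply: cvgM; [exact: cf|exact: cg]. Qed.

Lemma cts_add (T : topologicalType) (f g : T -> R) : continuous f -> continuous g ->
  continuous (fun x => f x + g x).
Proof. by move=> cf cg x; apply: cvgD; [exact: cf|exact: cg]. Qed.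

Lemma cts_opp (T : topologicalType) (f : T -> R) : continuous f ->
  continuous (fun x => - f x).
Proof. by move=> cf x; apply: cvgN; exact: cf. Qed.

Lemma cts_sub (T : topologicalType) (f g : T -> R) : continuous f -> continuous g ->
  continuous (fun x => f x - g x).
Proof. by move=> cf cg; apply: cts_add => //; exact: cts_opp. Qed.

Lemma cts_cst (T : topologicalType) (k : R) : continuous (fun _ : T => k).
Proof. by move=> x; exact: cvg_cst. Qed.

Lemma cts_norm (T : topologicalType) (f : T -> R) : continuous f ->
  continuous (fun x => `|f x|).
Proof. by move=> cf x; apply: cvg_norm; exact: cf. Qed.

Lemma cts_exp (T : topologicalType) (f : T -> R) n : continuous f ->
  continuous (fun x => f x ^+ n).
Proof.
move=> cf x; apply: (@continuous_comp _ _ _ f (fun y => y ^+ n)); first exact: cf.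
exact: exprn_continuous.
Qed.

(** The gradients are prescribed on [D] only, and [C] need not be continuous elsewhere: for the
    vorticity, [C] is a potential that exists on a disc. [H] dominates the failure of [A1 = C2] and
    [A2 = - C1]. *)
Section ConjugatePair.
Variables (A C A1 A2 C1 C2 H : R * R -> R) (c : R * R) (rho : R) (D : set (R * R)).
Hypothesis oD : open D.
Hypothesis rho0 : 0 <= rho.
Hypothesis cD : forall s phi, 0 <= s <= rho -> D (cpt c s phi).
Hypothesis gA : forall w, D w -> has_grad A w (A1 w) (A2 w).
Hypothesis gC : forall w, D w -> has_grad C w (C1 w) (C2 w).
Hypothesis cA : continuous A.
Hypothesis cA1 : continuous A1.
Hypothesis cA2 : continuous A2.
Hypothesis cC1 : continuous C1.
Hypothesis cC2 : continuous C2.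
Hypothesis cH : continuous H.
Hypothesis hH : forall w, D w -> `|A1 w - C2 w| + `|A2 w + C1 w| <= H w.

Let g (w : R * R) := A1 (cpt c w.1 w.2) * cos w.2 + A2 (cpt c w.1 w.2) * sin w.2.
Let t (w : R * R) := C2 (cpt c w.1 w.2) * cos w.2 - C1 (cpt c w.1 w.2) * sin w.2.

Let cg : continuous g.
Proof.
apply: cts_add; apply: cts_mul.
- exact: cts_comp_cpt.
- exact/cts_snd_fun/continuous_cos.
- exact: cts_comp_cpt.
- exact/cts_snd_fun/continuous_sin.
Qed.

Let ct : continuous t.
Proof.
apply: cts_sub; apply: cts_mul.
- exact: cts_comp_cpt.
- exact/cts_snd_fun/continuous_cos.
- exact: cts_comp_cpt.
- exact/cts_snd_fun/continuous_sin.
Qed.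

Let radial phi : intg 0 rho (fun s => g (s, phi)) = A (cpt c rho phi) - A c.
Proof.
have dA s : 0 <= s <= rho -> is_derive s 1 (fun s => A (cpt c s phi)) (g (s, phi)).
  by move=> s01; exact: is_derive_radial oD (cD phi s01) gA cA1 cA2.
by rewrite (intg_FTC2 rho0 (cts_within (@cts_secr _ _ phi cg)) dA) cpt0s.
Qed.

Let angular s : 0 <= s <= rho -> intg ca cb (fun phi => t (s, phi)) = 0.
Proof.
move=> /andP[s0 s1]; have cts := @cts_secl _ _ s ct.
(* At [s = 0] one cannot divide the angular derivative of [C] by [s]; there [t] is a fixed
   combination of [cos] and [sin] with an explicit periodic primitive. *)
have [s00|sp] := leP s 0.
  have {s0 s00} -> : s = 0 by apply/eqP; rewrite eq_le s00 s0.
  have d0 phi : ca <= phi <= cb ->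
      is_derive phi 1 (fun phi => C2 c * sin phi + C1 c * cos phi) (t (0, phi)).
    move=> _; rewrite /t /= cpt0s.
    by apply: is_derive_eq; rewrite /GRing.scale /=; ring.
  rewrite (intg_FTC2 ca_le_cb (cts_within (@cts_secl _ _ 0 ct)) d0).
  by rewrite cos_cb sin_cb subrr.
apply: (@mulfI _ s); first by rewrite gt_eqF.
rewrite mulr0 -intgZ//.
have dC phi : ca <= phi <= cb -> is_derive phi 1 (fun phi => C (cpt c s phi)) (s * t (s, phi)).
  move=> _.
  have -> : s * t (s, phi) = C1 (cpt c s phi) * (s * - sin phi) + C2 (cpt c s phi) * (s * cos phi).
    by rewrite /t /=; ring.
  apply: is_derive_angular oD _ gC cC1 cC2.
  by apply: cD; rewrite ltW.
by rewrite (intg_FTC2 ca_le_cb (cts_within (cts_mul (@cts_cst _ s) cts)) dC) cpt_cb subrr.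
Qed.

(* [t] is the tangential derivative of [C], so it has mean zero on circles, and subtracting it
   from the radial derivative [g] of [A] leaves only the Cauchy-Riemann defect. *)
Lemma circle_mean_le : `|cint A c rho - pi * 2 * A c| <= intg 0 rho (cint H c).
Proof.
have cAr := @cts_circ _ _ c rho cA.
have -> : cint A c rho - pi * 2 * A c = intg ca cb (fun phi => A (cpt c rho phi) - A c).
  rewrite intgB//; last exact: cts_cst.
  by rewrite intg_cst ?ca_le_cb// cb_sub_ca.
have -> : intg ca cb (fun phi => A (cpt c rho phi) - A c) =
   intg 0 rho (fun s => intg ca cb (fun phi => g (s, phi))).
  by rewrite intg_swap//; apply: eq_intg => phi _; rewrite radial.
have ci := @cts_intg_param _ ca cb _ cg.
apply: le_trans (abs_intg _ _ ci) _.
apply: le_intg => //; first exact: cts_norm.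
  exact: cts_cint.
move=> s s01; have cgs := @cts_secl _ _ s cg; have cts := @cts_secl _ _ s ct.
have -> : intg ca cb (fun phi => g (s, phi)) =
  intg ca cb (fun phi => g (s, phi) - t (s, phi)).
  by rewrite intgB// angular// subr0.
have cgt : continuous (fun phi => g (s, phi) - t (s, phi)) by exact: cts_sub.
apply: le_trans (abs_intg _ _ cgt) _.
apply: le_intg; [exact: cts_norm|exact: cts_circ|] => phi _.
rewrite /g /t /=.
set w := cpt c s phi.
have -> : A1 w * cos phi + A2 w * sin phi - (C2 w * cos phi - C1 w * sin phi) =
   (A1 w - C2 w) * cos phi + (A2 w + C1 w) * sin phi by ring.
apply: le_trans (ler_normD _ _) _.
apply: le_trans (hH (cD phi s01)); rewrite !normrM.
by rewrite lerD// ler_piMr// ler_norml ?cos_geN1 ?cos_le1 ?sin_geN1 ?sin_le1.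
Qed.

End ConjugatePair.
End MeanValue.

(** * Euclidean norm and point picking *)

Section Euclid.
Context {R : realType}.
Implicit Types (z w c : R * R).

Lemma enorm_ge0 z : 0 <= enorm z. Proof. exact: sqrtr_ge0. Qed.

Lemma enorm0 : enorm (0 : R * R) = 0.
Proof. by rewrite /enorm/= expr0n/= addr0 sqrtr0. Qed.

Lemma enorm_sq z : enorm z ^+ 2 = z.1 ^+ 2 + z.2 ^+ 2.
Proof. by rewrite sqr_sqrtr// addr_ge0// sqr_ge0. Qed.

Lemma le_enorm1 z : `|z.1| <= enorm z.
Proof. by rewrite -sqrtr_sqr ler_sqrt ?addr_ge0 ?sqr_ge0// lerDl sqr_ge0. Qed.

Lemma le_enorm2 z : `|z.2| <= enorm z.
Proof. by rewrite -sqrtr_sqr ler_sqrt ?addr_ge0 ?sqr_ge0// lerDr sqr_ge0. Qed.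

Lemma enorm_le z : enorm z <= `|z.1| + `|z.2|.
Proof.
rewrite -ler_sqr ?nnegrE ?enorm_ge0 ?addr_ge0// enorm_sq sqrrD !real_normK ?num_real//.
by rewrite lerD2r lerDl mulrn_wge0// mulr_ge0.
Qed.

Lemma enorm_dot z w : z.1 * w.1 + z.2 * w.2 <= enorm z * enorm w.
Proof.
have [h|h] := leP (z.1 * w.1 + z.2 * w.2) 0.
  by apply: le_trans h _; rewrite mulr_ge0 ?enorm_ge0.
rewrite -ler_sqr ?nnegrE ?mulr_ge0 ?enorm_ge0//; last exact: ltW.
rewrite exprMn !enorm_sq -subr_ge0.
have -> : (z.1 ^+ 2 + z.2 ^+ 2) * (w.1 ^+ 2 + w.2 ^+ 2) - (z.1 * w.1 + z.2 * w.2) ^+ 2 =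
  (z.1 * w.2 - z.2 * w.1) ^+ 2 by ring.
exact: sqr_ge0.
Qed.

Lemma enormD z w : enorm (z + w) <= enorm z + enorm w.
Proof.
rewrite -ler_sqr ?nnegrE ?addr_ge0 ?enorm_ge0// sqrrD !enorm_sq /=.
by have := enorm_dot z w; nra.
Qed.

Lemma enormN z : enorm (- z) = enorm z.
Proof. by rewrite /enorm /= !sqrrN. Qed.

Lemma enormB z w : enorm (z - w) = enorm (w - z).
Proof. by rewrite -enormN opprB. Qed.

Lemma enorm_polar (s phi : R) : 0 <= s -> enorm (s * cos phi, s * sin phi) = s.
Proof.
move=> s0; rewrite /enorm /= !exprMn -mulrDr cos2Dsin2 mulr1 sqrtr_sqr.
exact: ger0_norm.
Qed.

Lemma enorm_cpt c (s phi : R) : 0 <= s -> enorm (cpt c s phi - c) = s.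
Proof.
move=> s0; rewrite -[RHS](enorm_polar phi s0); congr enorm.
by rewrite /cpt; case: c => c1 c2 /=; congr (_, _) => /=; ring.
Qed.

Lemma enorm_ge_sub c w (s : R) : enorm (w - c) <= s -> enorm c - s <= enorm w.
Proof.
move=> h; rewrite lerBlDr; apply: le_trans (lerD (lexx _) h).
have {1}-> : c = w + (c - w) by rewrite addrC subrK.
by apply: le_trans (enormD _ _) _; rewrite (enormB c).
Qed.

Lemma enorm_le_add c w (s : R) : enorm (w - c) <= s -> enorm w <= enorm c + s.
Proof.
move=> h; apply: le_trans (lerD (lexx _) h).
have {1}-> : w = c + (w - c) by rewrite addrC subrK.
exact: enormD.
Qed.

Lemma cts_enormB c : continuous (fun w : R * R => enorm (w - c)).
Proof.
move=> w; apply: (@continuous_comp _ _ _ (fun w => w - c) enorm).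
  by apply: cvgD; [exact: cvg_id|exact: cvg_cst].
exact: continuous_enorm.
Qed.

Lemma open_eball c (r : R) : open [set w | enorm (w - c) < r].
Proof.
have /continuousP/(_ _ (@open_lt _ r)) := @cts_enormB c.
by congr open; apply/seteqP; split.
Qed.

Lemma open_exterior (r : R) : open [set w : R * R | r < enorm w].
Proof.
have /continuousP/(_ _ (@open_gt _ r)) := @continuous_enorm R.
by congr open; apply/seteqP; split.
Qed.

Lemma compact_eball c (r : R) : compact [set w | enorm (w - c) <= r].
Proof.
apply: (@subclosed_compact _ _ (`[c.1 - r, c.1 + r]%classic `*` `[c.2 - r, c.2 + r]%classic)).
- have /continuous_closedP/(_ _ (@closed_le _ r)) := @cts_enormB c.
  by congr closed; apply/seteqP; split.
- by apply: compact_setX; exact: segment_compact.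
- move=> w /= h; split; rewrite /= in_itv/= -ler_distl.
    exact: le_trans (le_enorm1 (w - c)) h.
  exact: le_trans (le_enorm2 (w - c)) h.
Qed.

(* Maximize [h w] times the distance from [w] to the boundary of the disc. *)
Lemma point_picking (h : R * R -> R) z0 rho : continuous h -> (forall w, 0 <= h w) ->
  0 < h z0 -> 0 < rho ->
  exists z1 d, [/\ 0 < d, d + enorm (z1 - z0) = rho, h z0 * rho <= h z1 * d &
    forall w, enorm (w - z1) <= d / 2 -> h w <= 2 * h z1].
Proof.
move=> ch h0 hz0 rho0.
have NE : [set w | enorm (w - z0) <= rho] !=set0.
  by exists z0; rewrite /= subrr enorm0 ltW.
have [|z1 z1B Hmax] := @compact_EVT_max _ R (fun w => h w * (rho - enorm (w - z0))) _ NE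
  (@compact_eball z0 rho).
  by apply/continuous_subspaceT/cts_mul => //; apply: cts_sub; [exact: cts_cst|exact: cts_enormB].
rewrite inE/= in z1B.
have M0 : h z0 * rho <= h z1 * (rho - enorm (z1 - z0)).
  by have := Hmax z0; rewrite subrr enorm0 subr0; apply; rewrite inE/= subrr enorm0 ltW.
have d0 : 0 < rho - enorm (z1 - z0).
  rewrite lt_neqAle subr_ge0 z1B andbT eq_sym; apply/eqP => d0.
  by move: M0; rewrite d0 mulr0 leNgt mulr_gt0.
exists z1, (rho - enorm (z1 - z0)); split => //; first by rewrite subrK.
move=> w hw.
have wd : enorm (w - z0) <= enorm (z1 - z0) + (rho - enorm (z1 - z0)) / 2.
  have -> : w - z0 = (z1 - z0) + (w - z1) by rewrite [RHS]addrC addrA subrK.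
  by apply: le_trans (enormD _ _) _; rewrite lerD2l.
have := Hmax w; rewrite inE/= => /(_ _)H.
have {}H : h w * (rho - enorm (w - z0)) <= h z1 * (rho - enorm (z1 - z0)) by apply: H; lra.
(* Moving from [z1] by at most half of its distance to the boundary leaves at least the other half,
   so maximality loses only a factor 2. *)
have h1 : h w * ((rho - enorm (z1 - z0)) / 2) <= h w * (rho - enorm (w - z0)).
  by rewrite ler_wpM2l//; lra.
rewrite -(ler_pM2r d0); lra.
Qed.

End Euclid.

(** * Energy of annuli *)

Section Energy.
Context {R : realType}.
Implicit Types (f g G H : R * R -> R) (z w c : R * R).
Notation leb := (@lebesgue_measure R).
Notation leb2 := (leb \x leb)%E.

(** For continuous nonnegative [g] and [0 <= s1 <= s2], the area integral over the annulus about
    [c], by [polar_coordinates]. *)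
Definition energy g c (s1 s2 : R) := intg s1 s2 (fun s => s * cint g c s).

Lemma cts_scint g c : continuous g -> continuous (fun s : R => s * cint g c s).
Proof. by move=> cg; apply: cts_mul; [move=> ?; exact: cvg_id|exact: cts_cint]. Qed.

Lemma cint_ge0 g c s : (forall z, 0 <= g z) -> 0 <= cint g c s.
Proof. by move=> g0; apply: intg_ge0. Qed.

Lemma le_cint f g c s : continuous f -> continuous g ->
  (forall phi, f (cpt c s phi) <= g (cpt c s phi)) -> cint f c s <= cint g c s.
Proof. by move=> cf cg h; apply: le_intg => //; exact: cts_circ. Qed.

Lemma cint_cst k c s : cint (fun=> k) c s = pi * 2 * k.
Proof. by rewrite /cint intg_cst ?ca_le_cb// cb_sub_ca. Qed.

Lemma cintD f g c s : continuous f -> continuous g ->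
  cint (fun z => f z + g z) c s = cint f c s + cint g c s.
Proof. by move=> cf cg; apply: intgD; exact: cts_circ. Qed.

Lemma cintZ k f c s : continuous f -> cint (fun z => k * f z) c s = k * cint f c s.
Proof. by move=> cf; apply: intgZ; exact: cts_circ. Qed.

Lemma energy_ge0 g c s1 s2 : (forall z, 0 <= g z) -> 0 <= s1 -> 0 <= energy g c s1 s2.
Proof.
move=> g0 s10; apply: intg_ge0 => s /andP[s1s _].
by rewrite mulr_ge0 ?cint_ge0// (le_trans s10).
Qed.

Lemma measurable_annulus_at g c s1 s2 : continuous g ->
  measurable_fun setT (fun z : measurableTypeR R * measurableTypeR R =>
    g z * \1_(annulus s1 s2) (z - c) : measurableTypeR R).
Proof.
move=> cg; apply: measurable_funM; first exact: cts_measurable2.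
have m1 : measurable_fun setT (\1_(annulus s1 s2) : measurableTypeR R * measurableTypeR R -> measurableTypeR R).
  by apply: measurable_indic; exact: measurable_annulus.
have m2 : measurable_fun setT (fun z : measurableTypeR R * measurableTypeR R =>
    z - c : measurableTypeR R * measurableTypeR R).
  by apply: measurable_fun_pair; apply: measurable_funB => //; exact: measurable_cst.
exact: (measurableT_comp m1 m2).
Qed.

(** Inclusion of sets, by the triangle inequality. It transfers smallness of the tail at infinity to
    discs about distant points. *)
Lemma energy_disc_annulus g c s1 s2 : continuous g -> (forall z, 0 <= g z) ->
  0 <= s1 -> s1 <= s2 -> s2 <= enorm c ->
  energy g c s1 s2 <= energy g 0 (enorm c - s2) (enorm c + s2).
Proof.
move=> cg g0 s10 s12 s2c; rewrite -lee_fin /energy -!polar_coordinates//; [|lra|lra].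
apply: ge0_le_integral => //.
- by move=> z _; rewrite lee_fin mulr_ge0// indicE.
- by apply/measurable_EFinP; exact: measurable_annulus_at.
- by apply/measurable_EFinP; exact: measurable_annulus_at.
- move=> z _; rewrite lee_fin ler_wpM2l// !indicE.
  case: (boolP (z - c \in _)) => //; rewrite inE /annulus /= => /andP[_ zc].
  rewrite mem_set// /annulus /= subr0.
  by rewrite enorm_ge_sub// enorm_le_add.
Qed.

(** The energy of the disc of radius [s] is nondecreasing and bounded by the total; [r] is a radius
    at which it is within [e] of its supremum. *)
Lemma energy_tail G : continuous G -> (forall z, 0 <= G z) ->
  (\int[leb2]_z (G z)%:E < +oo)%E ->
  forall e, 0 < e -> exists r, forall s1 s2, 0 <= s1 -> r <= s1 -> s1 <= s2 -> energy G 0 s1 s2 <= e.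
Proof.
move=> cG G0 Gfin e e0.
pose P s := energy G 0 0 s; pose A := [set P s | s in [set s : R | 0 <= s]].
have Pub s : 0 <= s -> P s <= fine (\int[leb2]_z (G z)%:E)%E.
  have I0 : (0 <= \int[leb2]_z (G z)%:E)%E by apply: integral_ge0 => z _; rewrite lee_fin.
  have If : (\int[leb2]_z (G z)%:E)%E \is a fin_num by rewrite (ge0_fin_numE I0).
  move=> s0; rewrite -lee_fin (fineK If).
  rewrite /P /energy -polar_coordinates//. apply: ge0_le_integral => //.
  - by move=> z _; rewrite lee_fin mulr_ge0// indicE.
  - by apply/measurable_EFinP; exact: measurable_annulus_at.
  - by apply/measurable_EFinP; exact: cts_measurable2.
  - by move=> z _; rewrite lee_fin ler_piMr// indicE; case: (_ \in _).
have hA : has_sup A.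
  split; first by exists (P 0), 0 => //=.
  by exists (fine (\int[leb2]_z (G z)%:E)%E) => _ [s /= s0 <-]; exact: Pub.
have [_ [r /= r0 <-] Hr] := sup_adherent e0 hA.
exists r => s1 s2 s10 rs1 s12.
have split0 t1 t2 : 0 <= t1 -> t1 <= t2 -> P t2 = P t1 + energy G 0 t1 t2.
  by move=> t10 t12; apply: intg_split => //; exact/cts_within/cts_scint.
have P2 : P s2 <= sup A by apply: ub_le_sup; [exact: hA.2|exists s2 => //=; exact: le_trans s12].
have := split0 _ _ s10 s12; have := split0 _ _ r0 rs1.
have := energy_ge0 (g := G) 0 s1 G0 r0; lra.
Qed.

(** Cauchy-Schwarz with a free weight: [H <= s * H^2 / (4 * eta) + eta / s] pointwise, then
    integrate; the last term produces the logarithm. If the energy is at most [q ^+ 2] and the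
    logarithm is of order [lam ^+ 2], the choice [eta = q / lam] makes both terms of order
    [q * lam]. *)
Lemma log_energy G H c s0 s1 eta : continuous G -> continuous H ->
  (forall z, H z ^+ 2 <= 2 * G z) -> 0 < s0 -> s0 <= s1 -> 0 < eta ->
  intg s0 s1 (cint H c) <= energy G c s0 s1 / (2 * eta) + eta * (pi * 2) * (ln s1 - ln s0).
Proof.
move=> cG cH HG s00 s01 eta0.
(* Equal to [1 / s] on the interval of integration and frozen below [s0], hence continuous on the
   whole line. *)
pose k (s : R) := (Num.max s s0)^-1.
have ck : continuous k.
  move=> s; apply: cvgV; first by rewrite gt_eqF// lt_max s00 orbT.
  by apply: continuous_max; [exact: cvg_id|exact: cvg_cst].
have kE s : s0 <= s <= s1 -> k s = s^-1 by move=> /andP[h _]; rewrite /k max_l.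
have lnE : intg s0 s1 k = ln s1 - ln s0.
  apply: (intg_FTC2 s01 (cts_within ck)) => s /[dup] /kE -> /andP[h _].
  by apply: is_derive1_ln; exact: lt_le_trans h.
have cs1 := @cts_scint _ c cG.
rewrite -lnE mulrC.
rewrite -(intgZ _ _ _ cs1) -(intgZ _ _ _ ck).
have c1 : continuous (fun s : R => (2 * eta)^-1 * (s * cint G c s)) by apply: cts_mul => //; exact: cts_cst.
have c2 : continuous (fun s : R => eta * (pi * 2) * k s) by apply: cts_mul => //; exact: cts_cst.
rewrite -(intgD _ _ c1 c2).
apply: le_intg => //; [exact: cts_cint|exact: cts_add|].
move=> s /[dup] /kE -> /andP[h _]; have sp : 0 < s by exact: lt_le_trans h.
have -> : (2 * eta)^-1 * (s * cint G c s) + eta * (pi * 2) / s =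
  cint (fun z => s / (2 * eta) * G z + eta / s) c s.
  rewrite cintD//; [|by apply: cts_mul => //; exact: cts_cst|exact: cts_cst].
  rewrite cintZ// cint_cst; field; rewrite !gt_eqF//.
apply: le_cint => //.
  by apply: cts_add; [apply: cts_mul => //; exact: cts_cst|exact: cts_cst].
move=> phi; set z := cpt _ _ _.
have t0 : 0 < s / (2 * eta) by rewrite divr_gt0// mulr_gt0.
apply: (@le_trans _ _ (s / (2 * eta) * (H z ^+ 2 / 2) + eta / s)); last first.
  by rewrite lerD2r ler_wpM2l//; [exact: ltW|have := HG z; lra].
rewrite -subr_ge0.
have -> : s / (2 * eta) * (H z ^+ 2 / 2) + eta / s - H z = (s * H z - 2 * eta) ^+ 2 / (4 * eta * s).
  by field; rewrite !gt_eqF.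
by rewrite divr_ge0 ?sqr_ge0// !mulr_ge0// ltW.
Qed.

End Energy.

(** * From circles about a point to circles about the origin *)

Section CircleMeans.
Context {R : realType}.
Implicit Types (z w c : R * R).

Lemma cts_id : continuous (fun s : R => s).
Proof. by move=> s; exact: cvg_id. Qed.

Lemma intg_id (a b : R) : a <= b -> intg a b (fun s => s) = (b ^+ 2 - a ^+ 2) / 2.
Proof.
move=> ab.
have d (x : R) : a <= x <= b -> is_derive x 1 (fun s : R => s ^+ 2 / 2) x.
  by move=> _; apply: is_derive_eq; rewrite /GRing.scale /=; field.
by rewrite (intg_FTC2 ab (cts_within cts_id) d); ring.
Qed.

Lemma trig_le (x y phi : R) : `|x * cos phi + y * sin phi| <= `|x| + `|y|.
Proof.
apply: le_trans (ler_normD _ _) _; rewrite !normrM.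
by apply: lerD; apply: ler_piMr => //; rewrite ler_norml ?cos_geN1 ?cos_le1 ?sin_geN1 ?sin_le1.
Qed.

Lemma pi_ge2 : 2 <= pi :> R.
Proof. by have := @pihalf_ge1 R; lra. Qed.

Lemma exterior_cpt (r : R) c (s phi : R) : 0 <= s -> r + s < enorm c -> r < enorm (cpt c s phi).
Proof.
move=> s0 rs; have := @enorm_ge_sub R c (cpt c s phi) s; rewrite enorm_cpt// lexx.
by move=> /(_ isT); lra.
Qed.

Lemma exterior_cpt0 (r s phi : R) : 0 <= r -> r < s -> r < enorm (cpt 0 s phi).
Proof. by move=> r0 rs; rewrite -[cpt _ _ _]subr0 enorm_cpt// (le_trans r0)// ltW. Qed.

(** The radial derivative is integrated along each ray from radius [s0] to [s], and the angular and
    radial integrals are exchanged. *)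
Lemma cint_growth (r1 : R) (A A1 A2 : R * R -> R) (s0 s : R) :
  continuous A -> continuous A1 -> continuous A2 ->
  (forall w, r1 < enorm w -> has_grad A w (A1 w) (A2 w)) ->
  0 <= r1 -> r1 < s0 -> s0 <= s ->
  cint (fun z => `|A z|) 0 s <= cint (fun z => `|A z|) 0 s0
     + intg s0 s (cint (fun z => `|A1 z| + `|A2 z|) 0).
Proof.
move=> cA cA1 cA2 gA r10 r1s0 s0s.
pose g (w : R * R) := A1 (cpt 0 w.1 w.2) * cos w.2 + A2 (cpt 0 w.1 w.2) * sin w.2.
have cg : continuous g.
  apply: cts_add; apply: cts_mul.
  - exact: cts_comp_cpt.
  - exact/cts_snd_fun/continuous_cos.
  - exact: cts_comp_cpt.
  - exact/cts_snd_fun/continuous_sin.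
pose H z := `|A1 z| + `|A2 z|.
have cH : continuous H by apply: cts_add; exact: cts_norm.
have cHc := @cts_comp_cpt _ H 0 cH.
have cA' : continuous (fun z => `|A z|) by exact: cts_norm.
have swap : intg s0 s (cint H 0) = intg ca cb (fun phi => intg s0 s (fun t => H (cpt 0 t phi))).
  exact: (intg_swap s0 s ca cb cHc).
rewrite swap.
have c1 := @cts_circ _ (fun z => `|A z|) 0 s0 cA'.
have cHs : continuous (fun w : R * R => H (cpt 0 w.2 w.1)).
  move=> w; apply: (@continuous_comp _ _ _ (fun w : R * R => (w.2, w.1)) (fun w => H (cpt 0 w.1 w.2))).
    by apply: cts_pair; [exact: cvg_snd|exact: cvg_fst].
  exact: cHc.
have c2 := @cts_intg_param _ s0 s _ cHs.
rewrite /cint -(intgD _ _ c1 c2).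
have cs := @cts_circ _ (fun z => `|A z|) 0 s cA'.
apply: (le_intg cs (cts_add c1 c2)) => phi _ /=.
have dA t : s0 <= t <= s -> is_derive t 1 (fun t => A (cpt 0 t phi)) (g (t, phi)).
  move=> /andP[t0 _].
  have tr : r1 < enorm (cpt 0 t phi) by exact: exterior_cpt0 r10 (lt_le_trans r1s0 t0).
  exact: is_derive_radial (@open_exterior _ r1) tr gA cA1 cA2.
have E := intg_FTC2 s0s (cts_within (@cts_secr _ _ phi cg)) dA.
have -> : A (cpt 0 s phi) = A (cpt 0 s0 phi) + intg s0 s (fun t => g (t, phi)) by rewrite E; ring.
apply: le_trans (ler_normD _ _) _; rewrite lerD2l.
have cgp := @cts_secr _ _ phi cg.
apply: le_trans (abs_intg _ _ cgp) _; apply: le_intg.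
- exact: cts_norm.
- exact: (@cts_secr _ (fun w => H (cpt 0 w.1 w.2)) phi cHc).
- by move=> t _; exact: trig_le.
Qed.

Lemma annulus_scales (n s : R) : 0 < n -> n - n / 2 <= s -> s <= n + n / 2 ->
  0 <= s /\ n / 2 <= s <= 3 / 2 * n.
Proof. by move=> n0 s1 s2; split; [lra|apply/andP; split; lra]. Qed.

Lemma annulus_bounds (n : R) : 0 < n -> n / 4 <= n / 2 /\ n - n / 2 <= n + n / 2.
Proof. by move=> n0; split; lra. Qed.

(** Integrals of the radius: [3 / 32 * n ^+ 2] over [n / 4 .. n / 2] and [n ^+ 2] over
    [n / 2 .. 3 * n / 2]; their ratio is 32 / 3. *)
Lemma annulus_algebra (X m n : R) : 0 < n ->
  X * (((n / 2) ^+ 2 - (n / 4) ^+ 2) / 2) <= m * (((n + n / 2) ^+ 2 - (n - n / 2) ^+ 2) / 2) ->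
  X <= 32 / 3 * m.
Proof.
move=> n0 h.
have : X * 3 / 32 * n ^+ 2 <= m * n ^+ 2 by lra.
rewrite ler_pM2r ?exprn_gt0//; lra.
Qed.

(** Circles with different centres are compared through area: the lower bound on circles about [c]
    is integrated over the radii from [n / 4] to [n / 2], and the annulus they fill lies in the
    annulus from [n / 2] to [3 * n / 2] about the origin, where [m] bounds the circle integrals. *)
Lemma average_bound (A W : R * R -> R) c (m S r1 : R) : continuous A -> continuous W ->
  (forall rho, 0 <= rho -> r1 + rho < enorm c ->
     `|cint A c rho - pi * 2 * A c| <= intg 0 rho (cint (fun z => `|W z|) c)) ->
  r1 < enorm c / 2 -> 0 < enorm c ->
  (forall s, enorm c / 2 <= s <= 3 / 2 * enorm c -> cint (fun z => `|A z|) 0 s <= m) ->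
  intg 0 (enorm c / 2) (cint (fun z => `|W z|) c) <= S ->
  pi * 2 * `|A c| <= 32 / 3 * m + S.
Proof.
move=> cA cW mean; set n := enorm c => r1c n0 hm hS.
have cA' : continuous (fun z => `|A z|) by exact: cts_norm.
have cW' : continuous (fun z => `|W z|) by exact: cts_norm.
have cX k : continuous (fun s : R => s * k) by apply: cts_mul; [exact: cts_id|exact: cts_cst].
have idk (k a b : R) : a <= b -> intg a b (fun s => s * k) = k * ((b ^+ 2 - a ^+ 2) / 2).
  move=> ab; rewrite -(intg_id ab) -(intgZ _ _ _ cts_id).
  by apply: eq_intg => s _; rewrite mulrC.
(* A lower bound for the integral of [|A|] over every circle about [c] of radius at most [n / 2]. *)
set X := pi * 2 * `|A c| - S.
have h1 : intg (n / 4) (n / 2) (fun s => s * X) <= energy (fun z => `|A z|) c (n / 4) (n / 2).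
  apply: le_intg; [exact: cX|exact: cts_scint|] => rho /andP[r4 r2].
  have rho0 : 0 <= rho by lra.
  rewrite (ler_wpM2l rho0)// /X.
  have rn : r1 + rho < enorm c by rewrite -/n; lra.
  have M := mean rho rho0 rn.
  have h2 : intg 0 rho (cint (fun z => `|W z|) c) <= S.
    apply: le_trans hS; rewrite (@intg_split _ 0 rho (n / 2))//; last exact/cts_within/cts_cint.
    by rewrite lerDl; apply: intg_ge0 => s _; exact: cint_ge0.
  have h3 : `|cint A c rho| <= cint (fun z => `|A z|) c rho by apply: abs_intg; exact: cts_circ.
  have h4 : pi * 2 * `|A c| <= `|cint A c rho| + `|cint A c rho - pi * 2 * A c|.
    have {1}-> : pi * 2 * `|A c| = `|cint A c rho - (cint A c rho - pi * 2 * A c)|.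
      by rewrite subKr normrM ger0_norm// mulr_ge0// pi_ge0.
    exact: ler_normB.
  lra.
have h2 : energy (fun z => `|A z|) c (n / 4) (n / 2) <= energy (fun z => `|A z|) 0 (n - n / 2) (n + n / 2).
  by apply: energy_disc_annulus => //; rewrite -/n; lra.
have h3 : energy (fun z => `|A z|) 0 (n - n / 2) (n + n / 2) <= intg (n - n / 2) (n + n / 2) (fun s => s * m).
  apply: le_intg; [exact: cts_scint|exact: cX|] => s /andP[s1 s2].
  have [sp sn] := annulus_scales n0 s1 s2.
  by rewrite (ler_wpM2l sp)// hm.
have [l1 l2] := annulus_bounds n0.
rewrite (idk _ _ _ l1) in h1; rewrite (idk _ _ _ l2) in h3.
rewrite -lerBlDr; exact: annulus_algebra n0 (le_trans h1 (le_trans h2 h3)).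
Qed.

End CircleMeans.

(** * Numerical inequalities behind the constants *)

(** A quarter of the left side is absorbed; [pi >= 2] then gives [(2 * A * t)^2 <= 64 / 3 * q^2],
    and [64 / 3 <= 25]. *)
Lemma sup_algebra {R : realType} (A t q e : R) : 0 < A -> 0 < t -> 0 < q ->
  pi * A * (t ^+ 2 / 2) <= pi * 2 * (A / 8) * (t ^+ 2 / 2) + 4 / A * e -> e <= q ^+ 2 ->
  A * (2 * t) <= 5 * q.
Proof.
move=> A0 t0 q0 L12 L3; have pi2 := @pi_ge2 R.
have L4 : 4 / A * e <= 4 / A * q ^+ 2 by rewrite ler_wpM2l// divr_ge0// ltW.
have L5 : pi * (A * t ^+ 2) * (3 / 8) <= 4 / A * q ^+ 2.
  move: (4 / A * q ^+ 2) (4 / A * e) L4 L12 => k k' L4 L12; move: (t ^+ 2) L12 => t2; lra.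
have L6 : 2 * (A * t ^+ 2) * (3 / 8) <= 4 / A * q ^+ 2.
  apply: le_trans L5; rewrite ler_pM2r; last by lra.
  by rewrite ler_wpM2r// mulr_ge0// ?sqr_ge0// ltW.
have L7 : A ^+ 2 * t ^+ 2 * 3 <= 16 * q ^+ 2.
  have := ler_wpM2l (ltW A0) L6.
  have -> : A * (4 / A * q ^+ 2) = 4 * q ^+ 2 by field; rewrite gt_eqF.
  lra.
rewrite -ler_sqr ?nnegrE ?mulr_ge0//; [|exact: ltW|exact: ltW|exact: ltW].
have -> : (A * (2 * t)) ^+ 2 = 4 * (A ^+ 2 * t ^+ 2) by ring.
have -> : (5 * q) ^+ 2 = 25 * q ^+ 2 by ring.
have := sqr_ge0 q; lra.
Qed.

Lemma picked_far {R : realType} (r1 r d t delta n1 n2 n3 : R) : 0 < r1 -> 0 < d ->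
  d + n3 = delta -> 0 <= n3 -> n1 - (2 * delta - d) <= n2 ->
  r1 + 4 * delta < n1 -> r + 4 * delta <= n1 -> d = 2 * t ->
  [/\ t <= n2, r <= n2 - t & 0 <= n2 - t].
Proof. by move=> *; split; lra. Qed.

(** Compatibility of the scales in [decay]: [Rr = |z0|], [n = |z1|], [h0] and [a] are the values of
    [|w|] at [z0] and [z1], [d] is the distance from [z1] to the boundary of the picking disc, and
    [Kb] will bound the coefficient [B] near [z1]. *)
Lemma picked_scales {R : realType} (r1 rn r s0 K eT Rr n d dist a h0 Kb delta : R) :
  0 < r1 -> 0 <= rn -> r <= rn -> 0 <= K -> s0 = r1 + rn + 1 ->
  4 * (s0 + 1) + 3 * (3 + 4 * K) + eT <= Rr -> 0 < eT ->
  0 < d -> d + dist = Rr / 2 -> 0 <= dist -> Rr - Rr / 2 <= n -> n <= Rr + Rr / 2 ->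
  1 < h0 -> 0 <= a -> h0 * (Rr / 2) <= a * d -> Kb = 2 * a + K * (1 + 2 * n) + 1 ->
  delta = (4 * Kb)^-1 ->
  [/\ [/\ h0 <= a, 1 <= a, 0 < n & 0 < Kb], [/\ 0 < delta, 2 * delta <= d / 2 & 2 * delta <= n],
    [/\ r1 + 4 * delta < n, r + 4 * delta <= n, delta <= n / 2, r <= n / 2 & r1 < n / 2] &
    [/\ Kb <= (3 + 4 * K) * Rr * a, s0 <= n / 2, r1 < s0, r <= s0 & 1 <= s0]].
Proof.
move=> r10 rn0 rrn K0 s0E hR eT0 d0 dz dist0 n1 n2 h01 a0 AW KbE deltaE.
have Rr4 : 4 <= Rr by lra.
have ha : h0 <= a.
  have h : a * d <= a * (Rr / 2) by rewrite ler_wpM2l//; lra.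
  have R2 : 0 < Rr / 2 by lra.
  by rewrite -(ler_pM2r R2); apply: le_trans h.
have a1 : 1 <= a by lra.
have n0 : 0 < n by lra.
have Kn0 : 0 <= K * (1 + 2 * n) by rewrite mulr_ge0//; lra.
have Kb3 : 3 <= Kb by lra.
have Kb0 : 0 < Kb by lra.
have delta0 : 0 < delta by rewrite deltaE invr_gt0 mulr_gt0.
have Kd : Kb * delta = 1 / 4 by rewrite deltaE; field; rewrite gt_eqF.
have delta1 : delta <= 1 / 12.
  have : 3 * delta <= Kb * delta by rewrite ler_wpM2r// ltW.
  lra.
(* The disc on which [W] is estimated must fit into the one where [|w| <= 2 * a]. This holds because
   [Kb * delta = 1 / 4], while [Kb * d >= a * d >= h0 * (Rr / 2)] is at least 2. *)
have dd : 2 * delta <= d / 2.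
  rewrite -(ler_pM2l Kb0).
  have e1 : a * d <= Kb * d by rewrite ler_wpM2r ?(ltW d0)//; lra.
  have e2 : 1 * (Rr / 2) <= h0 * (Rr / 2) by rewrite ler_wpM2r ?(ltW h01)//; lra.
  lra.
have KbR : Kb <= (3 + 4 * K) * Rr * a.
  have Ra : a <= Rr * a by rewrite ler_peMl//; lra.
  have Ra2 : Rr <= Rr * a by rewrite ler_peMr//; lra.
  have Kn : K * (1 + 2 * n) <= K * (4 * (Rr * a)) by rewrite ler_wpM2l//; lra.
  lra.
by split; [split|split|split|split] => //; lra.
Qed.

Lemma radius_large {R : realType} (r1 rn s0 K eT Rr : R) :
  0 < r1 -> 0 <= rn -> 0 <= K -> s0 = r1 + rn + 1 ->
  4 * (s0 + 1) + 3 * (3 + 4 * K) + eT <= Rr -> 0 < eT ->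
  [/\ 3 * (3 + 4 * K) <= Rr, eT <= Rr & 9 / 4 <= Rr].
Proof. by move=> *; split; lra. Qed.

(** Two factors 3 / 2 accumulate, from [z0] to [z1] and from [|z1|] to the outer circle;
    [9 / 4 <= Rr] then gives [s <= Rr ^+ 2]. *)
Lemma ln_square_bound {R : realType} (Rr n s : R) : 9 / 4 <= Rr -> n <= Rr + Rr / 2 ->
  0 < s -> s <= 3 / 2 * n -> ln s <= 2 * ln Rr.
Proof.
move=> R9 nR s0 sn; have Rr0 : 0 < Rr by lra.
rewrite (mulr_natl (ln Rr) 2) -lnXn// ler_ln ?posrE ?exprn_gt0// expr2.
have : 9 / 4 * Rr <= Rr * Rr by rewrite ler_wpM2r//; lra.
lra.
Qed.

(** Adding the two components and absorbing [4 * q * a <= a / 2] gives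
    [a <= 12 * M0 + 252 * (q * lam)]. The constants 24 and 504 are the doubles, so that each term
    takes at most half of [eps * lam]. *)
Lemma absorb_bound {R : realType} (x y a q k lam eps M0 : R) :
  0 <= a -> a <= x + y -> q <= 1 / 8 -> 0 <= M0 -> k = 504 -> q * k * lam <= eps * lam ->
  eps + 1 + 24 * M0 <= eps * lam ->
  x <= 3 * M0 + 63 * (q * lam) + 2 * (q * a) -> y <= 3 * M0 + 63 * (q * lam) + 2 * (q * a) ->
  0 < eps -> a <= eps * lam.
Proof.
move=> a0 axy q8 M00 kE ql el hx hy e0; rewrite kE in ql.
have qa : q * a <= 1 / 8 * a by rewrite ler_wpM2r.
lra.
Qed.

(** * Decay for a divergence-free field with nearly conjugate vorticity *)

Section Decay.
Context {R : realType}.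
Notation leb := (@lebesgue_measure R).
Notation leb2 := (leb \x leb)%E.
Variables (r1 K : R) (U V Ux Uy Vx Vy Wx Wy F1 F2 : R * R -> R).
Implicit Types (z w c : R * R).
Hypothesis r10 : 0 < r1.
Hypothesis K0 : 0 <= K.
Hypotheses (cU : continuous U) (cV : continuous V).
Hypotheses (cUx : continuous Ux) (cUy : continuous Uy).
Hypotheses (cVx : continuous Vx) (cVy : continuous Vy).
Hypotheses (cWx : continuous Wx) (cWy : continuous Wy).
Hypotheses (cF1 : continuous F1) (cF2 : continuous F2).

Let W z := Vx z - Uy z.
Let G z := Ux z ^+ 2 + Uy z ^+ 2 + Vx z ^+ 2 + Vy z ^+ 2.
Let B z := enorm (U z, V z) + K * (1 + enorm z).

Hypothesis gU : forall z, r1 < enorm z -> has_grad U z (Ux z) (Uy z).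
Hypothesis gV : forall z, r1 < enorm z -> has_grad V z (Vx z) (Vy z).
Hypothesis gW : forall z, r1 < enorm z -> has_grad W z (Wx z) (Wy z).
Hypothesis divfree : forall z, r1 < enorm z -> Ux z + Vy z = 0.
(** [(F1, F2)] is the part of the gradient of [W] that satisfies the Cauchy-Riemann equations with
    the potential [Q] of [hQ]; the remainder is of order [B * |W|]. *)
Hypothesis hF1 : forall z, r1 < enorm z -> `|Wx z - F1 z| <= B z * `|W z|.
Hypothesis hF2 : forall z, r1 < enorm z -> `|Wy z - F2 z| <= B z * `|W z|.
Hypothesis hQ : forall c (rho : R), 0 < rho ->
  (forall w, enorm (w - c) < rho -> r1 < enorm w) ->
  exists Q, forall w, enorm (w - c) < rho / 2 -> has_grad Q w (- F2 w) (F1 w).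
Hypothesis hG : (\int[leb2]_z (G z)%:E < +oo)%E.

Let cW : continuous W. Proof. exact: cts_sub. Qed.
Let caW : continuous (fun z => `|W z|). Proof. exact: cts_norm. Qed.

Let cG : continuous G.
Proof. by do 3 (apply: cts_add; last exact: cts_exp); exact: cts_exp. Qed.

Let G0 z : 0 <= G z. Proof. by rewrite !addr_ge0// sqr_ge0. Qed.

Let nw z := enorm (U z, V z).

Let cnw : continuous nw.
Proof.
move=> z; apply: (@continuous_comp _ _ _ (fun z => (U z, V z)) enorm).
  by apply: cts_pair; [exact: cU|exact: cV].
exact: continuous_enorm.
Qed.

Let nw0 z : 0 <= nw z. Proof. exact: enorm_ge0. Qed.

Let cB : continuous B.
Proof.
apply: cts_add; first exact: cnw.
by apply: cts_mul; [exact: cts_cst|apply: cts_add; [exact: cts_cst|exact: continuous_enorm]].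
Qed.

Let B0 z : 0 <= B z.
Proof. by rewrite addr_ge0 ?enorm_ge0// mulr_ge0// addr_ge0// enorm_ge0. Qed.

Let sqW z : `|W z| ^+ 2 <= 2 * G z.
Proof.
rewrite real_normK ?num_real// /W /G -subr_ge0.
have -> : 2 * (Ux z ^+ 2 + Uy z ^+ 2 + Vx z ^+ 2 + Vy z ^+ 2) - (Vx z - Uy z) ^+ 2 =
  2 * Ux z ^+ 2 + 2 * Vy z ^+ 2 + (Vx z + Uy z) ^+ 2 by ring.
by apply: addr_ge0; [apply: addr_ge0; apply: mulr_ge0|]; rewrite ?sqr_ge0.
Qed.

(** [circle_mean_le] for the pair [(W, Q)]. The potential is available only on the disc of half the
    radius, hence [2 * tau] in the hypothesis. *)
Lemma W_mean c tau : 0 <= tau -> r1 + 2 * tau < enorm c ->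
  `|cint W c tau - pi * 2 * W c| <= intg 0 tau (cint (fun z => 2 * B z * `|W z|) c).
Proof.
move=> t0 tc; have rho0 : 0 < enorm c - r1 by lra.
have ext w : enorm (w - c) < enorm c - r1 -> r1 < enorm w.
  move=> h; have := enorm_ge_sub (lexx (enorm (w - c))); lra.
have [Q hq] := hQ rho0 ext.
have inD (s phi : R) : 0 <= s <= tau -> enorm (cpt c s phi - c) < (enorm c - r1) / 2.
  by move=> /andP[s0 st]; rewrite enorm_cpt//; lra.
have extD w : enorm (w - c) < (enorm c - r1) / 2 -> r1 < enorm w.
  by move=> h; apply: ext; lra.
apply: (@circle_mean_le R W Q Wx Wy (fun z => - F2 z) F1 _ c tau
  [set w | enorm (w - c) < (enorm c - r1) / 2]) => //.
- exact: open_eball.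
- by move=> w /extD; exact: gW.
- exact: cts_opp.
- by apply: cts_mul => //; apply: cts_mul => //; exact: cts_cst.
- move=> w /extD rw; have -> : 2 * B w * `|W w| = B w * `|W w| + B w * `|W w| by ring.
  exact: lerD (hF1 rw) (hF2 rw).
Qed.

(** The pairs are [(U, - V)] and [(V, U)]: in each, one Cauchy-Riemann equation is the vanishing of
    the divergence and the defect in the other is [|W|]. *)
Lemma UV_mean c rho : 0 <= rho -> r1 + rho < enorm c ->
  `|cint U c rho - pi * 2 * U c| <= intg 0 rho (cint (fun z => `|W z|) c) /\
  `|cint V c rho - pi * 2 * V c| <= intg 0 rho (cint (fun z => `|W z|) c).
Proof.
move=> rho0 rc.
have inD (s phi : R) : 0 <= s <= rho -> r1 < enorm (cpt c s phi).
  by move=> /andP[s0 st]; apply: exterior_cpt => //; lra.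
have oD := @open_exterior R r1.
split.
- apply: (circle_mean_le (C := fun z => - V z) (A1 := Ux) (A2 := Uy)
    (C1 := fun z => - Vx z) (C2 := fun z => - Vy z) oD rho0 inD gU) => //.
  + move=> w /gV[[d1 e1] [d2 e2]]; split.
      by have := is_deriveN (DeriveDef d1 e1).
    by have := is_deriveN (DeriveDef d2 e2).
  + exact: cts_opp.
  + exact: cts_opp.
  + by move=> w /divfree E; rewrite opprK E normr0 add0r /W distrC.
- apply: (circle_mean_le (C := U) (A1 := Vx) (A2 := Vy)
    (C1 := Ux) (C2 := Uy) oD rho0 inD gV gU) => //.
  by move=> w /divfree E; rewrite addrC [Vy w + _]addrC E normr0 add0r.
Qed.

(** Point picking for [|W|] gives [z2] with value [A] and a disc of radius [t = d / 2] where
    [|W| <= 2 * A]. By [W_mean], the circle integrals of [|W|] about [z2] stay above [pi * A], half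
    of [2 pi A]. Integrated over the disc, this is compatible with an energy of at most [q ^+ 2]
    only if [A * t] is of order [q]. *)
Lemma W_sup c Kb q r : 0 < Kb -> 0 < q ->
  (forall s1 s2, 0 <= s1 -> r <= s1 -> s1 <= s2 -> energy G 0 s1 s2 <= q ^+ 2) ->
  (forall w, enorm (w - c) <= 2 * (4 * Kb)^-1 -> B w <= Kb) ->
  r1 + 4 * (4 * Kb)^-1 < enorm c -> r + 4 * (4 * Kb)^-1 <= enorm c ->
  forall z, enorm (z - c) <= (4 * Kb)^-1 -> `|W z| * (4 * Kb)^-1 <= 5 * q.
Proof.
move=> Kb0 q0 tail; set delta := (4 * Kb)^-1 => hB r1c rc z zc.
have delta0 : 0 < delta by rewrite invr_gt0 mulr_gt0.
have Kd : Kb * delta = 1 / 4 by rewrite /delta; field; rewrite gt_eqF.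
have [->|Wz0] := eqVneq (W z) 0; first by rewrite normr0 mul0r mulr_ge0// ltW.
have Wz : 0 < `|W z| by rewrite normr_gt0.
have [z2 [d [d0 dz AW Wle]]] := point_picking caW (fun w => normr_ge0 (W w)) Wz delta0.
apply: le_trans AW _.
set A := `|W z2|; set t := d / 2.
have t0 : 0 < t by rewrite divr_gt0.
have dE : d = 2 * t by rewrite /t; lra.
have A0 : 0 <= A by exact: normr_ge0.
have z2z0 : 0 <= enorm (z2 - z) by exact: enorm_ge0.
have z2c : enorm (z2 - c) <= 2 * delta - d.
  have -> : z2 - c = (z2 - z) + (z - c) by rewrite addrA subrK.
  by apply: le_trans (enormD _ _) _; lra.
have z2e : enorm c - (2 * delta - d) <= enorm z2 by exact: enorm_ge_sub.
have [A00|Ap] := leP A 0; first by have : A * d <= 0 by [rewrite mulr_le0_ge0// ltW]; lra.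
(* From [t <= delta / 2] and [Kb * delta = 1 / 4]. The 4 in [delta] is made for this bound, which
   keeps the defect below [pi * A]. *)
have Kt : Kb * t <= 1 / 8.
  have : Kb * (2 * t) <= Kb * delta by rewrite ler_wpM2l ?(ltW Kb0)//; lra.
  lra.
have cH : continuous (fun z => 2 * B z * `|W z|).
  by apply: cts_mul => //; apply: cts_mul => //; exact: cts_cst.
have low tau : 0 <= tau <= t -> pi * A <= cint (fun z => `|W z|) z2 tau.
  move=> /andP[tau0 taut].
  have r1z2 : r1 + 2 * tau < enorm z2 by lra.
  have M := W_mean tau0 r1z2.
  have H1 : intg 0 tau (cint (fun z => 2 * B z * `|W z|) z2) <= tau * (pi * 2 * (4 * Kb * A)).
    have := @intg_cst R 0 tau (pi * 2 * (4 * Kb * A)) tau0; rewrite subr0 => <-.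
    apply: le_intg; [exact: cts_cint|exact: cts_cst|] => s /andP[s0 st].
    rewrite -(cint_cst _ z2 s); apply: le_cint => //; first exact: cts_cst.
    move=> phi; have Ws : `|W (cpt z2 s phi)| <= 2 * A by apply: Wle; rewrite enorm_cpt// -/t; lra.
    have Bs : B (cpt z2 s phi) <= Kb.
      apply: hB; have -> : cpt z2 s phi - c = (cpt z2 s phi - z2) + (z2 - c) by rewrite addrA subrK.
      by apply: le_trans (enormD _ _) _; rewrite enorm_cpt//; lra.
    have -> : 4 * Kb * A = (2 * Kb) * (2 * A) by ring.
    by apply: ler_pM => //; [rewrite mulr_ge0|rewrite ler_wpM2l].
  have H2 : tau * (pi * 2 * (4 * Kb * A)) <= pi * A.
    have -> : tau * (pi * 2 * (4 * Kb * A)) = (pi * A) * (8 * (Kb * tau)) by ring.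
    have h8 : 8 * (Kb * tau) <= 1.
      by have := ler_wpM2l (ltW Kb0) taut; lra.
    by rewrite ler_piMr// mulr_ge0// pi_ge0.
  have H3 : `|cint W z2 tau| <= cint (fun z => `|W z|) z2 tau by apply: abs_intg; exact: cts_circ.
  have H4 : pi * 2 * A <= `|cint W z2 tau| + `|cint W z2 tau - pi * 2 * W z2|.
    have {1}-> : pi * 2 * A = `|cint W z2 tau - (cint W z2 tau - pi * 2 * W z2)|.
      by rewrite subKr normrM ger0_norm// mulr_ge0// pi_ge0.
    exact: ler_normB.
  lra.
have cX k : continuous (fun s : R => s * k) by apply: cts_mul; [exact: cts_id|exact: cts_cst].
have idk k : intg 0 t (fun s => s * k) = k * (t ^+ 2 / 2).
  have := @intg_id R 0 t (ltW t0); rewrite expr0n /= subr0 => <-.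
  by rewrite -(intgZ _ _ _ (@cts_id R)); apply: eq_intg => s _; rewrite mulrC.
have L1 : pi * A * (t ^+ 2 / 2) <= energy (fun z => `|W z|) z2 0 t.
  rewrite -idk; apply: le_intg; [exact: cX|exact: cts_scint|] => s st.
  by have [s0 _] := andP st; rewrite (ler_wpM2l s0)// low.
(* Young's inequality [|W| <= A / 8 + 2 * |W|^2 / A], weighted so that its first term is a quarter
   of the lower bound [L1]. *)
have L2 : energy (fun z => `|W z|) z2 0 t <= pi * 2 * (A / 8) * (t ^+ 2 / 2) + 4 / A * energy G z2 0 t.
  have cs := @cts_scint _ _ z2 cG.
  rewrite -idk -(intgZ _ _ _ cs).
  have cG4 : continuous (fun s : R => 4 / A * (s * cint G z2 s)) by apply: cts_mul => //; exact: cts_cst.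
  rewrite -(intgD _ _ (cX _) cG4).
  apply: le_intg; [exact: cts_scint|exact: cts_add|] => s /andP[s0 _].
  have -> : s * (pi * 2 * (A / 8)) + 4 / A * (s * cint G z2 s) = s * (pi * 2 * (A / 8) + 4 / A * cint G z2 s) by ring.
  apply: (ler_wpM2l s0).
  have cG4' : continuous (fun z => 4 / A * G z) by apply: cts_mul => //; exact: cts_cst.
  rewrite -(cint_cst (A / 8) z2 s) -cintZ// -cintD//; last exact: cts_cst.
  apply: le_cint => //; first by apply: cts_add => //; exact: cts_cst.
  move=> phi; set w := cpt _ _ _.
  apply: (@le_trans _ _ (A / 8 + 4 / A * (`|W w| ^+ 2 / 2))); last first.
    by rewrite lerD2l ler_wpM2l//; [rewrite divr_ge0|have := sqW w; lra].
  rewrite -subr_ge0.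
  have -> : A / 8 + 4 / A * (`|W w| ^+ 2 / 2) - `|W w| = (A - 4 * `|W w|) ^+ 2 / (8 * A).
    by field; rewrite gt_eqF.
  by rewrite divr_ge0 ?sqr_ge0// mulr_ge0.
have L3 : energy G z2 0 t <= q ^+ 2.
  have [x1 x2 x3] : [/\ t <= enorm z2, r <= enorm z2 - t & 0 <= enorm z2 - t].
    exact: (picked_far r10 d0 dz z2z0 z2e r1c rc dE).
  apply: (le_trans (energy_disc_annulus cG G0 (lexx 0) (ltW t0) x1)).
  apply: tail => //; rewrite lerBlDr -addrA lerDl addr_ge0//; exact: ltW.
rewrite dE; exact: (sup_algebra Ap t0 q0 (le_trans L1 L2) L3).
Qed.

Definition tail_at (q r : R) :=
  forall s1 s2, 0 <= s1 -> r <= s1 -> s1 <= s2 -> energy G 0 s1 s2 <= q ^+ 2.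

Lemma pi_lt4 : pi < 4 :> R.
Proof. by have := @pihalf_lt2 R; lra. Qed.

(** Up to radius [delta] the pointwise bound contributes [10 pi q]; beyond it [log_energy] applies
    with [eta = q / lam]. With [pi < 4] and [1 <= lam] the coefficient of [q * lam] is
    [40 + 1 / 2 + 24 <= 65]. *)
Lemma vorticity_integral c (delta q r lam a : R) : 0 < delta -> 0 < q -> 1 <= lam -> 0 <= a ->
  tail_at q r -> delta <= enorm c / 2 -> r <= enorm c / 2 ->
  (forall w, enorm (w - c) <= delta -> `|W w| * delta <= 5 * q) ->
  ln (enorm c / 2) - ln delta <= 3 * lam ^+ 2 + a ->
  intg 0 (enorm c / 2) (cint (fun z => `|W z|) c) <= 65 * (q * lam) + 8 * (q * a).
Proof.
move=> d0 q0 lam1 a0 tail; set n := enorm c => dn rn Wd hln.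
have lam0 : 0 < lam by lra.
rewrite (@intg_split _ 0 delta (n / 2))//; [|exact: ltW|exact/cts_within/cts_cint].
have S1 : intg 0 delta (cint (fun z => `|W z|) c) <= pi * (10 * q).
  have -> : pi * (10 * q) = (delta - 0) * (pi * 2 * (5 * q / delta)) by field; rewrite gt_eqF.
  rewrite -(intg_cst _ (ltW d0)).
  apply: le_intg; [exact: cts_cint|exact: cts_cst|] => s /andP[s0 sd].
  rewrite -(cint_cst _ c s); apply: le_cint => //; first exact: cts_cst.
  by move=> phi; rewrite ler_pdivlMr//; apply: Wd; rewrite enorm_cpt.
have eta0 : 0 < q / lam by rewrite divr_gt0.
have S2 := log_energy c cG caW sqW d0 dn eta0.
have S3 : energy G c delta (n / 2) <= q ^+ 2.
  have nn : n / 2 <= enorm c by rewrite -/n; lra.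
  apply: (le_trans (energy_disc_annulus cG G0 (ltW d0) dn nn)).
  apply: tail; rewrite -/n; lra.
have S4 : energy G c delta (n / 2) / (2 * (q / lam)) <= q * lam / 2.
  rewrite ler_pdivrMr ?mulr_gt0 ?invr_gt0//.
  have -> : q * lam / 2 * (2 * (q / lam)) = q ^+ 2 by field; rewrite gt_eqF.
  exact: S3.
have S5 : q / lam * (pi * 2) * (ln (n / 2) - ln delta) <= pi * 2 * (3 * (q * lam) + q * a).
  apply: (@le_trans _ _ (q / lam * (pi * 2) * (3 * lam ^+ 2 + a))).
    by rewrite ler_wpM2l// mulr_ge0 ?(ltW eta0)// mulr_ge0// pi_ge0.
  have -> : q / lam * (pi * 2) * (3 * lam ^+ 2 + a) = pi * 2 * (3 * (q * lam) + q * a / lam).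
    by field; rewrite gt_eqF.
  rewrite ler_wpM2l ?mulr_ge0 ?pi_ge0// lerD2l ler_pdivrMr// ler_peMr//.
  by rewrite mulr_ge0// ltW.
have p4 := pi_lt4.
have ql : q <= q * lam by rewrite ler_peMr// ltW.
have qa : 0 <= q * a by rewrite mulr_ge0// ltW.
have pq : pi * (10 * q) <= 4 * (10 * q) by rewrite ler_wpM2r ?(ltW p4)// mulr_ge0// ltW.
have pqa : pi * 2 * (3 * (q * lam) + q * a) <= 4 * 2 * (3 * (q * lam) + q * a).
  rewrite ler_wpM2r//; last by lra.
  have qlam0 : 0 <= q * lam by lra.
  lra.
have S6 := le_trans S2 (lerD S4 S5).
move: S1 S6; set I1 := intg 0 delta _; set I2 := intg delta (n / 2) _ => S1 S6.
lra.
Qed.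

(** Growth from the fixed circle [s0], again with [eta = q / lam]. The two terms of [log_energy]
    give [1 / 2 + 16], rounded up to 17; [1 <= s0] lets [ln s0] be dropped. *)
Lemma circle_average (A A1 A2 : R * R -> R) (s0 s q r lam M0 : R) :
  continuous A -> continuous A1 -> continuous A2 ->
  (forall w, r1 < enorm w -> has_grad A w (A1 w) (A2 w)) ->
  (forall w, (`|A1 w| + `|A2 w|) ^+ 2 <= 2 * G w) ->
  0 < q -> 1 <= lam -> tail_at q r -> r1 < s0 -> 1 <= s0 -> r <= s0 -> s0 <= s ->
  ln s <= 2 * lam ^+ 2 -> cint (fun z => `|A z|) 0 s0 <= M0 ->
  cint (fun z => `|A z|) 0 s <= M0 + 17 * (q * lam).
Proof.
move=> cA cA1 cA2 gA AG q0 lam1 tail r1s0 s01 rs0 s0s lns hM0.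
have lam0 : 0 < lam by lra.
have s00 : 0 < s0 by lra.
have H1 := cint_growth cA cA1 cA2 gA (ltW r10) r1s0 s0s.
have eta0 : 0 < q / lam by rewrite divr_gt0.
have cH : continuous (fun z => `|A1 z| + `|A2 z|) by apply: cts_add; exact: cts_norm.
have S2 := log_energy 0 cG cH AG s00 s0s eta0.
have S3 : energy G 0 s0 s <= q ^+ 2 by apply: tail; lra.
have S4 : energy G 0 s0 s / (2 * (q / lam)) <= q * lam / 2.
  rewrite ler_pdivrMr ?mulr_gt0 ?invr_gt0//.
  have -> : q * lam / 2 * (2 * (q / lam)) = q ^+ 2 by field; rewrite gt_eqF.
  exact: S3.
have ln0 : 0 <= ln s0 by exact: ln_ge0.
have S5 : q / lam * (pi * 2) * (ln s - ln s0) <= pi * (4 * (q * lam)).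
  have -> : pi * (4 * (q * lam)) = q / lam * (pi * 2) * (2 * lam ^+ 2) by field; rewrite gt_eqF.
  by rewrite ler_wpM2l//; [rewrite mulr_ge0 ?(ltW eta0)// mulr_ge0// pi_ge0|lra].
have ql : 0 < q * lam by rewrite mulr_gt0.
have pq : pi * (4 * (q * lam)) <= 4 * (4 * (q * lam)).
  by rewrite ler_wpM2r ?(ltW pi_lt4)//; lra.
have S6 := le_trans S2 (lerD S4 S5); lra.
Qed.

(** [pi >= 2] turns the factor [2 pi] into 4, and [32 / 3 * 17 + 65 <= 4 * 63]. *)
Lemma component_bound (A : R * R -> R) c (q lam a M0 : R) :
  continuous A ->
  (forall rho, 0 <= rho -> r1 + rho < enorm c ->
     `|cint A c rho - pi * 2 * A c| <= intg 0 rho (cint (fun z => `|W z|) c)) ->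
  r1 < enorm c / 2 -> 0 < q -> 1 <= lam -> 0 <= a -> 0 <= M0 ->
  (forall s, enorm c / 2 <= s <= 3 / 2 * enorm c ->
     cint (fun z => `|A z|) 0 s <= M0 + 17 * (q * lam)) ->
  intg 0 (enorm c / 2) (cint (fun z => `|W z|) c) <= 65 * (q * lam) + 8 * (q * a) ->
  `|A c| <= 3 * M0 + 63 * (q * lam) + 2 * (q * a).
Proof.
move=> cA mean r1c q0 lam1 a0 M00 hm hS.
have c0 : 0 < enorm c by have := r10; lra.
have H := average_bound cA cW mean r1c c0 hm hS.
have ql : 0 < q * lam by rewrite mulr_gt0//; lra.
have qa : 0 <= q * a by rewrite mulr_ge0// ltW.
have : 2 * 2 * `|A c| <= pi * 2 * `|A c|.
  by rewrite !ler_wpM2r ?normr_ge0// pi_ge2.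
lra.
Qed.

Lemma sqUV z : (`|Ux z| + `|Uy z|) ^+ 2 <= 2 * G z /\ (`|Vx z| + `|Vy z|) ^+ 2 <= 2 * G z.
Proof.
have h (x y : R) : (`|x| + `|y|) ^+ 2 <= 2 * (x ^+ 2 + y ^+ 2).
  rewrite -[x ^+ 2]real_normK ?num_real// -[y ^+ 2]real_normK ?num_real// -subr_ge0.
  have -> : 2 * (`|x| ^+ 2 + `|y| ^+ 2) - (`|x| + `|y|) ^+ 2 = (`|x| - `|y|) ^+ 2 by ring.
  exact: sqr_ge0.
have := sqr_ge0 (Ux z); have := sqr_ge0 (Uy z); have := sqr_ge0 (Vx z); have := sqr_ge0 (Vy z).
have := h (Ux z) (Uy z); have := h (Vx z) (Vy z); rewrite /G.
by split; lra.
Qed.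

(** The ratio of the scales is [2 * n * Kb], at most [3 * (3 + 4 * K) * Rr ^+ 2 * a]. A third factor
    [Rr] swallows the constant, and [ln a <= a] ends the estimate. *)
Lemma ln_scale (n Kb Rr a : R) : 1 <= Rr -> 1 <= a -> 0 < n -> n <= 3 / 2 * Rr -> 0 < Kb ->
  Kb <= (3 + 4 * K) * Rr * a -> 3 * (3 + 4 * K) <= Rr ->
  ln (n / 2) - ln (4 * Kb)^-1 <= 3 * ln Rr + a.
Proof.
move=> R1 a1 n0 nR Kb0 KbR CR.
have Rr0 : 0 < Rr by lra.
have a0 : 0 < a by lra.
have Kb4 : 0 < 4 * Kb by rewrite mulr_gt0.
rewrite lnV ?posrE// opprK -lnM ?posrE//; last by rewrite divr_gt0.
have h : n / 2 * (4 * Kb) <= Rr ^+ 3 * a.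
  have -> : n / 2 * (4 * Kb) = 2 * n * Kb by field.
  apply: (@le_trans _ _ (3 * Rr * ((3 + 4 * K) * Rr * a))).
    by apply: ler_pM => //; [lra|exact: ltW|lra].
  have -> : 3 * Rr * ((3 + 4 * K) * Rr * a) = (3 * (3 + 4 * K)) * (Rr ^+ 2 * a) by ring.
  have -> : Rr ^+ 3 * a = Rr * (Rr ^+ 2 * a) by ring.
  by rewrite ler_wpM2r// mulr_ge0 ?sqr_ge0// ltW.
have p1 : 0 < n / 2 * (4 * Kb) by rewrite mulr_gt0// divr_gt0.
apply: (@le_trans _ _ (ln (Rr ^+ 3 * a))).
  by rewrite ler_ln ?posrE// (lt_le_trans p1).
rewrite lnM ?posrE ?exprn_gt0// lnXn//.
by rewrite (mulr_natl (ln Rr) 3) lerD2l ltW// ln_sublinear.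
Qed.

Theorem decay (eps : R) : 0 < eps ->
  exists R0, forall z, R0 <= enorm z -> enorm (U z, V z) <= eps * Num.sqrt (ln (enorm z)).
Proof.
move=> eps0.
have [k [k0 kE]] : exists k : R, 0 < k /\ k = 504 by exists 504; split; [rewrite ltr0n|].
pose q := Num.min (1 / 8) (eps / k).
have q0 : 0 < q by rewrite lt_min !divr_gt0.
have q8 : q <= 1 / 8 by rewrite ge_min lexx.
have qe : q * k <= eps by rewrite -ler_pdivlMr// /q ge_min lexx orbT.
have [r tail] := energy_tail cG G0 hG (exprn_gt0 2 q0).
(* Beyond both [r1] and the tail radius [r]. The circle of radius [s0] is fixed, so its contribution
   [M0] is a constant, negligible against [lam]. *)
pose s0 := r1 + `|r| + 1.
pose M0 := cint (fun z => `|U z|) 0 s0 + cint (fun z => `|V z|) 0 s0.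
have MU : 0 <= cint (fun z => `|U z|) 0 s0 by exact: cint_ge0.
have MV : 0 <= cint (fun z => `|V z|) 0 s0 by exact: cint_ge0.
(* [eps * T = eps + 1 + 24 * M0], so [lam >= T] makes [eps * lam] dominate the constants. In the
   threshold below, [expR (T ^+ 2)] enforces this, [CK] absorbs the constant of [ln_scale], and the
   multiple of [s0 + 1] keeps all discs and circles outside radius [s0] or [r1]. *)
pose T := 1 + 1 / eps + 24 * M0 / eps.
pose CK := 3 * (3 + 4 * K).
exists (4 * (s0 + 1) + CK + expR (T ^+ 2)) => z0.
set Rr := enorm z0 => hR.
have eT : 0 < expR (T ^+ 2) by exact: expR_gt0.
have [hR2 hR3 hR4] : [/\ CK <= Rr, expR (T ^+ 2) <= Rr & 9 / 4 <= Rr].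
  exact: (radius_large r10 (normr_ge0 r) K0 (erefl s0) hR eT).
have Rr0 : 0 < Rr by apply: lt_le_trans hR4; rewrite divr_gt0// ltr0n.
have two0 : 0 < 2 :> R by [].
have hL : T ^+ 2 <= ln Rr by rewrite -ler_expR lnK ?posrE.
have M00 : 0 <= M0 by rewrite addr_ge0.
have T1 : 1 <= T.
  rewrite /T -addrA lerDl addr_ge0 ?divr_ge0 ?mulr_ge0//; exact: ltW.
set lam := Num.sqrt (ln Rr).
have L0 : 0 <= ln Rr by apply: le_trans hL; exact: sqr_ge0.
have lam2 : lam ^+ 2 = ln Rr by rewrite sqr_sqrtr.
have Tlam : T <= lam.
  by rewrite -ler_sqr ?nnegrE ?sqrtr_ge0 ?lam2//; apply: le_trans T1.
have lam1 : 1 <= lam by exact: le_trans Tlam.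
have epsT : eps + 1 + 24 * M0 <= eps * lam.
  have -> : eps + 1 + 24 * M0 = eps * T by rewrite /T; field; rewrite gt_eqF.
  by rewrite ler_wpM2l// ltW.
(* Values at most 1 are already below [eps * lam]. Otherwise [a > 1], as the scales and the bound
   [ln a <= a] require. *)
have [small|big] := leP (nw z0) 1.
  by apply: (le_trans small); lra.
have [z1 [d [d0 dz AW Wle]]] := point_picking cnw nw0 (lt_trans ltr01 big) (divr_gt0 Rr0 two0).
set a := nw z1 in AW Wle; set n := enorm z1.
have z1z0 : 0 <= enorm (z1 - z0) by exact: enorm_ge0.
have z1R : enorm (z1 - z0) <= Rr / 2 by rewrite -dz lerDr ltW.
have n1 : Rr - Rr / 2 <= n := enorm_ge_sub z1R.
have n2 : n <= Rr + Rr / 2 := enorm_le_add z1R.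
have a00 : 0 <= a by exact: nw0.
(* [Kb] bounds [B] on the disc of radius [2 * delta] about [z1], where [|w| <= 2 * a] and, as
   [2 * delta <= n], the norm is at most [2 * n]. The final 1 keeps [delta] bounded. *)
pose Kb := 2 * a + K * (1 + 2 * n) + 1; pose delta := (4 * Kb)^-1.
have [[za a1 n0 Kb0] [delta0 dd dn] [r1c rc dn2 rn2 nn0] [KbR s0n r1s0 rs0 s01]] :=
  picked_scales r10 (normr_ge0 r) (ler_norm r) K0 (erefl s0) hR eT d0 dz z1z0 n1 n2 big a00 AW
    (erefl Kb) (erefl delta).
have hB w : enorm (w - z1) <= 2 * delta -> B w <= Kb.
  move=> hw; rewrite /Kb -addrA; apply: lerD; first by apply: Wle; exact: le_trans dd.
  apply: ler_wpDr => //; apply: ler_wpM2l => //; rewrite lerD2l.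
  by apply: le_trans (enorm_le_add hw) _; rewrite [leRHS]mulr_natl mulr2n lerD2l.
have Ws w : enorm (w - z1) <= delta -> `|W w| * delta <= 5 * q.
  exact: (W_sup Kb0 q0 tail hB r1c rc).
have hln : ln (n / 2) - ln delta <= 3 * lam ^+ 2 + a.
  have R1 : 1 <= Rr by apply: le_trans hR4; rewrite ler_pdivlMr// mul1r ler_nat.
  rewrite lam2; apply: (ln_scale R1 a1 n0 _ Kb0 KbR hR2).
  by apply: le_trans n2 _; rewrite le_eqVlt; apply/orP; left; apply/eqP; field.
have hS : intg 0 (n / 2) (cint (fun z => `|W z|) z1) <= 65 * (q * lam) + 8 * (q * a).
  exact: (vorticity_integral delta0 q0 lam1 a00 tail dn2 rn2 Ws hln).
have lns s : n / 2 <= s <= 3 / 2 * n -> ln s <= 2 * lam ^+ 2.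
  move=> /andP[s1 s2]; rewrite lam2; apply: (ln_square_bound hR4 n2 _ s2).
  by apply: lt_le_trans s1; rewrite divr_gt0.
have bound (A A1 A2 : R * R -> R) : continuous A -> continuous A1 -> continuous A2 ->
   (forall w, r1 < enorm w -> has_grad A w (A1 w) (A2 w)) ->
   (forall w, (`|A1 w| + `|A2 w|) ^+ 2 <= 2 * G w) ->
   (forall rho, 0 <= rho -> r1 + rho < enorm z1 ->
     `|cint A z1 rho - pi * 2 * A z1| <= intg 0 rho (cint (fun z => `|W z|) z1)) ->
   cint (fun z => `|A z|) 0 s0 <= M0 ->
   `|A z1| <= 3 * M0 + 63 * (q * lam) + 2 * (q * a).
  move=> cA cA1 cA2 gA AG mean hM.
  apply: (component_bound cA mean nn0 q0 lam1 a00 M00 _ hS) => s /[dup] ss /lns lnss.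
  move: ss => /andP[ss1 _].
  exact: (circle_average cA cA1 cA2 gA AG q0 lam1 tail r1s0 s01 rs0 (le_trans s0n ss1) lnss hM).
have UA : `|U z1| <= 3 * M0 + 63 * (q * lam) + 2 * (q * a).
  apply: (bound U Ux Uy cU cUx cUy gU (fun w => (sqUV w).1)).
    by move=> rho rho0' rc'; exact: (UV_mean rho0' rc').1.
  by rewrite lerDl.
have VA : `|V z1| <= 3 * M0 + 63 * (q * lam) + 2 * (q * a).
  apply: (bound V Vx Vy cV cVx cVy gV (fun w => (sqUV w).2)).
    by move=> rho rho0' rc'; exact: (UV_mean rho0' rc').2.
  by rewrite lerDr.
have aUV : a <= `|U z1| + `|V z1| by exact: enorm_le.
have lam00 : 0 <= lam by exact: sqrtr_ge0.
have ql : q * k * lam <= eps * lam by exact: ler_wpM2r.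
exact: (le_trans za (absorb_bound a00 aUV q8 M00 kE ql epsT UA VA eps0)).
Qed.

End Decay.

(** * Directional derivatives and equality of mixed derivatives *)

Section PartialDerivatives.
Context {R : realType}.
Implicit Types (f g : R * R -> R) (z w : R * R) (D : set (R * R)).

Lemma dxP f z : derivable f z ex -> is_derive z.1 1 (fun t => f (t, z.2)) (dx f z).
Proof.
have E : (fun h : R => h^-1 *: (f (h *: ex + z) - f z)) =
         (fun h => h^-1 *: (f (h *: 1 + z.1, z.2) - f (z.1, z.2))).
  apply/funext => h; congr (_ *: (f _ - f _)); last by case: z.
  by case: z => x y; congr (_, _) => /=; rewrite scaler0 add0r.
move=> df; split.
  by move: df; rewrite /derivable /=; congr (cvg _); rewrite -E.
by rewrite /dx /derive -E.
Qed.

Lemma dyP f z : derivable f z ey -> is_derive z.2 1 (fun t => f (z.1, t)) (dy f z).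
Proof.
have E : (fun h : R => h^-1 *: (f (h *: ey + z) - f z)) =
         (fun h => h^-1 *: (f (z.1, h *: 1 + z.2) - f (z.1, z.2))).
  apply/funext => h; congr (_ *: (f _ - f _)); last by case: z.
  by case: z => x y; congr (_, _) => /=; rewrite scaler0 add0r.
move=> df; split.
  by move: df; rewrite /derivable /=; congr (cvg _); rewrite -E.
by rewrite /dy /derive -E.
Qed.

Lemma dxy_has_grad f z : derivable f z ex -> derivable f z ey -> has_grad f z (dx f z) (dy f z).
Proof. by move=> d1 d2; split; [exact: dxP|exact: dyP]. Qed.

Lemma is_derive_local (f g : R -> R) x d dl : 0 < dl ->
  (forall y, `|y - x| < dl -> f y = g y) -> is_derive x 1 g d -> is_derive x 1 f d.
Proof.
move=> dl0 fg /is_derive_epsP H; apply/is_derive_epsP => e /H[d1 d10 {}H].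
exists (Num.min dl d1); first by rewrite lt_min dl0.
move=> h; rewrite lt_min => /andP[h1 h2].
rewrite fg ?[x + h]addrC ?addrK// fg ?subrr ?normr0// [h + x]addrC; exact: H.
Qed.

Lemma has_grad_local f g D z a b : open D -> D z -> (forall w, D w -> f w = g w) ->
  has_grad g z a b -> has_grad f z a b.
Proof.
move=> oD Dz fg [g1 g2]; have [dl dl0 H] := open_boxP oD Dz.
split.
  apply: (is_derive_local dl0 _ g1) => y yz; apply: fg; apply: H => //=.
  by rewrite subrr normr0.
apply: (is_derive_local dl0 _ g2) => y yz; apply: fg; apply: H => //=.
by rewrite subrr normr0.
Qed.

(** The second difference over a square of side [h]: a mean value estimate in [x] for the vertical
    difference of [f], then one in [y] for [f1]. *)
Lemma mixed_increment D f f1 f12 z : open D -> D z ->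
  (forall w, D w -> is_derive w.1 1 (fun t => f (t, w.2)) (f1 w)) ->
  (forall w, D w -> is_derive w.2 1 (fun t => f1 (w.1, t)) (f12 w)) ->
  {for z, continuous f12} ->
  forall e, 0 < e -> exists2 dl, 0 < dl & forall h, `|h| < dl ->
    `|(f (z.1 + h, z.2 + h) - f (z.1 + h, z.2)) - (f (z.1, z.2 + h) - f (z.1, z.2)) - f12 z * h * h|
       <= e * `|h| * `|h|.
Proof.
move=> oD Dz d1 d12 /cts_boxP c12 e e0.
have [e1 e10 H] := c12 _ e0; have [e2 e20 HD] := open_boxP oD Dz.
exists (Num.min e1 e2); first by rewrite lt_min e10.
move=> h; rewrite lt_min => /andP[h1 h2].
apply: (@mean_value_le R (fun t => f (t, z.2 + h) - f (t, z.2))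
  (fun t => f1 (t, z.2 + h) - f1 (t, z.2)) z.1 h (f12 z * h) (e * `|h|)) => x xh.
- have D1 : D (x, z.2 + h).
    by apply: HD; rewrite /= ?[z.2 + h]addrC ?addrK ?(le_lt_trans xh).
  have D2 : D (x, z.2) by apply: HD; rewrite /= ?subrr ?normr0 ?(le_lt_trans xh).
  have := d1 _ D1; have := d1 _ D2; move=> /= i1 i2.
  exact: is_deriveB.
- apply: (@mean_value_le R (fun t => f1 (x, t)) (fun t => f12 (x, t))) => y yh.
    apply: (d12 (x, y)); apply: HD => /=; first exact: le_lt_trans h2.
    exact: le_lt_trans h2.
  by apply: H => /=; [exact: le_lt_trans h1|exact: le_lt_trans h1].
Qed.

(** The second difference is symmetric in the two variables, and it equals both [f12 z * h^2] and
    [f21 z * h^2] up to [e * h^2]. *)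
Lemma clairaut D f f1 f2 f12 f21 z : open D -> D z ->
  (forall w, D w -> has_grad f w (f1 w) (f2 w)) ->
  (forall w, D w -> is_derive w.2 1 (fun t => f1 (w.1, t)) (f12 w)) ->
  (forall w, D w -> is_derive w.1 1 (fun t => f2 (t, w.2)) (f21 w)) ->
  {for z, continuous f12} -> {for z, continuous f21} -> f12 z = f21 z.
Proof.
move=> oD Dz gf d12 d21 c12 c21.
pose sw (w : R * R) := (w.2, w.1).
have csw : continuous sw by move=> w; apply: cts_pair; [exact: cvg_snd|exact: cvg_fst].
have swD : open [set w | D (sw w)].
  by have /continuousP := csw; apply.
have H1 := mixed_increment oD Dz (fun w Dw => (gf w Dw).1) d12 c12.
(* Exchanging the coordinates gives the estimate with the differentiations in the other order. *)
have H2 := @mixed_increment _ (f \o sw) (f2 \o sw) (f21 \o sw) (sw z) swD.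
have {}H2 := H2 _ (fun w Dw => (gf _ Dw).2) (fun w Dw => d21 _ Dw).
have Dz' : D (sw (sw z)) by case: z Dz {H1 H2 c12 c21}.
have c21' : {for sw z, continuous (f21 \o sw)}.
  by apply: continuous_comp; [exact: csw|rewrite /sw /= -surjective_pairing].
have {}H2 := H2 Dz' c21'.
apply/eqP; rewrite -subr_eq0 -normr_le0; apply/ler_addgt0Pl => e e0; rewrite addr0.
have e2 : 0 < e / 2 by rewrite divr_gt0.
have [d1 d10 {}H1] := H1 _ e2; have [d2 d20 {}H2] := H2 _ e2.
pose h := Num.min d1 d2 / 2.
have h0 : 0 < h by rewrite divr_gt0// lt_min d10.
have hm : h < Num.min d1 d2 by rewrite /h ltr_pdivrMr// ltr_pMr ?ltr1n// lt_min d10.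
have habs : `|h| = h by rewrite gtr0_norm.
have h1 : `|h| < d1 by rewrite habs (lt_le_trans hm)// ge_min lexx.
have h2 : `|h| < d2 by rewrite habs (lt_le_trans hm)// ge_min lexx orbT.
have {}H1 := H1 _ h1; have {}H2 := H2 _ h2.
rewrite /sw /= habs -surjective_pairing in H1 H2.
have hh : 0 < h * h by rewrite mulr_gt0.
rewrite -(ler_pM2r hh).
have -> : `|f12 z - f21 z| * (h * h) = `|(f12 z - f21 z) * (h * h)|.
  by rewrite normrM (gtr0_norm hh).
set X := f (z.1 + h, z.2 + h) in H1 H2; set X1 := f (z.1 + h, z.2) in H1 H2.
set X2 := f (z.1, z.2 + h) in H1 H2; set X3 := f z in H1 H2.
have -> : (f12 z - f21 z) * (h * h) =
   (X - X2 - (X1 - X3) - f21 z * h * h) - (X - X1 - (X2 - X3) - f12 z * h * h) by ring.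
apply: le_trans (ler_normB _ _) _.
apply: le_trans (lerD H2 H1) _.
by rewrite le_eqVlt; apply/orP; left; apply/eqP; field.
Qed.

End PartialDerivatives.

(** * Extending gradients across the axis *)

Section Axis.
Context {R : realType}.
Implicit Types (f g : R * R -> R) (z w : R * R) (E : set (R * R)).

Lemma mean_value_seg (F dF : R -> R) (a b d e : R) : a <= b ->
  (forall x, a <= x <= b -> is_derive x 1 F (dF x)) ->
  (forall x, a <= x <= b -> `|dF x - d| <= e) ->
  `|F b - F a - d * (b - a)| <= e * (b - a).
Proof.
rewrite le_eqVlt => /predU1P[<- _ _|ab H1 H2]; first by rewrite !subrr !mulr0 subrr normr0.
have [c /andP[/ltW c1 /ltW c2] ->] := MVT_cc ab H1.
rewrite -mulrBl normrM (gtr0_norm (_ : 0 < b - a)) ?subr_gt0//.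
by rewrite ler_wpM2r ?subr_ge0 ?(ltW ab)// H2// c1.
Qed.

(** The increment on the axis is compared with the increment at a small height [k], where the
    derivative is known; continuity of [f] makes the difference less than [eta]. *)
Lemma x_derive_on_axis E f f1 : open E ->
  (forall z, E z -> {for z, continuous f}) -> (forall z, E z -> {for z, continuous f1}) ->
  (forall z, E z -> z.2 != 0 -> is_derive z.1 1 (fun t => f (t, z.2)) (f1 z)) ->
  forall z, E z -> is_derive z.1 1 (fun t => f (t, z.2)) (f1 z).
Proof.
move=> oE cf cf1 df z Ez; have [z20|/df] := eqVneq z.2 0; last exact.
apply/is_derive_epsP => e e0.
have [d1 d10 H1] := open_boxP oE Ez.
have /cts_boxP/(_ _ e0)[d2 d20 H2] := cf1 _ Ez.
exists (Num.min d1 d2); first by rewrite lt_min d10.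
move=> h; rewrite lt_min => /andP[h1 h2].
apply/ler_addgt0Pl => eta eta0; have eta2 : 0 < eta / 2 by rewrite divr_gt0.
have Eh : E (z.1 + h, z.2) by apply: H1; rewrite /= ?subrr ?normr0 ?[z.1 + h]addrC ?addrK.
have /cts_boxP/(_ _ eta2)[d3 d30 H3] := cf _ Eh.
have /cts_boxP/(_ _ eta2)[d4 d40 H4] := cf _ Ez.
pose k := Num.min (Num.min d1 d2) (Num.min d3 d4) / 2.
have m0 : 0 < Num.min (Num.min d1 d2) (Num.min d3 d4) by rewrite !lt_min d10 d20 d30.
have k0 : 0 < k by rewrite divr_gt0.
have : k < Num.min (Num.min d1 d2) (Num.min d3 d4) by rewrite /k ltr_pdivrMr// ltr_pMr ?ltr1n.
rewrite !lt_min => /andP[/andP[k1 k2] /andP[k3 k4]].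
have kz : `|k - z.2| = k by rewrite z20 subr0 gtr0_norm.
have H : `|f (z.1 + h, k) - f (z.1, k) - f1 z * h| <= e * `|h|.
  apply: (@mean_value_le R (fun t => f (t, k)) (fun t => f1 (t, k))) => x xh.
    apply: (df (x, k)); last by rewrite /= gt_eqF.
    by apply: H1; rewrite /= ?kz// (le_lt_trans xh).
  by apply: H2; rewrite /= ?kz// (le_lt_trans xh).
have A3 : `|f (z.1 + h, k) - f (z.1 + h, z.2)| <= eta / 2.
  by apply: H3; rewrite /= ?kz// subrr normr0.
have A4 : `|f (z.1, k) - f z| <= eta / 2 by apply: H4; rewrite /= ?kz// subrr normr0.
have -> : f (z.1 + h, z.2) - f (z.1, z.2) - f1 z * h =
   (f (z.1 + h, k) - f (z.1, k) - f1 z * h)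
   - (f (z.1 + h, k) - f (z.1 + h, z.2)) + (f (z.1, k) - f z).
  by rewrite -surjective_pairing; ring.
apply: le_trans (ler_normD _ _) _; have := ler_normB (f (z.1 + h, k) - f (z.1, k) - f1 z * h) (f (z.1 + h, k) - f (z.1 + h, z.2)).
lra.
Qed.

(** [MVT_cc] needs the derivative up to the endpoints, and on the axis it is what has to be proved.
    The estimate is therefore made from [s * h] to [h], and the piece next to the axis is controlled
    by continuity of [f]. *)
Lemma y_derive_on_axis E f f2 : open E ->
  (forall z, E z -> {for z, continuous f}) -> (forall z, E z -> {for z, continuous f2}) ->
  (forall z, E z -> z.2 != 0 -> is_derive z.2 1 (fun t => f (z.1, t)) (f2 z)) ->
  forall z, E z -> is_derive z.2 1 (fun t => f (z.1, t)) (f2 z).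
Proof.
move=> oE cf cf2 df z Ez; have [z20|/df] := eqVneq z.2 0; last exact.
apply/is_derive_epsP => e e0.
have [d1 d10 H1] := open_boxP oE Ez.
have /cts_boxP/(_ _ e0)[d2 d20 H2] := cf2 _ Ez.
exists (Num.min d1 d2); first by rewrite lt_min d10.
move=> h; rewrite lt_min z20 add0r => /andP[h1 h2].
have [->|hn0] := eqVneq h 0; first by rewrite subrr mulr0 subr0 normr0 mulr0.
apply/ler_addgt0Pl => eta eta0.
pose M := `|f2 z| + 1; have M0 : 0 < M by rewrite ltr_pwDr.
have eta2 : 0 < eta / 2 by rewrite divr_gt0.
have /cts_boxP/(_ _ eta2)[d4 d40 H4] := cf _ Ez.
(* A point [s * h], [0 < s < 1], close to the axis. *)
pose s := Num.min (1 / 2) (Num.min (d4 / (2 * `|h|)) (eta / (2 * M * `|h|))).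
have ha : 0 < `|h| by rewrite normr_gt0.
have s0 : 0 < s by rewrite !lt_min; apply/and3P; split; [lra|rewrite divr_gt0// mulr_gt0|rewrite divr_gt0// !mulr_gt0].
have s1 : s <= 1 / 2 by rewrite ge_min lexx.
have s2 : s * `|h| <= d4 / 2.
  have : s <= d4 / (2 * `|h|) by rewrite /s !ge_min lexx !orbT.
  rewrite -(ler_pM2r ha); have -> : d4 / (2 * `|h|) * `|h| = d4 / 2 by field; rewrite gt_eqF.
  by [].
have s3 : M * (s * `|h|) <= eta / 2.
  have : s <= eta / (2 * M * `|h|) by rewrite /s !ge_min lexx !orbT.
  have Mh : 0 < M * `|h| by rewrite mulr_gt0.
  rewrite -(ler_pM2r Mh); have -> : eta / (2 * M * `|h|) * (M * `|h|) = eta / 2.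
    by field; rewrite !gt_eqF.
  by have -> : s * (M * `|h|) = M * (s * `|h|) by ring.
have box (x : R) : `|x| <= `|h| -> x != 0 -> is_derive x 1 (fun t => f (z.1, t)) (f2 (z.1, x)) /\ `|f2 (z.1, x) - f2 z| <= e.
  move=> xh x0; split.
    apply: (df (z.1, x)) => //; apply: H1; rewrite /= ?subrr ?normr0// z20 subr0.
    exact: le_lt_trans h1.
  by apply: H2; rewrite /= ?subrr ?normr0// z20 subr0; exact: le_lt_trans h2.
have H : `|f (z.1, h) - f (z.1, s * h) - f2 z * (h - s * h)| <= e * `|h - s * h|.
  have [hp|hm] : 0 < h \/ h < 0 by case/lt_total/orP: hn0; [right|left].
  - have sh : s * h <= h by rewrite ler_piMl ?(ltW hp)//; lra.
    have sh0 : 0 < s * h by rewrite mulr_gt0.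
    rewrite [X in _ <= e * X]ger0_norm ?subr_ge0//.
    have bx x : s * h <= x <= h -> is_derive x 1 (fun t => f (z.1, t)) (f2 (z.1, x)) /\ `|f2 (z.1, x) - f2 z| <= e.
      move=> /andP[x1 x2]; have x0 : 0 < x by exact: lt_le_trans x1.
      by apply: box; [rewrite !gtr0_norm|rewrite gt_eqF].
    exact: (@mean_value_seg (fun t => f (z.1, t)) (fun t => f2 (z.1, t)) (s * h) h (f2 z) e sh
      (fun x hx => (bx x hx).1) (fun x hx => (bx x hx).2)).
  - have sh : h <= s * h.
      rewrite -subr_ge0; have -> : s * h - h = (1 - s) * - h by ring.
      by rewrite mulr_ge0//; lra.
    have sh0 : s * h < 0 by rewrite pmulr_rlt0.
    rewrite [X in _ <= e * X]ler0_norm ?subr_le0// opprB -normrN.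
    have -> : - (f (z.1, h) - f (z.1, s * h) - f2 z * (h - s * h)) =
      f (z.1, s * h) - f (z.1, h) - f2 z * (s * h - h) by ring.
    have bx x : h <= x <= s * h -> is_derive x 1 (fun t => f (z.1, t)) (f2 (z.1, x)) /\ `|f2 (z.1, x) - f2 z| <= e.
      move=> /andP[x1 x2]; have x0 : x < 0 by exact: le_lt_trans sh0.
      by apply: box; [rewrite !ltr0_norm// lerN2|rewrite lt_eqF].
    exact: (@mean_value_seg (fun t => f (z.1, t)) (fun t => f2 (z.1, t)) h (s * h) (f2 z) e sh
      (fun x hx => (bx x hx).1) (fun x hx => (bx x hx).2)).
have A4 : `|f (z.1, s * h) - f z| <= eta / 2.
  apply: H4; rewrite /= ?subrr ?normr0// z20 subr0 normrM (gtr0_norm s0); lra.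
have A5 : `|f2 z * (s * h)| <= eta / 2.
  rewrite !normrM (gtr0_norm s0); apply: le_trans s3.
  by rewrite ler_wpM2r ?mulr_ge0 ?(ltW s0)// /M lerDl.
have A6 : e * `|h - s * h| <= e * `|h|.
  have -> : h - s * h = (1 - s) * h by ring.
  rewrite ler_wpM2l ?(ltW e0)// normrM ler_piMl// ger0_norm; lra.
have fz : f (z.1, 0) = f z by rewrite -z20 -surjective_pairing.
rewrite fz.
have -> : f (z.1, h) - f z - f2 z * h =
  (f (z.1, h) - f (z.1, s * h) - f2 z * (h - s * h)) + (f (z.1, s * h) - f z) - f2 z * (s * h) by ring.
have := ler_normB (f (z.1, h) - f (z.1, s * h) - f2 z * (h - s * h) + (f (z.1, s * h) - f z)) (f2 z * (s * h)).
have := ler_normD (f (z.1, h) - f (z.1, s * h) - f2 z * (h - s * h)) (f (z.1, s * h) - f z).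
lra.
Qed.

(** A removable singularity argument: reflected functions become C^1 once they and their candidate
    derivatives are known to be continuous across the axis, without one-sided derivatives on it. *)
Lemma grad_across_axis E f f1 f2 : open E ->
  (forall z, E z -> {for z, continuous f}) -> (forall z, E z -> {for z, continuous f1}) ->
  (forall z, E z -> {for z, continuous f2}) ->
  (forall z, E z -> z.2 != 0 -> has_grad f z (f1 z) (f2 z)) ->
  forall z, E z -> has_grad f z (f1 z) (f2 z).
Proof.
move=> oE cf cf1 cf2 df z Ez; split.
  by apply: (x_derive_on_axis oE cf cf1) => // w Ew /(df w Ew)[].
by apply: (y_derive_on_axis oE cf cf2) => // w Ew /(df w Ew)[].
Qed.

End Axis.

(** * Even and odd reflections *)

Section Reflection.
Context {R : realType}.
Variable r0 : R.
Hypothesis r00 : 0 < r0.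
Implicit Types (f g : R * R -> R) (z w : R * R).
Notation Om := (@Omega0 R r0).
Notation E := [set z : R * R | r0 < enorm z].

Definition fold_up z : R * R := (z.1, `|z.2|).
Definition ev g z := g (fold_up z).
(** As [Num.sg 0 = 0], this is zero on the axis whatever [g] is; continuity there will use that [g]
    itself vanishes on the flat boundary. *)
Definition od g z := Num.sg z.2 * g (fold_up z).

Lemma enorm_fold z : enorm (fold_up z) = enorm z.
Proof. by rewrite /enorm /= real_normK ?num_real. Qed.

Lemma fold_Om z : r0 < enorm z -> z.2 != 0 -> Om (fold_up z).
Proof. by move=> Ez z2; split; rewrite ?enorm_fold//= normr_gt0. Qed.

Lemma open_Om : open Om.
Proof.
have -> : Om = [set z : R * R | 0 < z.2] `&` E by apply/seteqP; split.
apply: openI; last exact: open_exterior.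
have /continuousP/(_ _ (@open_gt _ 0)) := @cts_snd_fun R (fun t => t) (@cts_id R).
by congr open; apply/seteqP; split.
Qed.

Lemma fold_closure z : r0 < enorm z -> closure Om (fold_up z).
Proof.
move=> Ez; have [z20|z2] := eqVneq z.2 0; last exact/subset_closure/fold_Om.
move=> B /nbhs_ballP[e /= e0 HB].
exists (z.1, e / 2); split; last first.
  apply: HB; split; rewrite /ball/= ?subrr ?normr0// z20 normr0 sub0r normrN.
  by rewrite gtr0_norm ?divr_gt0// ltr_pdivrMr// ltr_pMr// ltr1n.
split; rewrite /= ?divr_gt0//.
have -> : enorm (z.1, e / 2) = Num.sqrt (z.1 ^+ 2 + (e / 2) ^+ 2) by [].
apply: (lt_le_trans Ez); rewrite /enorm z20 ler_sqrt ?addr_ge0 ?sqr_ge0//.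
by rewrite lerD2l expr0n sqr_ge0.
Qed.

Lemma within_boxP (A : set (R * R)) g z : {within A, continuous g} -> A z ->
  forall e, 0 < e -> exists2 dl, 0 < dl & forall w, A w -> `|w.1 - z.1| < dl ->
    `|w.2 - z.2| < dl -> `|g w - g z| <= e.
Proof.
move=> /subspace_continuousP H Az e e0.
have /cvgrPdist_le/(_ _ e0) := H z Az.
rewrite /within /= => /nbhs_ballP[dl /= dl0 K]; exists dl => // w Aw h1 h2.
by rewrite distrC; apply: K => //; split; rewrite /ball/= distrC.
Qed.

Lemma ev_cts g : {within closure Om, continuous g} ->
  forall z, r0 < enorm z -> {for z, continuous (ev g)}.
Proof.
move=> cg z Ez; apply/cts_boxP => e e0.
have [d1 d10 H] := within_boxP cg (fold_closure Ez) e0.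
have [d2 d20 H2] := open_boxP (@open_exterior R r0) (Ez : E z).
exists (Num.min d1 d2); first by rewrite lt_min d10.
move=> w; rewrite !lt_min => /andP[a1 a2] /andP[b1 b2].
apply: H => //=; first exact/fold_closure/H2.
by apply: le_lt_trans b1; exact: ler_dist_dist.
Qed.

(** Off the axis the sign is locally constant. On the axis [|od g| <= |ev g|], and [ev g] is
    continuous with value zero there. *)
Lemma od_cts g : {within closure Om, continuous g} ->
  (forall x, r0 < `|x| -> g (x, 0) = 0) ->
  forall z, r0 < enorm z -> {for z, continuous (od g)}.
Proof.
move=> cg g0 z Ez; have ce := ev_cts cg Ez; apply/cts_boxP => e e0.
have /cts_boxP/(_ _ e0)[d1 d10 H] := ce.
have [z20|z2] := eqVneq z.2 0.
  have gz : ev g z = 0.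
    rewrite /ev /fold_up z20 normr0; apply: g0.
    by move: Ez; rewrite /enorm z20 expr0n addr0 sqrtr_sqr.
  exists d1 => // w h1 h2; have := H w h1 h2.
  rewrite gz subr0 [od g z]/od z20 sgr0 mul0r subr0 => h.
  apply: le_trans h; rewrite /od /ev normrM normr_sg.
  by case: eqP => _; rewrite ?mul0r ?mul1r.
have nz : 0 < `|z.2| by rewrite normr_gt0.
exists (Num.min d1 `|z.2|); first by rewrite lt_min d10.
move=> w; rewrite !lt_min => /andP[a1 a2] /andP[b1 b2].
have sgE : Num.sg w.2 = Num.sg z.2.
  have [zp|zn] : 0 < z.2 \/ z.2 < 0 by case/lt_total/orP: z2; [right|left].
    move: b2; rewrite (gtr0_norm zp) ltr_norml => /andP[b2 _].
    by rewrite !gtr0_sg//; lra.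
  move: b2; rewrite (ltr0_norm zn) ltr_norml => /andP[_ b2].
  by rewrite !ltr0_sg//; lra.
rewrite /od sgE -mulrBr normrM normr_sg z2 mul1r; exact: H.
Qed.

Lemma fold_derive g z (b : R) : z.2 != 0 ->
  is_derive `|z.2| 1 (fun t => g (z.1, t)) b ->
  is_derive z.2 1 (fun t => ev g (z.1, t)) (Num.sg z.2 * b) /\
  is_derive z.2 1 (fun t => od g (z.1, t)) b.
Proof.
move=> z2 d; have nz : 0 < `|z.2| by rewrite normr_gt0.
have [zp|zn] : 0 < z.2 \/ z.2 < 0 by case/lt_total/orP: z2; [right|left].
- rewrite gtr0_norm// in d nz; rewrite gtr0_sg// mul1r.
  have pos y : `|y - z.2| < z.2 -> 0 < y by rewrite ltr_norml => /andP[h _]; lra.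
  split; apply: (is_derive_local nz _ d) => y /pos y0.
    by rewrite /ev /fold_up /= gtr0_norm.
  by rewrite /od /fold_up /= gtr0_sg// mul1r gtr0_norm.
- rewrite ltr0_norm// in d nz; rewrite ltr0_sg// mulN1r.
  have neg y : `|y - z.2| < - z.2 -> y < 0 by rewrite ltr_norml => /andP[_ h]; lra.
  have dN : is_derive z.2 1 (fun t => g (z.1, - t)) (- b).
    have -> : - b = b * -1 by rewrite mulrN1.
    apply: (@is_derive1_comp _ (fun t => g (z.1, t)) (fun t : R => - t)) => //.
  split.
    by apply: (is_derive_local nz _ dN) => y /neg y0; rewrite /ev /fold_up /= ltr0_norm.
  have dNN := is_deriveN dN; rewrite opprK in dNN.
  apply: (is_derive_local nz _ dNN) => y /neg y0.
  by rewrite /od /fold_up /= ltr0_sg// mulN1r ltr0_norm.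
Qed.

Lemma ev_grad g g1 g2 z : z.2 != 0 -> has_grad g (fold_up z) (g1 (fold_up z)) (g2 (fold_up z)) ->
  has_grad (ev g) z (ev g1 z) (od g2 z).
Proof. by move=> z2 [d1 d2]; split; [exact: d1|exact: (fold_derive z2 d2).1]. Qed.

Lemma od_grad g g1 g2 z : z.2 != 0 -> has_grad g (fold_up z) (g1 (fold_up z)) (g2 (fold_up z)) ->
  has_grad (od g) z (od g1 z) (ev g2 z).
Proof.
move=> z2 [d1 d2]; split; last exact: (fold_derive z2 d2).2.
rewrite /od; have := is_deriveZ (Num.sg z.2) d1.
by rewrite /GRing.scale /=.
Qed.

End Reflection.

(** * A local potential across the axis *)

Section Potential.
Context {R : realType}.
Variables (H1 H2 U V Ux Uy Vx Vy q : R * R -> R) (a r1 : R).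
Hypotheses (cH1 : continuous H1) (cH2 : continuous H2).
Hypotheses (cU : continuous U) (cV : continuous V).
Hypotheses (cUx : continuous Ux) (cVy : continuous Vy).
Implicit Types (z w c : R * R).
Hypothesis gU : forall z, r1 < enorm z -> has_grad U z (Ux z) (Uy z).
Hypothesis gV : forall z, r1 < enorm z -> has_grad V z (Vx z) (Vy z).
Hypothesis divfree : forall z, r1 < enorm z -> Ux z + Vy z = 0.
Hypothesis gq : forall z, r1 < enorm z -> z.2 != 0 ->
  has_grad q z (H1 z - a * Num.sg z.2 * V z) (H2 z + a * Num.sg z.2 * U z).

(** [H1] and [H2] are merely continuous, so Green's formula is not applied to them. Off the axis
    [(H1, H2)] is the gradient of [q] plus [a * s] times [(V, - U)]: the gradient has no
    circulation, and the circulation of the second field is, up to sign, the flux of [(U, V)]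
    through the rectangle, zero by [divfree]. *)
Lemma rectangle_off_axis (x0 x t t' s : R) : x0 <= x -> t <= t' ->
  (forall y, t <= y <= t' -> y != 0 /\ Num.sg y = s) ->
  (forall x' y, x0 <= x' <= x -> t <= y <= t' -> r1 < enorm (x', y)) ->
  intg x0 x (fun x' => H1 (x', t')) - intg x0 x (fun x' => H1 (x', t)) =
  intg t t' (fun y => H2 (x, y) - H2 (x0, y)).
Proof.
move=> x0x tt' sgn ext.
have side y : t <= y <= t' ->
    intg x0 x (fun x' => H1 (x', y)) =
    q (x, y) - q (x0, y) + a * s * intg x0 x (fun x' => V (x', y)).
  move=> ty; have [y0 ys] := sgn y ty.
  have cV' := @cts_secr _ V y cV; have cH1' := @cts_secr _ H1 y cH1.
  have c1 : continuous (fun x' => H1 (x', y) - a * s * V (x', y)).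
    by apply: cts_sub => //; apply: cts_mul => //; exact: cts_cst.
  have d x' : x0 <= x' <= x -> is_derive x' 1 (fun x' => q (x', y)) (H1 (x', y) - a * s * V (x', y)).
    by move=> hx; have [] := gq (ext x' y hx ty) y0; rewrite ys.
  rewrite -(intg_FTC2 x0x (cts_within c1) d) -(intgZ _ _ _ cV').
  rewrite -(intgD _ _ c1 (cts_mul (@cts_cst _ _ _) cV')).
  by apply: eq_intg => x' _; rewrite subrK.
have vert x' : x0 <= x' <= x ->
    intg t t' (fun y => H2 (x', y)) =
    q (x', t') - q (x', t) - a * s * intg t t' (fun y => U (x', y)).
  move=> hx.
  have cU' := @cts_secl _ U x' cU; have cH2' := @cts_secl _ H2 x' cH2.
  have c1 : continuous (fun y => H2 (x', y) + a * s * U (x', y)).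
    by apply: cts_add => //; apply: cts_mul => //; exact: cts_cst.
  have d y : t <= y <= t' -> is_derive y 1 (fun y => q (x', y)) (H2 (x', y) + a * s * U (x', y)).
    by move=> ty; have [y0 ys] := sgn y ty; have [] := gq (ext x' y hx ty) y0; rewrite ys.
  rewrite -(intg_FTC2 tt' (cts_within c1) d) -(intgZ _ _ _ cU').
  rewrite -(intgB _ _ c1 (cts_mul (@cts_cst _ _ _) cU')).
  by apply: eq_intg => y _; rewrite addrK.
have xx : x0 <= x <= x by rewrite x0x lexx.
have x00 : x0 <= x0 <= x by rewrite x0x lexx.
have tt1 : t <= t' <= t' by rewrite tt' lexx.
have tt0 : t <= t <= t' by rewrite tt' lexx.
have flux : intg x0 x (fun x' => V (x', t')) - intg x0 x (fun x' => V (x', t)) =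
    - (intg t t' (fun y => U (x, y)) - intg t t' (fun y => U (x0, y))).
  rewrite -(intgB _ _ (@cts_secr _ V t' cV) (@cts_secr _ V t cV)).
  rewrite -(intgB _ _ (@cts_secl _ U x cU) (@cts_secl _ U x0 cU)).
  have E1 : intg x0 x (fun x' => V (x', t') - V (x', t)) =
      intg x0 x (fun x' => intg t t' (fun y => Vy (x', y))).
    apply: eq_intg => x' hx; apply/esym.
    have d y : t <= y <= t' -> is_derive y 1 (fun y => V (x', y)) (Vy (x', y)).
      by move=> hy; have [] := gV (ext x' y hx hy).
    exact: (intg_FTC2 tt' (cts_within (@cts_secl _ Vy x' cVy)) d).
  have E2 : intg t t' (fun y => U (x, y) - U (x0, y)) =
      intg t t' (fun y => intg x0 x (fun x' => Ux (x', y))).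
    apply: eq_intg => y hy; apply/esym.
    have d x' : x0 <= x' <= x -> is_derive x' 1 (fun x' => U (x', y)) (Ux (x', y)).
      by move=> hx; have [] := gU (ext x' y hx hy).
    exact: (intg_FTC2 x0x (cts_within (@cts_secr _ Ux y cUx)) d).
  rewrite E1 E2 -(intg_swap x0 x t t' cUx).
  have cUx' := @cts_intg_param _ t t' _ cUx.
  rewrite -mulN1r -(intgZ _ _ _ cUx'); apply: eq_intg => x' hx.
  rewrite -(intgZ _ _ _ (@cts_secl _ Ux x' cUx)); apply: eq_intg => y hy.
  by rewrite mulN1r; have := divfree (ext x' y hx hy) => /eqP; rewrite addrC addr_eq0 => /eqP.
rewrite (intgB _ _ (@cts_secl _ H2 x cH2) (@cts_secl _ H2 x0 cH2)).
rewrite (side t' tt1) (side t tt0) (vert x xx) (vert x0 x00).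
set v1 := intg x0 x _ in flux *; set v0 := intg x0 x _ in flux *.
set u1 := intg t t' _ in flux *; set u0 := intg t t' _ in flux *.
have -> : v1 = v0 - (u1 - u0) by rewrite -flux addrC subrK.
ring.
Qed.

(** The difference of the two sides, [Psi] up to a constant, is constant in [t] on each side of the
    axis and continuous across it. *)
Lemma rectangle_circulation (x0 x y0 y1 : R) : x0 <= x ->
  (forall x' y, x0 <= x' <= x -> y0 <= y <= y1 -> r1 < enorm (x', y)) ->
  forall t, y0 <= t <= y1 ->
  intg x0 x (fun x' => H1 (x', t)) - intg x0 x (fun x' => H1 (x', y0)) =
  intg y0 t (fun y => H2 (x, y) - H2 (x0, y)).
Proof.
move=> x0x ext.
pose k y := H2 (x, y) - H2 (x0, y).
have ck : continuous k by apply: cts_sub; exact: cts_secl.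
(* The base point is [y0 - 1] because [intg_FTC1] needs it strictly below [t], and [t = y0] must be
   allowed. *)
pose Psi t := intg x0 x (fun x' => H1 (x', t)) - intg (y0 - 1) t k.
have cH1' : continuous (fun w : R * R => H1 (w.2, w.1)).
  move=> w; apply: (@continuous_comp _ _ _ (fun w : R * R => (w.2, w.1)) H1); last exact: cH1.
  by apply: cts_pair; [exact: cvg_snd|exact: cvg_fst].
have cPsi t : y0 - 1 < t -> {for t, continuous Psi}.
  move=> yt; apply: cvgB; first exact: (@cts_intg_param _ x0 x _ cH1' t).
  exact: (is_derive_cts (intg_FTC1 ck yt)).
have same t t' s : y0 <= t -> t <= t' -> t' <= y1 ->
    (forall y, t <= y <= t' -> y != 0 /\ Num.sg y = s) -> Psi t' = Psi t.
  move=> y0t tt' ty1 sgn.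
  have E := rectangle_off_axis x0x tt' sgn (fun x' y hx hy =>
    ext x' y hx ltac:(case/andP: hy => h1 h2; apply/andP; split; [exact: le_trans h1|exact: le_trans ty1])).
  have y1t : y0 - 1 <= t by lra.
  have S := intg_split y1t tt' (cts_within ck).
  rewrite /Psi S -[intg t t' k]E; ring.
have const t : y0 <= t <= y1 -> Psi t = Psi y0.
  move=> /andP[y0t ty1].
  have sgp y : 0 < y -> y != 0 /\ Num.sg y = 1 :> R by move=> h; rewrite gt_eqF// gtr0_sg.
  have sgn y : y < 0 -> y != 0 /\ Num.sg y = -1 :> R by move=> h; rewrite lt_eqF// ltr0_sg.
  have above s s' : y0 <= s -> 0 < s -> s <= s' -> s' <= y1 -> Psi s' = Psi s.
    move=> h1 h2 h3 h4; apply: (same s s' 1) => // y /andP[h5 _]; apply: sgp.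
    exact: lt_le_trans h5.
  have below s s' : y0 <= s -> s' < 0 -> s <= s' -> s' <= y1 -> Psi s' = Psi s.
    move=> h1 h2 h3 h4; apply: (same s s' (-1)) => // y /andP[_ h5]; apply: sgn.
    exact: le_lt_trans h2.
  (* Continuity at the axis joins the two half rectangles. *)
  have above0 s : y0 <= 0 -> 0 <= s -> s <= y1 -> Psi s = Psi 0.
    move=> y00 s0 sy1; have [->//|sn0] := eqVneq s 0.
    have sp : 0 < s by rewrite lt_neqAle eq_sym sn0.
    apply/eqP; rewrite -subr_eq0 -normr_le0; apply/ler_addgt0Pl => e e0; rewrite addr0.
    have /cvgrPdist_le/(_ _ e0) := cPsi 0 ltac:(lra).
    move=> /nbhs_ballP[dl /= dl0 K].
    pose s' := Num.min s (dl / 2).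
    have s'0 : 0 < s' by rewrite lt_min sp divr_gt0.
    have s's : s' <= s by rewrite ge_min lexx.
    rewrite (above s' s)//; last exact: le_trans (ltW s'0).
    rewrite distrC; apply: K; rewrite /ball/= sub0r normrN gtr0_norm//.
    by apply: (@le_lt_trans _ _ (dl / 2)); [rewrite ge_min lexx orbT|lra].
  have below0 s : y0 <= s -> s <= 0 -> 0 <= y1 -> Psi s = Psi 0.
    move=> y0s s0 y10; have [->//|sn0] := eqVneq s 0.
    have sp : s < 0 by rewrite lt_neqAle sn0.
    apply/eqP; rewrite -subr_eq0 -normr_le0; apply/ler_addgt0Pl => e e0; rewrite addr0.
    have /cvgrPdist_le/(_ _ e0) := cPsi 0 ltac:(lra).
    move=> /nbhs_ballP[dl /= dl0 K].
    pose s' := Num.max s (- (dl / 2)).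
    have s'0 : s' < 0 by rewrite gt_max sp oppr_lt0 divr_gt0.
    have s's : s <= s' by rewrite le_max lexx.
    rewrite -(below s s')//; last exact: le_trans (ltW s'0) y10.
    rewrite distrC; apply: K; rewrite /ball/= sub0r normrN ltr0_norm//.
    apply: (@le_lt_trans _ _ (dl / 2)); last by lra.
    by rewrite lerNl le_max lexx orbT.
  have [yp|yn] := ltP 0 y0; first by rewrite (above y0 t).
  have [tn|tp] := ltP t 0; first by rewrite (below y0 t).
  rewrite (above0 t yn tp ty1) -(below0 y0 (lexx _) yn)//.
  exact: le_trans ty1.
move=> t /[dup] ty /const E; move: E; rewrite /Psi.
have /andP[y0t _] := ty.
have yy1 : y0 - 1 <= y0 by lra.
rewrite (intg_split yy1 y0t (cts_within ck)) => E.
apply/eqP; rewrite -subr_eq0; apply/eqP.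
transitivity ((intg x0 x (fun x' => H1 (x', t)) - (intg (y0 - 1) y0 k + intg y0 t k))
   - (intg x0 x (fun x' => H1 (x', y0)) - intg (y0 - 1) y0 k)); first by rewrite /k; ring.
by rewrite E subrr.
Qed.

(* [q] itself jumps across the axis; gluing is done through the closed form [H1 dx + H2 dy]. *)
Lemma local_potential c (rho : R) : 0 < rho ->
  (forall w, enorm (w - c) < rho -> r1 < enorm w) ->
  exists Q, forall w, enorm (w - c) < rho / 2 -> has_grad Q w (H1 w) (H2 w).
Proof.
move=> rho0 ext.
pose x0 := c.1 - rho / 2; pose y0 := c.2 - rho / 2.
(* The square of half-side [rho / 2] lies in the disc of radius [rho] and contains the disc of
   radius [rho / 2]: hence the loss of a factor 2 in the radius. *)
have box x y : `|x - c.1| <= rho / 2 -> `|y - c.2| <= rho / 2 -> r1 < enorm (x, y).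
  move=> hx hy; apply: ext.
  rewrite -ltr_sqr ?nnegrE ?enorm_ge0 ?(ltW rho0)// enorm_sq /=.
  have h (t : R) : `|t| <= rho / 2 -> t ^+ 2 <= rho ^+ 2 / 4.
    move=> ht; rewrite -[t ^+ 2]real_normK ?num_real//.
    have -> : rho ^+ 2 / 4 = (rho / 2) ^+ 2 by field.
    by rewrite ler_sqr ?nnegrE// divr_ge0// ltW.
  have := h _ hx; have := h _ hy; have : 0 < rho ^+ 2 by rewrite exprn_gt0.
  lra.
(* Integration up the left side, then horizontally, which gives the [x] derivative. For the [y]
   derivative, [rectangle_circulation] replaces the path by the bottom side followed by a vertical
   segment. *)
pose Q (w : R * R) := intg x0 w.1 (fun x' => H1 (x', w.2)) + intg y0 w.2 (fun y => H2 (x0, y)).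
exists Q => w wc.
have w1 : `|w.1 - c.1| < rho / 2 by apply: le_lt_trans wc; exact: (le_enorm1 (w - c)).
have w2 : `|w.2 - c.2| < rho / 2 by apply: le_lt_trans wc; exact: (le_enorm2 (w - c)).
have x0w : x0 < w.1 by move: w1; rewrite ltr_norml /x0 => /andP[h _]; lra.
have y0w : y0 < w.2 by move: w2; rewrite ltr_norml /y0 => /andP[h _]; lra.
split.
  have d := intg_FTC1 (@cts_secr _ H1 w.2 cH1) x0w.
  rewrite -surjective_pairing in d.
  have := is_deriveD d (is_derive_cst (intg y0 w.2 (fun y => H2 (x0, y))) w.1 1).
  by rewrite addr0.
have d := intg_FTC1 (@cts_secl _ H2 w.1 cH2) y0w.
have dd := is_deriveD (is_derive_cst (intg x0 w.1 (fun x' => H1 (x', y0))) w.2 1) d.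
rewrite add0r -surjective_pairing in dd.
pose y1 := c.2 + rho / 2.
have wy1 : w.2 < y1 by move: w2; rewrite ltr_norml /y1 => /andP[_ h]; lra.
have ext' x' y : x0 <= x' <= w.1 -> y0 <= y <= y1 -> r1 < enorm (x', y).
  move=> /andP[a1 a2] /andP[b1 b2]; move: w1; rewrite ltr_norml => /andP[_ h].
  by rewrite /x0 /y0 /y1 in a1 b1 b2 *; apply: box; rewrite ler_norml; apply/andP; split; lra.
have circ := rectangle_circulation (ltW x0w) ext'.
have dl0 : 0 < Num.min (w.2 - y0) (y1 - w.2) by rewrite lt_min !subr_gt0 y0w.
apply: (is_derive_local dl0 _ dd) => t; rewrite lt_min !ltr_norml => /andP[/andP[t1 _] /andP[_ t2]].
have ty : y0 <= t <= y1 by apply/andP; split; lra.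
have := circ t ty; rewrite (intgB _ _ (@cts_secl _ H2 w.1 cH2) (@cts_secl _ H2 x0 cH2)) /Q /= => E.
apply/eqP; rewrite -subr_eq0; apply/eqP.
transitivity (intg x0 w.1 (fun x' => H1 (x', t)) - intg x0 w.1 (fun x' => H1 (x', y0))
  - (intg y0 t (fun t => H2 (w.1, t)) - intg y0 t (fun t => H2 (x0, t)))); first by rewrite ?fctE /cst; ring.
by rewrite E subrr.
Qed.

End Potential.

(** * Gradients of the reflections, and the cutoff *)

Section ReflectedGradient.
Context {R : realType}.
Variable r0 : R.
Hypothesis r00 : 0 < r0.
Implicit Types (f g : R * R -> R) (z w : R * R).
Notation Om := (@Omega0 R r0).

(** [gx] is defined on the boundary only as a continuous extension; [x_derive_on_axis], applied to
    the even reflection, identifies it there with the tangential derivative of a function that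
    vanishes. *)
Lemma axis_dx g gx gy : {within closure Om, continuous g} -> {within closure Om, continuous gx} ->
  (forall z, Om z -> has_grad g z (gx z) (gy z)) ->
  (forall x, r0 < `|x| -> g (x, 0) = 0) -> forall x, r0 < `|x| -> gx (x, 0) = 0.
Proof.
move=> cg cgx gg g0 x xr.
have Ex : r0 < enorm (x, 0 : R) by rewrite /enorm /= expr0n addr0 sqrtr_sqr.
have D : is_derive x 1 (fun t => ev g (t, 0)) (ev gx (x, 0)).
  apply: (x_derive_on_axis (@open_exterior R r0) (ev_cts cg) (ev_cts cgx) _ Ex) => w Ew w2.
  exact: (gg _ (fold_Om Ew w2)).1.
have rx : 0 < `|x| - r0 by rewrite subr_gt0.
have D0 : is_derive x 1 (fun t => ev g (t, 0)) 0.
  apply: (is_derive_local rx _ (is_derive_cst 0 x 1)) => y yx.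
  rewrite /ev /fold_up /= normr0 g0//.
  have := ler_dist_dist x y; rewrite distrC in yx.
  have := ler_norm (`|x| - `|y|); lra.
have [_ e1] := D; have [_ e0] := D0.
by move: e1; rewrite /= e0 /ev /fold_up /= normr0.
Qed.

Lemma even_grad g gx gy : {within closure Om, continuous g} ->
  {within closure Om, continuous gx} -> {within closure Om, continuous gy} ->
  (forall z, Om z -> has_grad g z (gx z) (gy z)) ->
  (forall x, r0 < `|x| -> gy (x, 0) = 0) ->
  forall z, r0 < enorm z -> has_grad (ev g) z (ev gx z) (od gy z).
Proof.
move=> cg cgx cgy gg g0.
apply: (grad_across_axis (@open_exterior R r0) (ev_cts cg) (ev_cts cgx) (od_cts cgy g0)).
by move=> z Ez z2; apply: ev_grad => //; apply: gg; exact: fold_Om.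
Qed.

Lemma odd_grad g gx gy : {within closure Om, continuous g} ->
  {within closure Om, continuous gx} -> {within closure Om, continuous gy} ->
  (forall z, Om z -> has_grad g z (gx z) (gy z)) ->
  (forall x, r0 < `|x| -> g (x, 0) = 0) ->
  forall z, r0 < enorm z -> has_grad (od g) z (od gx z) (ev gy z).
Proof.
move=> cg cgx cgy gg g0; have gx0 := axis_dx cg cgx gg g0.
apply: (grad_across_axis (@open_exterior R r0) (od_cts cg g0) (od_cts cgx gx0) (ev_cts cgy)).
by move=> z Ez z2; apply: od_grad => //; apply: gg; exact: fold_Om.
Qed.

(** Makes functions known outside the disc continuous on the whole plane. Functions and their
    derivatives are cut off separately, so the gradient relations are kept only where the cutoff is
    1; a smooth cutoff is not called for. *)
Definition cutoff z : R := Num.max 0 (Num.min 1 (enorm z - (r0 + 1))).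
Definition cut g z := cutoff z * g z.

Lemma cutoff1 z : r0 + 2 < enorm z -> cutoff z = 1.
Proof. by move=> h; rewrite /cutoff min_l ?max_r//; lra. Qed.

Lemma cutoff0 z : enorm z < r0 + 1 -> cutoff z = 0.
Proof. by move=> h; rewrite /cutoff max_l// ge_min; apply/orP; right; lra. Qed.

Lemma cutoff_sq z : 0 <= cutoff z ^+ 2 <= 1.
Proof.
rewrite sqr_ge0 expr_le1//; first by rewrite ge_max ler01 ge_min lexx.
by rewrite le_max lexx.
Qed.

Lemma continuous_cutoff : continuous cutoff.
Proof.
have -> : cutoff = (fun=> 0) \max ((fun=> 1) \min (fun z => enorm z - (r0 + 1))) by [].
move=> z; apply: continuous_max; first exact: cvg_cst.
apply: continuous_min; first exact: cvg_cst.
by apply: cvgB; [exact: continuous_enorm|exact: cvg_cst].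
Qed.

Lemma cutE g z : r0 + 2 < enorm z -> cut g z = g z.
Proof. by move=> /cutoff1 h; rewrite /cut h mul1r. Qed.

Lemma cut_cts g : (forall z, r0 < enorm z -> {for z, continuous g}) -> continuous (cut g).
Proof.
move=> cg z; have [h|h] := ltP r0 (enorm z).
  by apply: cvgM; [exact: continuous_cutoff|exact: cg].
apply/cts_boxP => e e0.
have Dz : [set w : R * R | enorm (w - 0) < r0 + 1] z by rewrite /= subr0; lra.
have [dl dl0 H] := open_boxP (@open_eball R 0 (r0 + 1)) Dz.
exists dl => // w h1 h2; have := H w h1 h2; rewrite /= subr0 => hw.
rewrite /cut !cutoff0//; last by lra.
by rewrite !mul0r subrr normr0 ltW.
Qed.

Lemma cut_grad g z a b : r0 + 2 < enorm z -> has_grad g z a b -> has_grad (cut g) z a b.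
Proof.
move=> h; apply: (has_grad_local (@open_exterior R (r0 + 2))) => //.
by move=> w; exact: cutE.
Qed.

End ReflectedGradient.

(** * Energy of the reflected field *)

Section HalfPlaneEnergy.
Context {R : realType}.
Notation mR := (measurableTypeR R).
Notation leb := (@lebesgue_measure R).
Notation leb2 := (leb \x leb)%E.
Implicit Types (G : mR * mR -> mR).

Definition flip (z : R * R) : R * R := (z.1, - z.2).

Lemma measurable_flip : measurable_fun setT (flip : mR * mR -> mR * mR).
Proof. by apply: measurable_fun_pair => //; exact: measurableT_comp. Qed.

Lemma flip_integral G : measurable_fun setT G -> (forall z, 0 <= G z) ->
  (\int[leb2]_z (G (flip z))%:E = \int[leb2]_z (G z)%:E)%E.
Proof.
move=> mG G0.
rewrite fubini_tonelli1; last 2 first.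
- by apply/measurable_EFinP; apply: (measurableT_comp mG); exact: measurable_flip.
- by move=> z; rewrite lee_fin.
rewrite (fubini_tonelli1 (fun z => (G z)%:E)); last 2 first.
- exact/measurable_EFinP.
- by move=> z; rewrite lee_fin.
apply: eq_integral => x _; rewrite /fubini_F /= /flip/= [RHS]integral_oppr//.
- by apply/measurable_EFinP; exact: (measurableT_comp mG).
- by move=> y; rewrite lee_fin.
Qed.

Definition upper : set (mR * mR) := [set z | 0 < z.2].

Lemma measurable_upper : measurable upper.
Proof. exact: measurable_set_lt. Qed.

Lemma symmetric_integral G : measurable_fun setT G -> (forall z, 0 <= G z) ->
  (forall z, G (flip z) = G z) ->
  (\int[leb2]_z (G z)%:E = \int[leb2]_z (\1_upper z * G z)%:E + \int[leb2]_z (\1_upper z * G z)%:E)%E.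
Proof.
move=> mG G0 Gs.
have m1 : measurable_fun setT (\1_upper : mR * mR -> mR).
  by apply: measurable_indic; exact: measurable_upper.
have mI : measurable_fun setT (fun z : mR * mR => \1_upper z * G z) by exact: measurable_funM.
have I0 (z : mR * mR) : 0 <= \1_upper z * G z by rewrite mulr_ge0// indicE.
have mF : measurable_fun setT (fun z : mR * mR => \1_upper (flip z) * G (flip z)).
  exact: (measurableT_comp mI measurable_flip).
rewrite -{2}(flip_integral mI I0) -ge0_integralD//; last 4 first.
- by move=> z _; rewrite lee_fin.
- exact/measurable_EFinP.
- by move=> z _; rewrite lee_fin; exact: (I0 (flip z)).
- exact/measurable_EFinP.
apply: ge0_ae_eq_integral => //.
- exact/measurable_EFinP.
- by apply: emeasurable_funD; exact/measurable_EFinP.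
- by move=> z _; rewrite lee_fin.
- by move=> z _; rewrite adde_ge0// lee_fin; [exact: I0|exact: (I0 (flip z))].
- exists ([set: mR] `*` [set (0 : mR)]); split.
  + by apply: measurableX => //; exact: measurable_set1.
  + have := @product_measure1E _ _ mR mR R leb leb setT [set 0] measurableT (measurable_set1 _).
    by move=> /= ->; rewrite lebesgue_measure_set1 mule0.
  + move=> z /= H; apply: contrapT => zn; apply: H => _.
    have z0 : z.2 != 0 by apply/eqP => z0; apply: zn; split => //=.
    rewrite -EFinD Gs -mulrDl; congr EFin.
    suff -> : \1_upper z + \1_upper (flip z) = 1 :> R by rewrite mul1r.
    have [zp|zn'] : 0 < z.2 \/ z.2 < 0 by case/lt_total/orP: z0; [right|left].
      rewrite !indicE mem_set// memNset ?addr0// /upper /flip /= oppr_gt0.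
      by apply/negP; rewrite -leNgt ltW.
    rewrite !indicE memNset ?mem_set ?add0r//; first by rewrite /upper /flip /= oppr_gt0.
    by rewrite /upper /=; apply/negP; rewrite -leNgt ltW.
Qed.

Lemma open_continuous_measurable2 (D : set (R * R)) (g : R * R -> R) : open D ->
  (forall z, D z -> {for z, continuous g}) ->
  measurable_fun (D : set (mR * mR)) (g : mR * mR -> mR).
Proof.
move=> oD cg; apply: (measurability _ (measurable_realfun.RGenOpens.measurableE R)).
move=> _ [_ [x [y ->] <-]]; apply: open_measurable2.
rewrite openE => z [Dz gz].
have : nbhs z (g @^-1` `]x, y[) 
  by apply: cg => //; apply: open_nbhs_nbhs; split => //; exact: interval_open.
by move=> h; apply: filterI => //; exact: open_nbhs_nbhs.
Qed.

(** By symmetry the integral is twice that over the upper half plane, where an inequality is enough: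
    the cutoff can only decrease the energy density. *)
Lemma half_plane_energy (r0 : R) (g : R * R -> R) (G : R * R -> R) : continuous G ->
  (forall z, 0 <= G z) -> (forall z, G (flip z) = G z) ->
  (forall z, Omega0 r0 z -> {for z, continuous g}) -> (forall z, Omega0 r0 z -> 0 <= g z) ->
  (forall z, 0 < z.2 -> Omega0 r0 z -> G z <= g z) ->
  (forall z, 0 < z.2 -> ~ Omega0 r0 z -> G z = 0) ->
  (\int[leb2]_(z in Omega0 r0) (g z)%:E < +oo)%E -> (\int[leb2]_z (G z)%:E < +oo)%E.
Proof.
move=> cG G0 Gs cg g0 Gg Gz hg.
have mG := cts_measurable2 cG.
have m1 : measurable_fun setT (\1_upper : mR * mR -> mR).
  by apply: measurable_indic; exact: measurable_upper.
have mI : measurable_fun setT (fun z : mR * mR => \1_upper z * G z) by exact: measurable_funM.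
have oO := @open_Om R r0.
have mO : measurable (Omega0 r0 : set (mR * mR)) by exact: open_measurable2.
have le : (\int[leb2]_z (\1_upper z * G z)%:E <= \int[leb2]_(z in Omega0 r0) (g z)%:E)%E.
  have -> : (\int[leb2]_z (\1_upper z * G z)%:E = \int[leb2]_(z in Omega0 r0) (\1_upper z * G z)%:E)%E.
    rewrite [RHS]integral_mkcond; apply: eq_integral => z _; rewrite patchE.
    case: ifPn => //; rewrite notin_setE => nO; rewrite indicE.
    case: (boolP (z \in upper)); rewrite ?mul0r// inE => zu; rewrite Gz ?mulr0//.
  apply: ge0_le_integral => //.
  - by move=> z _; rewrite lee_fin mulr_ge0// indicE.
  - by apply/measurable_EFinP; exact: measurable_funTS mI.
  - by apply/measurable_EFinP; exact: open_continuous_measurable2.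
  - move=> z Oz; rewrite lee_fin indicE; case: Oz (Oz) => z2 _ Oz.
    by rewrite mem_set// mul1r Gg.
rewrite (symmetric_integral mG G0 Gs).
by apply: lte_add_pinfty; exact: le_lt_trans hg.
Qed.

End HalfPlaneEnergy.

(** * The reflected flow satisfies the hypotheses of [decay] *)

Section ReflectedFlow.
Context {R : realType}.
Notation leb := (@lebesgue_measure R).
Notation leb2 := (leb \x leb)%E.
Variables (r0 a b : R).
Variables (u ux uy uxx uxy uyx uyy v vx vy vxx vxy vyx vyy p : R * R -> R).
Hypothesis r00 : 0 < r0.
Implicit Types (f g : R * R -> R) (z w : R * R).
Notation Om := (@Omega0 R r0).
Notation ctsOm f := {within closure Om, continuous f}.
Hypotheses (cu : ctsOm u) (cux : ctsOm ux) (cuy : ctsOm uy).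
Hypotheses (cuxy : ctsOm uxy) (cuyx : ctsOm uyx) (cuyy : ctsOm uyy).
Hypotheses (cv : ctsOm v) (cvx : ctsOm vx) (cvy : ctsOm vy).
Hypotheses (cvxx : ctsOm vxx) (cvxy : ctsOm vxy) (cvyx : ctsOm vyx).
Hypothesis gu : forall z, Om z -> has_grad u z (ux z) (uy z).
Hypothesis gux : forall z, Om z -> has_grad ux z (uxx z) (uxy z).
Hypothesis guy : forall z, Om z -> has_grad uy z (uyx z) (uyy z).
Hypothesis gv : forall z, Om z -> has_grad v z (vx z) (vy z).
Hypothesis gvx : forall z, Om z -> has_grad vx z (vxx z) (vxy z).
Hypothesis gvy : forall z, Om z -> has_grad vy z (vyx z) (vyy z).
Hypothesis gp : forall z, Om z -> has_grad p z
  (uxx z + uyy z - (u z * ux z + v z * uy z) - (a * z.2 * ux z + b * uy z) - a * v z)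
  (vxx z + vyy z - (u z * vx z + v z * vy z) - (a * z.2 * vx z + b * vy z)).
Hypothesis div0 : forall z, Om z -> ux z + vy z = 0.
Hypothesis v_axis : forall x, r0 < `|x| -> v (x, 0) = 0.
Hypothesis uy_axis : forall x, r0 < `|x| -> uy (x, 0) = 0.
Hypothesis finite_energy :
  (\int[leb2]_(z in Om) (ux z ^+ 2 + uy z ^+ 2 + vx z ^+ 2 + vy z ^+ 2)%:E < +oo)%E.

Let om z := vx z - uy z.
Let omx z := vxx z - uyx z.
Let omy z := vxy z - uyy z.
Let f1 z := omx z - (u z + a * z.2) * om z.
Let f2 z := omy z - (v z + b) * om z.
(* Bernoulli function: its gradient is the rotated gradient of [om] up to first order in [om]. *)
Let q z := p z + (u z * u z + v z * v z) / 2 + b * v z + a * z.2 * u z.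

Lemma ctsOm_add f g : ctsOm f -> ctsOm g -> ctsOm (fun z => f z + g z).
Proof. by move=> cf cg x; apply: cvgD; [exact: cf|exact: cg]. Qed.

Lemma ctsOm_mul f g : ctsOm f -> ctsOm g -> ctsOm (fun z => f z * g z).
Proof. by move=> cf cg x; apply: cvgM; [exact: cf|exact: cg]. Qed.

Lemma ctsOm_sub f g : ctsOm f -> ctsOm g -> ctsOm (fun z => f z - g z).
Proof. by move=> cf cg x; apply: cvgB; [exact: cf|exact: cg]. Qed.

Lemma ctsOm_snd : ctsOm (fun z : R * R => z.2).
Proof. by apply: continuous_subspaceT => z; exact: cvg_snd. Qed.

Lemma ctsOm_cst (k : R) : ctsOm (fun _ : R * R => k).
Proof. by apply: continuous_subspaceT => z; exact: cvg_cst. Qed.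

Let com : ctsOm om. Proof. exact: ctsOm_sub. Qed.
Let comx : ctsOm omx. Proof. exact: ctsOm_sub. Qed.
Let comy : ctsOm omy. Proof. exact: ctsOm_sub. Qed.
Let cf1 : ctsOm f1.
Proof.
apply: ctsOm_sub => //; apply: ctsOm_mul => //; apply: ctsOm_add => //.
by apply: ctsOm_mul; [exact: ctsOm_cst|exact: ctsOm_snd].
Qed.
Let cf2 : ctsOm f2.
Proof.
by apply: ctsOm_sub => //; apply: ctsOm_mul => //; apply: ctsOm_add => //; exact: ctsOm_cst.
Qed.

Lemma gradD f g z x1 y1 x2 y2 : has_grad f z x1 y1 -> has_grad g z x2 y2 ->
  has_grad (fun z => f z + g z) z (x1 + x2) (y1 + y2).
Proof. by move=> [d1 d2] [e1 e2]; split; exact: is_deriveD. Qed.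

Lemma gradB f g z x1 y1 x2 y2 : has_grad f z x1 y1 -> has_grad g z x2 y2 ->
  has_grad (fun z => f z - g z) z (x1 - x2) (y1 - y2).
Proof. by move=> [d1 d2] [e1 e2]; split; exact: is_deriveB. Qed.

Lemma gradM f g z x1 y1 x2 y2 : has_grad f z x1 y1 -> has_grad g z x2 y2 ->
  has_grad (fun z => f z * g z) z (f z * x2 + g z * x1) (f z * y2 + g z * y1).
Proof.
move=> [d1 d2] [e1 e2]; split.
  by have := is_deriveM d1 e1; rewrite -surjective_pairing.
by have := is_deriveM d2 e2; rewrite -surjective_pairing.
Qed.

Lemma grad_cst k z : has_grad (fun=> k) z 0 0.
Proof. by split; exact: is_derive_cst. Qed.

Lemma grad_snd z : has_grad (fun w : R * R => w.2) z 0 1.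
Proof. by split; [exact: is_derive_cst|exact: is_derive_id]. Qed.

Lemma has_grad_unique f z x1 y1 x2 y2 : has_grad f z x1 y1 -> has_grad f z x2 y2 ->
  x1 = x2 /\ y1 = y2.
Proof. by move=> [[_ <-] [_ <-]] [[_ <-] [_ <-]]. Qed.

Lemma interior_cts g z : ctsOm g -> Om z -> {for z, continuous g}.
Proof.
move=> cg Oz; apply/cts_boxP => e e0.
have [d1 d10 H] := within_boxP cg (subset_closure Oz) e0.
have [d2 d20 H2] := open_boxP (@open_Om R r0) Oz.
exists (Num.min d1 d2); first by rewrite lt_min d10.
move=> w; rewrite !lt_min => /andP[a1 a2] /andP[b1 b2].
by apply: H => //; exact/subset_closure/H2.
Qed.

Let mixed_u z : Om z -> uxy z = uyx z.
Proof.
move=> Oz; apply: (clairaut (@open_Om R r0) Oz gu) => [w /gux[]|w /guy[]||] //.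
- exact: interior_cts.
- exact: interior_cts.
Qed.

Let mixed_v z : Om z -> vxy z = vyx z.
Proof.
move=> Oz; apply: (clairaut (@open_Om R r0) Oz gv) => [w /gvx[]|w /gvy[]||] //.
- exact: interior_cts.
- exact: interior_cts.
Qed.

Let div_grad z : Om z -> uxx z + vyx z = 0 /\ uxy z + vyy z = 0.
Proof.
move=> Oz; apply: (has_grad_unique (gradD (gux Oz) (gvy Oz))).
exact: (has_grad_local (@open_Om R r0) Oz div0 (grad_cst 0 z)).
Qed.

Let gom z : Om z -> has_grad om z (omx z) (omy z).
Proof. by move=> Oz; apply: gradB; [exact: gvx|exact: guy]. Qed.

(** Incompressibility and symmetry of mixed derivatives turn the Laplacian of [(u, v)] into
    [(- omy, omx)], and the convection is the gradient of [(u^2 + v^2) / 2] plus [om * (- v, u)].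
    The terms [b * v] and [a * y * u] of the head take up the linear drift in the same way, leaving
    multiples of [om], collected in [f1] and [f2], and the field [a * (- v, u)]. *)
Let gq z : Om z -> has_grad q z (- f2 z - a * v z) (f1 z + a * u z).
Proof.
move=> Oz.
have G := gradD (gradD (gradD (gp Oz) (gradM (gradD (gradM (gu Oz) (gu Oz)) (gradM (gv Oz) (gv Oz))) (grad_cst 2^-1 z)))
  (gradM (grad_cst b z) (gv Oz))) (gradM (gradM (grad_cst a z) (grad_snd z)) (gu Oz)).
have [e1 e2] := div_grad Oz; have m1 := mixed_u Oz; have m2 := mixed_v Oz; have d0 := div0 Oz.
have -> : - f2 z - a * v z =
  uxx z + uyy z - (u z * ux z + v z * uy z) - (a * z.2 * ux z + b * uy z) - a * v z
  + ((u z * u z + v z * v z) * 0 + 2^-1 * (u z * ux z + u z * ux z + (v z * vx z + v z * vx z)))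
  + (b * vx z + v z * 0) + (a * z.2 * ux z + u z * (a * 0 + z.2 * 0)).
  have -> : uxx z = - vxy z by rewrite m2; lra.
  by rewrite /f2 /omy /om; field.
have -> : f1 z + a * u z =
  vxx z + vyy z - (u z * vx z + v z * vy z) - (a * z.2 * vx z + b * vy z)
  + ((u z * u z + v z * v z) * 0 + 2^-1 * (u z * uy z + u z * uy z + (v z * vy z + v z * vy z)))
  + (b * vy z + v z * 0) + (a * z.2 * uy z + u z * (a * 1 + z.2 * 0)).
  have -> : vyy z = - uyx z by rewrite -m1; lra.
  by rewrite /f1 /omx /om; field.
exact: G.
Qed.

Let vx_axis : forall x, r0 < `|x| -> vx (x, 0) = 0.
Proof. exact: axis_dx cv cvx gv v_axis. Qed.

Let om_axis x : r0 < `|x| -> om (x, 0) = 0.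
Proof. by move=> xr; rewrite /om vx_axis// uy_axis// subrr. Qed.

Let omx_axis : forall x, r0 < `|x| -> omx (x, 0) = 0.
Proof. exact: axis_dx com comx gom om_axis. Qed.

Let f1_axis x : r0 < `|x| -> f1 (x, 0) = 0.
Proof. by move=> xr; rewrite /f1 omx_axis// om_axis// mulr0 subrr. Qed.

Let cut_ev g : ctsOm g -> continuous (cut r0 (ev g)).
Proof. by move=> cg; apply: cut_cts => z; exact: ev_cts. Qed.

Let cut_od g : ctsOm g -> (forall x, r0 < `|x| -> g (x, 0) = 0) -> continuous (cut r0 (od g)).
Proof. by move=> cg g0; apply: cut_cts => z; exact: od_cts. Qed.

Let r1 := r0 + 2.
Let r1r0 z : r1 < enorm z -> r0 < enorm z. Proof. by rewrite /r1; lra. Qed.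

Let U := cut r0 (ev u).
Let Ux := cut r0 (ev ux).
Let Uy := cut r0 (od uy).
Let V := cut r0 (od v).
Let Vx := cut r0 (od vx).
Let Vy := cut r0 (ev vy).
Let F1 := cut r0 (od f1).
Let F2 := cut r0 (ev f2).

Let gU z : r1 < enorm z -> has_grad U z (Ux z) (Uy z).
Proof.
move=> h; rewrite /Ux /Uy !cutE//; apply: cut_grad => //.
by apply: (even_grad (r0 := r0)) => //; exact: r1r0.
Qed.

Let gV z : r1 < enorm z -> has_grad V z (Vx z) (Vy z).
Proof.
move=> h; rewrite /Vx /Vy !cutE//; apply: cut_grad => //.
by apply: (odd_grad (r0 := r0)) => //; exact: r1r0.
Qed.

Let WE z : Vx z - Uy z = cut r0 (od om) z.
Proof. by rewrite /Vx /Uy /cut /od -!mulrBr. Qed.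

Let gW z : r1 < enorm z -> has_grad (fun z => Vx z - Uy z) z (cut r0 (od omx) z) (cut r0 (ev omy) z).
Proof.
move=> h; have -> : (fun z => Vx z - Uy z) = cut r0 (od om) by apply/funext => w; exact: WE.
rewrite (cutE (od omx))// (cutE (ev omy))//; apply: cut_grad => //.
by apply: (odd_grad (r0 := r0)) => //; exact: r1r0.
Qed.

Let axis_point z : z.2 = 0 -> fold_up z = (z.1, 0).
Proof. by rewrite /fold_up => ->; rewrite normr0. Qed.

Let axis_norm z : z.2 = 0 -> r0 < enorm z -> r0 < `|z.1|.
Proof. by move=> z2; rewrite /enorm z2 expr0n addr0 sqrtr_sqr. Qed.

Let UVdiv z : r1 < enorm z -> Ux z + Vy z = 0.
Proof.
move=> h; rewrite /Ux /Vy !cutE//; have h0 := r1r0 h.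
have [z2|z2] := eqVneq z.2 0; last exact: div0 (fold_Om h0 z2).
(* On the axis, by continuity of the divergence. *)
have cd := ctsOm_add cux cvy.
apply/eqP; rewrite -normr_le0; apply/ler_addgt0Pl => e e0; rewrite addr0.
have /cts_boxP/(_ _ e0)[dl dl0 H] := ev_cts cd h0.
have [d2 d20 H2] := open_boxP (@open_exterior R r0) (h0 : [set w | r0 < enorm w] z).
pose t := Num.min dl d2 / 2.
have m0 : 0 < Num.min dl d2 by rewrite lt_min dl0.
have t0 : 0 < t by rewrite divr_gt0.
have : t < Num.min dl d2 by rewrite /t ltr_pdivrMr// ltr_pMr ?ltr1n.
rewrite lt_min => /andP[t1 t2].
have tz : `|(z.1, t).2 - z.2| = t by rewrite /= z2 subr0 gtr0_norm.
have xz : `|(z.1, t).1 - z.1| = 0 by rewrite /= subrr normr0.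
have Et : r0 < enorm (z.1, t) by apply: H2; rewrite ?tz ?xz.
have := H (z.1, t) ltac:(by rewrite xz) ltac:(by rewrite tz).
rewrite [ev _ (z.1, t)](_ : _ = 0); last by apply: div0; apply: fold_Om; rewrite //= gt_eqF.
by rewrite sub0r normrN.
Qed.

Let K := `|a| + `|b|.
Let B z := enorm (U z, V z) + K * (1 + enorm z).

Let hF1 z : r1 < enorm z -> `|cut r0 (od omx) z - F1 z| <= B z * `|Vx z - Uy z|.
Proof.
move=> h; rewrite WE /F1 !cutE// /od -mulrBr !normrM.
have -> : omx (fold_up z) - f1 (fold_up z) = (u (fold_up z) + a * `|z.2|) * om (fold_up z).
  by rewrite /f1 /=; ring.
rewrite normrM mulrCA ler_wpM2r ?mulr_ge0//.
apply: le_trans (ler_normD _ _) _; rewrite /B; apply: lerD.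
  by have := le_enorm1 (U z, V z); rewrite /U /= cutE.
rewrite normrM normr_id; apply: ler_pM => //; first by rewrite /K lerDl.
by apply: le_trans (le_enorm2 z) _; rewrite lerDr.
Qed.

Let hF2 z : r1 < enorm z -> `|cut r0 (ev omy) z - F2 z| <= B z * `|Vx z - Uy z|.
Proof.
move=> h; rewrite WE /F2 !cutE// /ev.
have -> : omy (fold_up z) - f2 (fold_up z) = (v (fold_up z) + b) * om (fold_up z).
  by rewrite /f2 /=; ring.
(* The sign in [od] makes [V] zero on the axis, so [|v|] is compared with [|V|] off the axis only;
   on it [om] vanishes. *)
have [z2|z2] := eqVneq z.2 0.
  rewrite axis_point// om_axis ?mulr0 ?normr0 ?mulr_ge0//; last exact/axis_norm/r1r0.
  by rewrite addr_ge0 ?enorm_ge0// mulr_ge0 ?addr_ge0 ?enorm_ge0.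
rewrite /od !normrM normr_sg z2 mul1r ler_wpM2r//.
apply: le_trans (ler_normD _ _) _; rewrite /B; apply: lerD.
  have := le_enorm2 (U z, V z); rewrite /V /= cutE// /od normrM normr_sg z2 mul1r.
  by [].
rewrite -[X in X <= _]mulr1; apply: ler_pM => //; first by rewrite /K lerDr.
by rewrite lerDl enorm_ge0.
Qed.

Let potential c (rho : R) : 0 < rho ->
  (forall w, enorm (w - c) < rho -> r1 < enorm w) ->
  exists Q, forall w, enorm (w - c) < rho / 2 -> has_grad Q w (- F2 w) (F1 w).
Proof.
have cF2 : continuous (fun w => - F2 w) by apply: cts_opp; exact: cut_ev.
apply: (@local_potential R (fun w => - F2 w) F1 U V Ux Uy Vx Vy (ev q) a r1 cF2
  (cut_od cf1 f1_axis) (cut_ev cu) (cut_od cv v_axis) (cut_ev cux) (cut_ev cvy) gU gV UVdiv).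
move=> z h z2; rewrite /F2 /F1 /U /V !cutE//.
have := ev_grad (g1 := fun z => - f2 z - a * v z) (g2 := fun z => f1 z + a * u z) z2
  (gq (fold_Om (r1r0 h) z2)).
(* The even reflection of [v] is the sign times [V], and the odd reflection of [u] is the sign times
   [U]: this is the jump in the gradient of the reflected head. *)
have sg2 : Num.sg z.2 * Num.sg z.2 = 1 by rewrite -expr2 sqr_sg z2.
have -> : - ev f2 z - a * Num.sg z.2 * od v z = ev (fun z => - f2 z - a * v z) z.
  rewrite /od /ev -[X in _ = _ - X]mul1r -sg2; ring.
have -> // : od f1 z + a * Num.sg z.2 * ev u z = od (fun z => f1 z + a * u z) z.
by rewrite /od /ev; ring.
Qed.

Let energy_finite :
  (\int[leb2]_z (Ux z ^+ 2 + Uy z ^+ 2 + Vx z ^+ 2 + Vy z ^+ 2)%:E < +oo)%E.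
Proof.
have cUx := cut_ev cux; have cUy := cut_od cuy uy_axis.
have cVx := cut_od cvx vx_axis; have cVy := cut_ev cvy.
apply: (half_plane_energy (r0 := r0)
  (g := fun z => ux z ^+ 2 + uy z ^+ 2 + vx z ^+ 2 + vy z ^+ 2)) => //.
- by do 3 (apply: cts_add; last exact: cts_exp); exact: cts_exp.
- by move=> z; rewrite !addr_ge0// sqr_ge0.
- move=> z; have ff : fold_up (flip z) = fold_up z by rewrite /fold_up /flip /= normrN.
  have fe : cutoff r0 (flip z) = cutoff r0 z.
    by rewrite /cutoff -[enorm (flip z)]enorm_fold ff enorm_fold.
  by rewrite /Ux /Uy /Vx /Vy /cut /ev /od fe ff /flip /= sgrN; ring.
- move=> z Oz.
  have sq g : ctsOm g -> {for z, continuous (fun z => g z ^+ 2)}.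
    move=> cg; apply: (@continuous_comp _ _ _ g (fun y => y ^+ 2)); first exact: interior_cts.
    exact: exprn_continuous.
  by apply: cvgD; [apply: cvgD; [apply: cvgD|]|]; exact: sq.
- by move=> z _; rewrite !addr_ge0// sqr_ge0.
- move=> z z2 _.
  have fz : fold_up z = z by rewrite /fold_up gtr0_norm// -surjective_pairing.
  rewrite /Ux /Uy /Vx /Vy /cut /ev /od fz gtr0_sg// !mul1r !exprMn.
  have /andP[_ c1] := cutoff_sq r0 z.
  by rewrite !lerD// ler_piMl// sqr_ge0.
- move=> z z2 nO.
  have rz : enorm z <= r0 by rewrite leNgt; apply/negP => rz; apply: nO; split.
  rewrite /Ux /Uy /Vx /Vy /cut cutoff0; last by lra.
  by rewrite !mul0r expr0n /= !addr0.
Qed.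

Theorem flow_decay (eps : R) : 0 < eps -> exists R0, forall z, 0 <= z.2 -> R0 <= enorm z ->
  enorm (u z, v z) <= eps * Num.sqrt (ln (enorm z)).
Proof.
move=> eps0.
have r10 : 0 < r1 by rewrite addr_gt0.
have K0 : 0 <= K by rewrite addr_ge0.
have [R0 H] := @decay R r1 K U V Ux Uy Vx Vy (cut r0 (od omx)) (cut r0 (ev omy)) F1 F2 r10 K0
  (cut_ev cu) (cut_od cv v_axis) (cut_ev cux) (cut_od cuy uy_axis) (cut_od cvx vx_axis) (cut_ev cvy)
  (cut_od comx omx_axis) (cut_ev comy) (cut_od cf1 f1_axis) (cut_ev cf2) gU gV gW UVdiv hF1 hF2 potential energy_finite eps eps0.
exists (Num.max R0 (r1 + 1)) => z z2; rewrite ge_max => /andP[zR zr].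
have h : r1 < enorm z by lra.
have := H z zR; have fz : fold_up z = z by rewrite /fold_up ger0_norm// -surjective_pairing.
rewrite /U /V !cutE// /ev /od fz.
have [z20|zn0] := eqVneq z.2 0; last by rewrite gtr0_sg ?mul1r// lt_neqAle eq_sym zn0.
rewrite z20 sgr0 mul0r.
by have -> : v z = 0 by rewrite [z]surjective_pairing z20; apply/v_axis/axis_norm/r1r0.
Qed.

End ReflectedFlow.

(** * Derivatives extended to the closure *)

Section ClosureData.
Context {R : realType}.
Variable r0 : R.
Implicit Types (f g : R * R -> R) (z w : R * R).
Notation Om := (@Omega0 R r0).
Notation ctsOm f := {within closure Om, continuous f}.

(** Density of the domain in its closure. It identifies the extension of the [y] derivative of [u]
    named in the theorem with the one obtained from C^2 regularity. *)
Lemma closure_extension_unique g1 g2 : ctsOm g1 -> ctsOm g2 ->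
  (forall z, Om z -> g1 z = g2 z) -> forall z, closure Om z -> g1 z = g2 z.
Proof.
move=> c1 c2 g12 z Cz; apply/eqP; rewrite -subr_eq0 -normr_le0.
apply/ler_addgt0Pl => e e0; rewrite addr0.
have [dl dl0 H] := within_boxP (ctsOm_sub c1 c2) Cz e0.
have [w [Ow [w1 w2]]] := Cz _ (nbhsx_ballx z dl dl0).
have := H w (subset_closure Ow); rewrite g12// subrr sub0r normrN.
by apply; rewrite distrC.
Qed.

Lemma flat_closure x : r0 < `|x| -> closure Om (x, 0).
Proof.
move=> xr; have := @fold_closure R r0 (x, 0); rewrite /fold_up /= normr0; apply.
by rewrite /enorm /= expr0n addr0 sqrtr_sqr.
Qed.

(** The second derivatives are those of [dx f] and [dy f], which agree with the extensions [fx] and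
    [fy] on the domain only; as the domain is open, [has_grad_local] transfers them. *)
Lemma C2_data f : Ck_closure 2 Om f ->
  exists fx fy fxx fxy fyx fyy : R * R -> R,
  [/\ ctsOm f, [/\ ctsOm fx, ctsOm fy & [/\ ctsOm fxx, ctsOm fxy, ctsOm fyx & ctsOm fyy]],
   forall z, Om z -> [/\ has_grad f z (fx z) (fy z), has_grad fx z (fxx z) (fxy z) &
     has_grad fy z (fyx z) (fyy z)] &
   forall z, Om z -> [/\ fx z = dx f z, fy z = dy f z, fxx z = dx (dx f) z & fyy z = dy (dy f) z]].
Proof.
move=> [cf [_ [df [[fx [cfx fxE]] [dfx [[fxx [cfxx fxxE]] _] [[fxy [cfxy fxyE]] _]]]
  [[fy [cfy fyE]] [dfy [[fyx [cfyx fyxE]] _] [[fyy [cfyy fyyE]] _]]]]]].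
exists fx, fy, fxx, fxy, fyx, fyy; split => //.
  move=> z Oz; split.
  - by rewrite fxE// fyE//; apply: dxy_has_grad; [exact: (df z Oz).1|exact: (df z Oz).2].
  - rewrite fxxE// fxyE//; apply: (has_grad_local (@open_Om R r0) Oz fxE).
    by apply: dxy_has_grad; [exact: (dfx z Oz).1|exact: (dfx z Oz).2].
  - rewrite fyxE// fyyE//; apply: (has_grad_local (@open_Om R r0) Oz fyE).
    by apply: dxy_has_grad; [exact: (dfy z Oz).1|exact: (dfy z Oz).2].
by move=> z Oz; rewrite fxE// fyE// fxxE// fyyE.
Qed.

End ClosureData.

Theorem theorem1 (R : realType) (r0 a b : R) (u v p uy : R * R -> R)
  (hr0 : 0 < r0)
  (hu : Ck_closure 2 (Omega0 r0) u) (hv : Ck_closure 2 (Omega0 r0) v)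
  (hsys : solves_system a b (Omega0 r0) u v p)
  (hbv : vanishes_on_flat_boundary r0 v)
  (huy : continuous_extension (Omega0 r0) (dy u) uy)
  (hbuy : vanishes_on_flat_boundary r0 uy)
  (hD : (\int[(@lebesgue_measure R \x @lebesgue_measure R)%E]_(z in Omega0 r0)
           (grad_sq u v z)%:E < +oo)%E) :
  {uniform `[0, pi],
    (fun r theta : R =>
       enorm (u (polar r theta), v (polar r theta)) / Num.sqrt (ln r))
      @ +oo --> (fun=> 0)}.
Proof.
have [ux [uy' [uxx [uxy [uyx [uyy [cu [cux cuy [cuxx cuxy cuyx cuyy]] gu uE]]]]]]] := C2_data hu.
have [vx [vy [vxx [vxy [vyx [vyy [cv [cvx cvy [cvxx cvxy cvyx cvyy]] gv vE]]]]]]] := C2_data hv.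
have uy'0 x : r0 < `|x| -> uy' (x, 0) = 0.
  move=> xr; rewrite -[RHS](hbuy x xr).
  apply: (@closure_extension_unique _ _ _ _ cuy huy.1 _ _ (flat_closure xr)).
  by move=> z Oz; have [_ -> _ _] := uE z Oz; rewrite huy.2.
have gp z : Omega0 r0 z -> has_grad p z
  (uxx z + uyy z - (u z * ux z + v z * uy' z) - (a * z.2 * ux z + b * uy' z) - a * v z)
  (vxx z + vyy z - (u z * vx z + v z * vy z) - (a * z.2 * vx z + b * vy z)).
  move=> Oz; have [dp e1 e2 _] := hsys z Oz.
  have [-> -> -> ->] := uE z Oz; have [-> -> -> ->] := vE z Oz.
  rewrite -[X in has_grad _ _ X _]/(laplacian u z - convection u v u z
    - (a * z.2 * dx u z + b * dy u z) - a * v z) e1.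
  rewrite -[X in has_grad _ _ _ X]/(laplacian v z - convection u v v z
    - (a * z.2 * dx v z + b * dy v z)) e2.
  by apply: dxy_has_grad; exact: diff_derivable.
have div z : Omega0 r0 z -> ux z + vy z = 0.
  move=> Oz; have [_ _ _ e] := hsys z Oz.
  by have [-> _ _ _] := uE z Oz; have [_ -> _ _] := vE z Oz.
have fin : (\int[(@lebesgue_measure R \x @lebesgue_measure R)%E]_(z in Omega0 r0)
    (ux z ^+ 2 + uy' z ^+ 2 + vx z ^+ 2 + vy z ^+ 2)%:E < +oo)%E.
  rewrite (_ : (\int[_]_(z in _) _)%E = (\int[(@lebesgue_measure R \x @lebesgue_measure R)%E]_(z in Omega0 r0)
    (grad_sq u v z)%:E)%E)//.
  apply: eq_integral => z; rewrite inE => Oz; rewrite /grad_sq.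
  by have [-> -> _ _] := uE z Oz; have [-> -> _ _] := vE z Oz.
have decay := @flow_decay R r0 a b u ux uy' uxx uxy uyx uyy v vx vy vxx vxy vyx vyy p hr0.
move=> P /uniform_nbhs [E [entE EP]].
move: entE; rewrite -entourage_ballE => -[eps /= eps0 ballE].
(* Half of [eps], since the bound obtained is not strict and membership in a ball is. *)
have e2 : 0 < eps / 2 by rewrite divr_gt0.
have [R0 H] := decay cu cux cuy cuxy cuyx cuyy cv cvx cvy cvxx cvxy cvyx (fun z Oz => let: And3 h _ _ := gu z Oz in h)
  (fun z Oz => let: And3 _ h _ := gu z Oz in h) (fun z Oz => let: And3 _ _ h := gu z Oz in h)
  (fun z Oz => let: And3 h _ _ := gv z Oz in h) (fun z Oz => let: And3 _ h _ := gv z Oz in h)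
  (fun z Oz => let: And3 _ _ h := gv z Oz in h) gp div hbv uy'0 fin (eps / 2) e2.
exists (Num.max R0 1); split; first exact: num_real.
move=> r; rewrite gt_max => /andP[rR r1]; apply: EP => theta /= th; apply: ballE.
have r00 : 0 <= r by apply: ltW; apply: lt_trans r1.
have er : enorm (polar r theta) = r by rewrite /polar enorm_polar.
have up : 0 <= (polar r theta).2.
  by rewrite /polar /= mulr_ge0// sin_ge0_pi//.
have := H (polar r theta) up; rewrite er => /(_ (ltW rR)) h.
have s0 : 0 < Num.sqrt (ln r) by rewrite sqrtr_gt0 ln_gt0.
rewrite /ball /= sub0r normrN ger0_norm; last by rewrite divr_ge0 ?enorm_ge0// ltW.
by rewrite ltr_pdivrMr// (le_lt_trans h)// ltr_pM2r// ltr_pdivrMr// ltr_pMr// ltr1n.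
Qed.
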